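(* For any $p\in(1,\infty)$ the following statements are equivalent: (i) $\zeta(s)\neq0$ for $\Re s>1/p$; (ii) $\|M_1\|_r<\infty$ for all $r\in(1,p)$.
   Context: $\zeta$ is the Riemann zeta function. $M(x):=\sum_{k\le x}\mu(k)$ where $\mu$ is the Möbius function, and $M_1(\theta):=M(1/\theta)$ for $\theta>0$ (so $M_1(\theta)=0$ for $\theta>1$). $\|\cdot\|_r$ is the norm of $L_r(0,\infty)$ with Lebesgue measure (for $M_1$ this equals the $L_r(0,1)$ norm). *)

(* Defs.v *)
From HB Require Import structures.
From mathcomp Require Import all_boot all_order all_algebra.
From mathcomp Require Import all_classical all_reals all_analysis.
From mathcomp Require Import complex.

Set Implicit Arguments.
Unset Strict Implicit.
Unset Printing Implicit Defensive.

Import Order.TTheory GRing.Theory Num.Theory.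
Import numFieldNormedType.Exports.

Local Open Scope classical_set_scope.
Local Open Scope ring_scope.
Local Open Scope complex_scope.

Definition cexp (R : realType) (z : R[i]) : R[i] :=
  (expR (complex.Re z))%:C * (cos (complex.Im z) +i* sin (complex.Im z)).

(* [n.+1 ^ (- s)]: the Dirichlet series is indexed from 0. *)
Definition zeta_term (R : realType) (s : R[i]) (n : nat) : R[i] :=
  cexp (- (s * (ln n.+1%:R)%:C)).

(* The topology of [R[i]], that of its modulus, is the one inferred on the
   alias [R[i]^o]. *)
Definition analytic_at (R : realType) (f : R[i] -> R[i]) (s0 : R[i]) : Prop :=
  exists2 e : R, 0 < e &
  exists a : nat -> R[i], forall s : R[i], `|s - s0| < e%:C ->
    series (fun n => a n * (s - s0) ^+ n) @ \oo --> (f s : R[i]^o).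

(* [zeta] is the analytic continuation to C \ {1} of the Dirichlet series.
   This determines [zeta] away from the pole at 1, where its value (functions
   being total) is unconstrained. *)
Definition is_riemann_zeta (R : realType) (zeta : R[i] -> R[i]) : Prop :=
  (forall s, 1 < complex.Re s -> series (zeta_term s) @ \oo --> (zeta s : R[i]^o)) /\
  (forall s, s != 1 -> analytic_at zeta s).

Definition mobius (n : nat) : int :=
  if (0 < n)%N && all (fun q => logn q n == 1%N) (primes n)
  then (-1) ^+ size (primes n) else 0.

Definition mertens (R : realType) (x : R) : R :=
  (\sum_(1 <= k < (Num.truncn x).+1) mobius k)%:~R.

Definition M1 (R : realType) (theta : R) : R := mertens (1 / theta).

Definition lebesgue_pos (R : realType)
    : {measure set (measurableTypeR R) -> \bar R} :=
  mrestr (@lebesgue_measure R) (measurable_itv `]0, +oo[).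

(* Main.v *)
Require Import Defs.
From HB Require Import structures.
From mathcomp Require Import all_boot all_order all_algebra.
From mathcomp Require Import all_classical all_reals all_analysis.
From mathcomp Require Import measurable_realfun complex.
From mathcomp Require Import cyclic separable cyclotomic.
From mathcomp Require Import ring lra zify.

(* With M(N) the partial sums of the Moebius function, M_1 equals M(N) on
   ]1/(N+1), 1/N], so that the r-th power of its norm is the sum of the
   |M(N)|^r / (N (N+1)).

   If zeta has no zero in Re s > 1/p, Borel-Caratheodory and Hadamard's three
   circles applied to log((s - 1) zeta s) show that 1 / zeta(s) grows more slowly
   than any power of Im s on each half-plane Re s >= 1/p + 2 delta; shifting
   the line of integration in Perron's formula then gives
   M(N) = O(N^(1/p + epsilon)), and the sum converges for every r < p.
   Conversely Young's inequality turns the convergence of the sum into that of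
   sum |M(N)| N^(-1 - sigma) for sigma > 1/r, whence by partial summation
   1 / zeta extends analytically to Re s > 1/r.

   Complex analysis is done without integrals: holomorphic functions are uniform
   limits of polynomials on closed discs, Cauchy's estimates come from averages
   over roots of unity, and contour integrals are Riemann sums on vertical lines,
   moved horizontally by the discrete Cauchy-Riemann equation. *)

Set Implicit Arguments.
Unset Strict Implicit.
Unset Printing Implicit Defensive.

Import Order.TTheory GRing.Theory Num.Theory.
Import numFieldNormedType.Exports.

Local Open Scope classical_set_scope.
Local Open Scope ring_scope.
Local Open Scope complex_scope.

(** No logarithm of (s - 1) zeta s is constructed: a zero-free polynomial close to it is factored,
    and the log-modulus of each linear factor is nearly the real part of a polynomial. Of the
    resulting Taylor coefficients, those of order below K are bounded independently of Im s, from a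
    disc in Re s >= 2; the others cost log |Im s| times the K-th power of a ratio below 1, so a
    large K makes the exponent of |Im s| small. Perron's kernel 1/s is not absolutely integrable on
    vertical lines. It is replaced by ((N + 1)^s - N^s) / s^2, whose inverse transform is constant
    on the integers up to N and vanishes on those beyond. That constant is only of order 1/N; the
    loss is recovered by interpolating between two bounds for (N + 1)^s - N^s. The given zeta is
    known only through its series on Re s > 1 and its analyticity off 1, neither of which bounds its
    growth. So (s - 1) zeta s is built independently as a convergent series on Re s > 0, where
    bounds are explicit, and is identified with the given function by the identity theorem along
    paths avoiding 1. *)

Notation normc := (@ComplexField.Normc.normc _).

(** * Real-valued modulus of complex numbers *)

Section ComplexModulus.
Variable R : realType.
Implicit Types (z w : R[i]) (x y : R).

Lemma normc_sqrt z :
  normc z = Num.sqrt (complex.Re z ^+ 2 + complex.Im z ^+ 2).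
Proof. by case: z. Qed.

Lemma normc_ge0 z : 0 <= normc z.
Proof. by rewrite normc_sqrt sqrtr_ge0. Qed.

Lemma normc0 : normc (0 : R[i]) = 0.
Proof. exact: ComplexField.Normc.normc0. Qed.

Lemma normc1 : normc (1 : R[i]) = 1.
Proof. exact: ComplexField.Normc.normc1. Qed.

Lemma normc_eq0 z : (normc z == 0) = (z == 0).
Proof.
by apply/eqP/eqP => [/ComplexField.Normc.eq0_normc //|->]; exact: normc0.
Qed.

Lemma normc_gt0 z : (0 < normc z) = (z != 0).
Proof. by rewrite lt_def normc_ge0 normc_eq0 andbT. Qed.

Lemma normcM z w : normc (z * w) = normc z * normc w.
Proof. exact: ComplexField.Normc.normcM. Qed.

Lemma normcV z : normc z^-1 = (normc z)^-1.
Proof. exact: ComplexField.Normc.normcV. Qed.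

Lemma normcX z n : normc (z ^+ n) = normc z ^+ n.
Proof.
elim: n => [|n IH]; first by rewrite !expr0 normc1.
by rewrite !exprS normcM IH.
Qed.

Lemma normcD z w : normc (z + w) <= normc z + normc w.
Proof. exact: (@le_normcD R). Qed.

Lemma normcNE z : normc (- z) = normc z.
Proof. exact: (@normcN R). Qed.

Lemma normcB z w : normc (z - w) <= normc z + normc w.
Proof. by rewrite (le_trans (normcD _ _))// normcNE. Qed.

Lemma normcC z w : normc (z - w) = normc (w - z).
Proof. by rewrite -normcNE opprB. Qed.

Lemma normc_sub z w : normc z - normc w <= normc (z - w).
Proof. by rewrite lerBlDr (le_trans _ (normcD _ _))// subrK. Qed.

Lemma normc_tri z w u : normc (z - u) <= normc (z - w) + normc (w - u).
Proof. by rewrite (le_trans _ (normcD _ _))// addrA subrK. Qed.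

Lemma normc_sum I (r : seq I) (P : pred I) (F : I -> R[i]) :
  normc (\sum_(i <- r | P i) F i) <= \sum_(i <- r | P i) normc (F i).
Proof.
elim/big_rec2: _ => [|i y x _ IH]; first by rewrite normc0.
by rewrite (le_trans (normcD _ _))// lerD2l.
Qed.

Lemma normc_real x : normc x%:C = `|x|.
Proof. by rewrite /ComplexField.Normc.normc /= expr0n addr0 sqrtr_sqr. Qed.

Lemma normc_ge0_real x : 0 <= x -> normc x%:C = x.
Proof. by move=> x0; rewrite normc_real ger0_norm. Qed.

Lemma natrC n : (n%:R : R[i]) = (n%:R : R)%:C.
Proof. by rewrite rmorph_nat. Qed.

Lemma normc_nat n : normc (n%:R : R[i]) = n%:R.
Proof. by rewrite natrC normc_ge0_real. Qed.

Lemma normci : normc ('i : R[i]) = 1.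
Proof. by rewrite /ComplexField.Normc.normc /= expr0n add0r expr1n sqrtr1. Qed.

Lemma Re_le_normc z : `|complex.Re z| <= normc z.
Proof.
by rewrite normc_sqrt -sqrtr_sqr ler_wsqrtr// lerDl sqr_ge0.
Qed.

Lemma Im_le_normc z : `|complex.Im z| <= normc z.
Proof.
by rewrite normc_sqrt -sqrtr_sqr ler_wsqrtr// lerDr sqr_ge0.
Qed.

Lemma ReD z w : complex.Re (z + w) = complex.Re z + complex.Re w.
Proof. by case: z; case: w. Qed.

Lemma ImD z w : complex.Im (z + w) = complex.Im z + complex.Im w.
Proof. by case: z; case: w. Qed.

Lemma ReN z : complex.Re (- z) = - complex.Re z.
Proof. by case: z. Qed.

Lemma ImN z : complex.Im (- z) = - complex.Im z.
Proof. by case: z. Qed.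

Lemma ReM z w : complex.Re (z * w) =
  complex.Re z * complex.Re w - complex.Im z * complex.Im w.
Proof. by case: z; case: w. Qed.

Lemma Re_sum I (r : seq I) (P : pred I) (F : I -> R[i]) :
  complex.Re (\sum_(i <- r | P i) F i) = \sum_(i <- r | P i) complex.Re (F i).
Proof. by elim/big_rec2: _ => // i y x _ <-; rewrite ReD. Qed.

Lemma normc_le_ReIm z : normc z <= `|complex.Re z| + `|complex.Im z|.
Proof.
case: z => a b; have -> : a +i* b = a%:C + 'i * b%:C.
  by rewrite [LHS]complexE.
by rewrite (le_trans (normcD _ _))// normcM normci mul1r !normc_real/=
  ?mul0r ?mul1r ?mulr0 ?subr0 ?addr0 ?add0r.
Qed.

Lemma normc_lec z x : (`|z| <= x%:C) = (normc z <= x).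
Proof. by rewrite -lecR. Qed.

Lemma normc_ltc z x : (`|z| < x%:C) = (normc z < x).
Proof. by rewrite -ltcR. Qed.

End ComplexModulus.

(** * The complex exponential and its first two Taylor remainders *)

Section ComplexExponential.
Variable R : realType.
Implicit Types (z w : R[i]) (x y : R).

Lemma cexp0 : cexp (0 : R[i]) = 1.
Proof. by rewrite /cexp /= expR0 cos0 sin0 mul1r. Qed.

Lemma cexpD z w : cexp (z + w) = cexp z * cexp w.
Proof.
rewrite /cexp ReD ImD expRD cosD sinD.
case: z => a b; case: w => c d /=.
apply/eqP; rewrite eq_complex /=; apply/andP; split; apply/eqP; ring.
Qed.

Lemma cexp_real x : cexp x%:C = (expR x)%:C.
Proof. by rewrite /cexp /= cos0 sin0 mulr1. Qed.

Lemma normc_cexp z : normc (cexp z) = expR (complex.Re z).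
Proof.
rewrite /cexp normcM normc_ge0_real ?expR_ge0// normc_sqrt /=.
by rewrite cos2Dsin2 sqrtr1 mulr1.
Qed.

Lemma cexp_neq0 z : cexp z != 0.
Proof. by rewrite -normc_gt0 normc_cexp expR_gt0. Qed.

Lemma cexpN z : cexp (- z) = (cexp z)^-1.
Proof.
apply: (mulIf (cexp_neq0 z)); rewrite mulVf ?cexp_neq0//.
by rewrite -cexpD addNr cexp0.
Qed.

Lemma cexpMn z n : cexp (n%:R * z) = cexp z ^+ n.
Proof.
elim: n => [|n IH]; first by rewrite mul0r cexp0 expr0.
by rewrite exprS -IH -cexpD mulrSr mulrDl mul1r addrC.
Qed.

Lemma expR_sub1_le x : expR x - 1 <= x * expR x.
Proof.
have := expR_ge1Dx (- x); rewrite expRN => h.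
have e0 := expR_gt0 x.
have : (1 - x) * expR x <= 1.
  by rewrite -ler_pdivlMr// mul1r.
lra.
Qed.

Lemma expR_sub1_bound x : `|expR x - 1| <= `|x| * Num.max 1 (expR x).
Proof.
have h1 := expR_sub1_le x; have h2 := expR_ge1Dx x.
have [x0|x0] := leP 0 x.
  rewrite (ger0_norm x0) ger0_norm; last lra.
  by apply: (le_trans h1); rewrite ler_wpM2l// le_max lexx orbT.
rewrite (ltr0_norm x0) ler0_norm; last first.
  have : expR x <= 1 by rewrite expR_le1 ltW.
  lra.
apply: (@le_trans _ _ (- x * 1)); first lra.
by rewrite ler_wpM2l ?le_max ?lexx//; lra.
Qed.

Lemma expR_sub1x_bound x :
  `|expR x - 1 - x| <= x ^+ 2 * Num.max 1 (expR x).
Proof.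
have h1 := expR_sub1_le x; have h2 := expR_ge1Dx x.
rewrite ger0_norm; last lra.
have -> : x ^+ 2 = `|x| * `|x| by rewrite -normrM ger0_norm -?expr2 ?sqr_ge0.
rewrite -mulrA (le_trans _ (ler_wpM2l _ (expR_sub1_bound x)))//.
by rewrite -normrM (le_trans _ (ler_norm _))//; lra.
Qed.

Lemma abs_sin_le y : `|sin y| <= `|y|.
Proof.
wlog y0 : y / 0 < y => [H|].
  case: (ltgtP y 0) => [y0|y0|->]; [|exact: H|by rewrite sin0 normr0].
  by rewrite -(normrN y) -(normrN (sin y)) -sinN; apply: H; rewrite oppr_gt0.
have [|c _] := @MVT_segment R sin cos 0 y (ltW y0).
  by apply: continuous_subspaceT => x; exact: continuous_sin.
rewrite sin0 !subr0 => ->.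
by rewrite normrM ler_piMl// cos_max.
Qed.

Lemma sqr_le_norm x y : `|x| <= `|y| -> x ^+ 2 <= y ^+ 2.
Proof.
move=> h; rewrite -(real_normK (num_real x)) -(real_normK (num_real y)).
by rewrite lerXn2r ?nnegrE.
Qed.

Lemma abs_cos_sub1_le y : `|cos y - 1| <= y ^+ 2.
Proof.
have -> : cos y - 1 = - (2 * sin (y / 2) ^+ 2).
  have {1}-> : y = (y / 2) *+ 2 by rewrite -mulr_natr; field.
  by rewrite cos_mulr2n cos2sin2; ring.
rewrite normrN ger0_norm; last by rewrite mulr_ge0 ?sqr_ge0.
have : sin (y / 2) ^+ 2 <= (y / 2) ^+ 2.
  by apply: sqr_le_norm; exact: abs_sin_le.
have := sqr_ge0 y.
nra.
Qed.

Lemma abs_sin_sub_le y : `|sin y - y| <= y ^+ 2.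
Proof.
wlog y0 : y / 0 < y => [H|].
  case: (ltgtP y 0) => [y0|y0|->]; [|exact: H|by rewrite sin0 subr0 normr0 expr0n].
  have := H (- y); rewrite sinN sqrrN -opprD normrN; apply.
  by rewrite oppr_gt0.
have [|c cI] := @MVT_segment R (fun x => sin x - x) (fun x => cos x - 1) 0 y (ltW y0).
- apply: continuous_subspaceT => x; apply: cvgB; [exact: continuous_sin|exact: cvg_id].
rewrite sin0 !subr0 => ->.
rewrite normrM (gtr0_norm y0) expr2 ler_pM2r//.
have [y1|y1] := leP 2 y.
  rewrite (le_trans _ y1)//.
  have := cos_max c; have := ler_normB (cos c) 1; rewrite normr1; lra.
have -> : cos c - 1 = - (2 * sin (c / 2) ^+ 2).
  have {1}-> : c = (c / 2) *+ 2 by rewrite -mulr_natr; field.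
  by rewrite cos_mulr2n cos2sin2; ring.
rewrite normrN ger0_norm; last by rewrite mulr_ge0 ?sqr_ge0.
have /andP[c0 cy] : 0 <= c <= y by move: cI; rewrite in_itv /=.
have : sin (c / 2) ^+ 2 <= (c / 2) ^+ 2.
  by apply: sqr_le_norm; exact: abs_sin_le.
nra.
Qed.

Lemma cexp_sub1x_bound z :
  normc (cexp z - 1 - z) <=
  4 * normc z ^+ 2 * Num.max 1 (expR (complex.Re z)).
Proof.
case: z => x y; set M := Num.max _ _.
have M1 : 1 <= M by rewrite /M le_max lexx.
have Me : expR x <= M by rewrite /M le_max lexx orbT.
have e0 := expR_gt0 x.
(* A real second-order remainder, a trigonometric remainder, and the mixed term i y (e^x - 1). *)
have -> : cexp (x +i* y) - 1 - (x +i* y) =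
   (expR x - 1 - x)%:C + (expR x)%:C * ((cos y - 1) +i* (sin y - y))
   + 'i * (y * (expR x - 1))%:C.
  rewrite /cexp /=; apply/eqP; rewrite eq_complex /=; apply/andP; split; apply/eqP; ring.
have hx := expR_sub1x_bound x; have hx1 := expR_sub1_bound x.
rewrite -/M in hx hx1.
have hc := abs_cos_sub1_le y; have hs := abs_sin_sub_le y.
have nz : normc (x +i* y) ^+ 2 = x ^+ 2 + y ^+ 2.
  by rewrite normc_sqrt /= sqr_sqrtr// addr_ge0 ?sqr_ge0.
rewrite nz (le_trans (normcD _ _))//.
have h1 : normc ((expR x - 1 - x)%:C : R[i]) <= x ^+ 2 * M by rewrite normc_real.
have h2 : normc ((expR x)%:C * ((cos y - 1) +i* (sin y - y))) <= M * (2 * y ^+ 2).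
  rewrite normcM normc_ge0_real ?(ltW e0)// ler_pM ?(ltW e0) ?normc_ge0//.
  by rewrite (le_trans (normc_le_ReIm _))//=; lra.
have h3 : normc ('i * (y * (expR x - 1))%:C) <= `|y| * `|x| * M.
  by rewrite normcM normci mul1r normc_real normrM -mulrA ler_wpM2l.
have h4 : `|y| * `|x| <= x ^+ 2 + y ^+ 2.
  rewrite -(real_normK (num_real x)) -(real_normK (num_real y)).
  have := sqr_ge0 (`|x| - `|y|); have := normr_ge0 x; have := normr_ge0 y; nra.
have h5 := normcD (expR x - 1 - x)%:C ((expR x)%:C * ((cos y - 1) +i* (sin y - y))).
have h6 : `|y| * `|x| * M <= (x ^+ 2 + y ^+ 2) * M by rewrite ler_wpM2r//; lra.
apply: (@le_trans _ _ (x ^+ 2 * M + M * (2 * y ^+ 2) + (x ^+ 2 + y ^+ 2) * M)).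
  by lra.
have := sqr_ge0 x; have := sqr_ge0 y => a b.
have : 0 <= x ^+ 2 * M by rewrite mulr_ge0//; lra.
have : 0 <= y ^+ 2 * M by rewrite mulr_ge0//; lra.
lra.
Qed.

Lemma cexp_sub1_bound z :
  normc (cexp z - 1) <=
  5 * normc z * Num.max 1 (expR (complex.Re z)).
Proof.
set M := Num.max _ _.
have M1 : 1 <= M by rewrite /M le_max lexx.
have Me : expR (complex.Re z) <= M by rewrite /M le_max lexx orbT.
have n0 := normc_ge0 z.
have [z1|z1] := leP (normc z) 1.
  have -> : cexp z - 1 = (cexp z - 1 - z) + z by rewrite subrK.
  rewrite (le_trans (normcD _ _))//.
  have := cexp_sub1x_bound z; rewrite -/M.
  have : normc z ^+ 2 <= normc z by rewrite expr2 ler_piMl.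
  have : 0 <= normc z * (M - 1) by rewrite mulr_ge0//; lra.
  nra.
rewrite (le_trans (normcB _ _))// normc1 normc_cexp.
have : 0 <= (normc z - 1) * M by rewrite mulr_ge0//; lra.
nra.
Qed.

End ComplexExponential.

(** * Coefficient estimates for complex polynomials *)

Section PolynomialEstimates.
Variable R : realType.
Local Notation C := R[i].
Implicit Types (p q : {poly C}) (z w : C) (r B : R).

(** X^N - 1 is separable in characteristic zero, so it has [N] distinct roots, and among [N]
    distinct roots of unity of order dividing [N] one is primitive. *)
Lemma prim_root_complex N : (0 < N)%N -> exists w : C, N.-primitive_root w.
Proof.
move=> N0; pose p : {poly C} := 'X^N - 1.
have [s Dp] := closed_field_poly_normal p.
rewrite (monicP _) ?monicXnsubC// scale1r in Dp.
have sN : all N.-unity_root s by apply/allP=> z; rewrite -root_prod_XsubC -Dp.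
have szs : (N < (size s).+1)%N.
  by rewrite -(size_prod_XsubC s id) -Dp size_XnsubC.
have [|z _ zP] := hasP (has_prim_root N0 sN _ szs); last by exists z.
by rewrite -separable_prod_XsubC -Dp separable_Xn_sub_1// pnatr_eq0 -lt0n.
Qed.

Lemma normc_unity w N : (0 < N)%N -> w ^+ N = 1 -> normc w = 1.
Proof.
move=> N0 wN; apply/eqP.
by rewrite -(@pexpr_eq1 _ _ N) ?normc_ge0// -normcX wN normc1.
Qed.

Lemma unity_geometric_sum w N : w ^+ N = 1 -> w != 1 ->
  \sum_(k < N) w ^+ k = 0.
Proof.
move=> wN w1; have /eqP := subrX1 w N.
by rewrite wN subrr eq_sym mulf_eq0 subr_eq0 (negPf w1) => /eqP.
Qed.

(** Discrete Fourier inversion: with at least as many nodes as coefficients there is no aliasing, so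
    the average is exactly one coefficient. It takes the place of Cauchy's integral formula. *)
Lemma unity_average p N n w z : N.-primitive_root w ->
  (size p <= N)%N -> (n < N)%N ->
  \sum_(k < N) p.[z * w ^+ k] * w^-1 ^+ (k * n) = N%:R * (p`_n * z ^+ n).
Proof.
move=> wP sp nN; have N0 := leq_ltn_trans (leq0n n) nN.
have w0 : w != 0 by rewrite (prim_root_eq0 wP) -lt0n.
under eq_bigr do rewrite (horner_coef_wide _ sp) mulr_suml.
rewrite exchange_big /= (bigD1 (Ordinal nN)) //= [X in _ + X]big1 ?addr0.
  under eq_bigr => k _.
    rewrite exprMn -exprM -!mulrA -exprMn mulfV// expr1n mulr1; over.
  by rewrite sumr_const card_ord mulr_natl.
move=> j jn.
under eq_bigr => k _.
  rewrite exprMn -exprM mulnC (mulnC k n) !exprM -!mulrA -exprMn; over.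
rewrite -!mulr_sumr unity_geometric_sum ?mulr0//.
  rewrite exprMn -!exprM mulnC (mulnC n) !exprM exprVn (prim_expr_order wP).
  by rewrite invr1 !expr1n mulr1.
apply: contraNneq jn => h; apply/eqP/val_inj => /=.
have : w ^+ j == w ^+ n.
  by rewrite -(divfK (expf_neq0 n w0) (w ^+ j)) -exprVn h mul1r.
by rewrite (eq_prim_root_expr wP) !modn_small// => /eqP.
Qed.

Lemma cauchy_estimate p r B n : 0 <= r ->
  (forall z, normc z <= r -> normc p.[z] <= B) -> normc p`_n * r ^+ n <= B.
Proof.
move=> r0 pB; pose N := (maxn (size p) n).+1.
have sp : (size p <= N)%N by rewrite /N ltnW// ltnS leq_maxl.
have nN : (n < N)%N by rewrite /N ltnS leq_maxr.
have [w wP] := @prim_root_complex N isT.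
have w1 : normc w = 1 by apply: (@normc_unity w N) => //; exact: prim_expr_order.
have N0 : 0 < N%:R :> R by rewrite ltr0n.
have := @unity_average p N n w r%:C wP sp nN.
move/(congr1 normc); rewrite !normcM normc_nat normcX normc_ge0_real// => h.
rewrite -(ler_pM2l N0) -h (le_trans (normc_sum _ _ _))//.
rewrite mulr_natl -[X in _ *+ X]card_ord -sumr_const; apply: ler_sum => k _.
rewrite normcM normcX normcV w1 invr1 expr1n mulr1 pB//.
by rewrite normcM normcX w1 expr1n mulr1 normc_ge0_real.
Qed.

(** At the nodes the conjugate of [q] carries only opposite frequencies, so q and q + conj q = 2 Re
    q have the same n-th Fourier coefficient for n > 0, and subtracting the constant 2 B does not
    alter it. What is averaged then has modulus 2 (B - Re q), whose mean is 2 B because [q] has no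
    constant term. *)
Lemma borel_caratheodory q r B n : 0 <= r -> q`_0 = 0 ->
  (forall z, normc z <= r -> complex.Re q.[z] <= B) ->
  normc q`_n * r ^+ n <= 2 * B.
Proof.
move=> r0 q0 qB.
have B0 : 0 <= B by have := qB 0; rewrite normc0 horner_coef0 q0 => ->.
have [->|n0] := posnP n.
  by rewrite q0 normc0 mul0r mulr_ge0.
pose N := (size q + n).+1.
have sq : (size q <= N)%N by rewrite /N ltnW// ltnS leq_addr.
have nN : (n < N)%N by rewrite /N ltnS leq_addl.
have N_gt0 : (0 < N)%N by [].
have [w wP] := @prim_root_complex N isT.
have wN := prim_expr_order wP.
have w1 : normc w = 1 by exact: (@normc_unity w N).
have w0 : w != 0 by rewrite -normc_gt0 w1.
have N0 : 0 < N%:R :> R by rewrite ltr0n.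
have cw : conjc w = w^-1.
  apply: (mulfI w0); rewrite mulfV// -sqr_normc /Num.norm /= w1.
  by rewrite -rmorphXn expr1n.
pose zk (k : 'I_N) : C := r%:C * w ^+ k.
have nzk k : normc (zk k) <= r.
  by rewrite normcM normcX w1 expr1n mulr1 normc_ge0_real.
have e1 := @unity_average q N n w r%:C wP sq nN.
(* Conjugation turns frequency [n] into [N - n], and [N] was taken so large that [q] has no
   coefficient of that order. *)
have e2 : \sum_(k < N) conjc q.[zk k] * w^-1 ^+ (k * n) = 0.
  transitivity (conjc (\sum_(k < N) q.[zk k] * w^-1 ^+ (k * (N - n)))).
    rewrite rmorph_sum; apply: eq_bigr => k _ /=.
    rewrite rmorphM rmorphXn fmorphV /= cw invrK; congr (_ * _).
    have e : w ^+ (k * n) * w ^+ (k * (N - n)) = 1.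
      by rewrite -exprD -mulnDr subnKC 1?ltnW// mulnC exprM wN expr1n.
    by rewrite exprVn -[RHS](mulKf (expf_neq0 (k * n) w0)) e mulr1.
  rewrite unity_average//; last by rewrite ltn_subrL n0.
  have -> : q`_(N - n) = 0 by rewrite nth_default// /N -addSn addnK.
  by rewrite mul0r mulr0 rmorph0.
have e3 : \sum_(k < N) w^-1 ^+ (k * n) = 0.
  under eq_bigr do rewrite mulnC exprM.
  rewrite unity_geometric_sum//; first by rewrite -exprM mulnC exprM exprVn wN invr1 expr1n.
  rewrite exprVn invr_eq1 -(expr0 w) (eq_prim_root_expr wP) mod0n modn_small//.
  by rewrite -lt0n.
have e4 : \sum_(k < N) q.[zk k] = 0.
  have := @unity_average q N 0 w r%:C wP sq isT.
  rewrite q0 mul0r mulr0 => {2}<-; apply: eq_bigr => k _.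
  by rewrite muln0 expr0 mulr1.
have e5 : N%:R * (q`_n * r%:C ^+ n) =
    \sum_(k < N) (2 * (complex.Re q.[zk k] - B))%:C * w^-1 ^+ (k * n).
  transitivity (\sum_(k < N) (q.[zk k] + conjc q.[zk k]) * w^-1 ^+ (k * n)
     - (2 * B)%:C * \sum_(k < N) w^-1 ^+ (k * n)).
    rewrite e3 mulr0 subr0; under [RHS]eq_bigr do rewrite mulrDl.
    by rewrite big_split /= e2 addr0 -e1.
  rewrite mulr_sumr -sumrB; apply: eq_bigr => k _; rewrite -mulrBl; congr (_ * _).
  by rewrite addcJ mulrBr rmorphB/= !rmorphM/= rmorph_nat.
rewrite -(ler_pM2l N0).
have -> : N%:R * (normc q`_n * r ^+ n) = normc (N%:R * (q`_n * r%:C ^+ n)).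
  by rewrite !normcM normc_nat normcX normc_ge0_real.
rewrite e5 (le_trans (normc_sum _ _ _))//.
have -> : N%:R * (2 * B) = \sum_(k < N) 2 * (B - complex.Re q.[zk k]).
  rewrite -mulr_sumr sumrB -Re_sum e4 /= subr0 sumr_const card_ord.
  by rewrite -mulr_natl; ring.
apply: ler_sum => k _.
rewrite normcM normcX normcV w1 invr1 expr1n mulr1 normc_real.
by have := qB _ (nzk k) => h; rewrite ler0_norm; lra.
Qed.

Lemma geometric_tail_le (x : R) K M : 0 <= x < 1 ->
  \sum_(K <= n < M) x ^+ n <= x ^+ K / (1 - x).
Proof.
move=> /andP[x0 x1]; have x1' : 0 < 1 - x by lra.
rewrite ler_pdivlMr//.
have [MK|KM] := leqP M K; first by rewrite big_geq// mul0r exprn_ge0.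
rewrite mulr_suml (@telescope_sumr_eq _ _ _ (fun n => - x ^+ n)) ?(ltnW KM)//.
  have := exprn_ge0 M x0; lra.
by move=> i _; rewrite exprS; ring.
Qed.

Lemma horner_tail p K r z : 0 <= r -> forall B, 0 <= B ->
  (forall n, (K <= n)%N -> normc p`_n * r ^+ n <= B) -> normc z < r ->
  normc (p.[z] - \sum_(n < K) p`_n * z ^+ n)
    <= B * ((normc z / r) ^+ K / (1 - normc z / r)).
Proof.
move=> r0 B B0 pB zr; have z0 := normc_ge0 z.
have rp : 0 < r by exact: le_lt_trans zr.
rewrite (@horner_coef_wide _ (maxn K (size p))) ?leq_maxr//.
rewrite -!(big_mkord predT (fun n => p`_n * z ^+ n)).
rewrite (@big_cat_nat _ _ _ K) ?leq_maxl//= addrAC subrr add0r.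
rewrite (le_trans (normc_sum _ _ _))//.
have x01 : 0 <= normc z / r < 1 by rewrite divr_ge0//= ltr_pdivrMr// mul1r.
apply: (@le_trans _ _ (B * \sum_(K <= n < maxn K (size p)) (normc z / r) ^+ n)); last first.
  by rewrite ler_wpM2l// geometric_tail_le.
rewrite mulr_sumr !big_nat; apply: ler_sum => n /andP[Kn _].
rewrite normcM normcX expr_div_n mulrCA mulrC ler_pM ?exprn_ge0 ?normc_ge0//.
by rewrite ler_pdivlMr ?exprn_gt0// pB.
Qed.

(** The constant terms cancel, and so does the linear part since 1 + i i = 0. What remains are two
    Taylor tails of order 2, for which [h <= r / 2] bounds the geometric factor by 2. *)
Lemma cauchy_riemann_poly p r B h : 0 < r ->
  (forall z, normc z <= r -> normc p.[z] <= B) -> 0 <= h <= r / 2 ->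
  normc (p.[h%:C] - p.[0] + 'i * (p.['i * h%:C] - p.[0])) <= 4 * B * (h / r) ^+ 2.
Proof.
move=> r0 pB /andP[h0 hr].
have B0 : 0 <= B by rewrite (le_trans (normc_ge0 _) (pB 0 _))// normc0 ltW.
have cB n : (2 <= n)%N -> normc p`_n * r ^+ n <= B.
  by move=> _; exact: (cauchy_estimate _ (ltW r0)).
have key z : normc z = h ->
    normc (p.[z] - (p`_0 + p`_1 * z)) <= 2 * B * (h / r) ^+ 2.
  move=> zh; have zr : normc z < r by rewrite zh; lra.
  have := @horner_tail p 2 r z (ltW r0) B B0 cB zr.
  rewrite !big_ord_recl big_ord0 /= expr0 expr1 mulr1 addr0 zh => /le_trans; apply.
  rewrite -mulrA (mulrCA 2) ler_wpM2l// mulrC ler_wpM2r//.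
    by rewrite exprn_ge0// divr_ge0// ltW.
  have hr2 : h / r <= 1 / 2 by rewrite ler_pdivrMr//; lra.
  by rewrite invf_ple ?posrE//; lra.
have -> : p.[h%:C] - p.[0] + 'i * (p.['i * h%:C] - p.[0]) =
   (p.[h%:C] - (p`_0 + p`_1 * h%:C)) + 'i * (p.['i * h%:C] - (p`_0 + p`_1 * ('i * h%:C))).
  rewrite horner_coef0.
  have ii : 'i * 'i = -1 :> C by rewrite -expr2 sqr_i.
  transitivity (p.[h%:C] - p`_0 + 'i * (p.['i * h%:C] - p`_0) - p`_1 * h%:C * (1 + 'i * 'i)).
    by rewrite ii subrr mulr0 subr0.
  ring.
rewrite (le_trans (normcD _ _))// normcM normci mul1r.
have h1 := key h%:C (normc_ge0_real h0).
have h2 : normc ('i * h%:C : C) = h by rewrite normcM normci mul1r normc_ge0_real.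
have := key _ h2; lra.
Qed.

End PolynomialEstimates.

(** * Uniform approximation by polynomials on discs *)

Definition poly_approx (R : realType) (f : R[i] -> R[i]) (s : R[i]) (r : R) :=
  forall e : R, 0 < e -> exists p : {poly R[i]},
    forall z, normc z <= r -> normc (f (s + z) - p.[z]) <= e.

Section PolyApprox.
Variable R : realType.
Local Notation C := R[i].
Implicit Types (f g : C -> C) (p q : {poly C}) (s z w : C) (r e B : R).

Lemma poly_bounded p r : 0 <= r ->
  exists2 B, 0 <= B & forall z, normc z <= r -> normc p.[z] <= B.
Proof.
move=> r0; elim/poly_ind: p => [|p c [B B0 pB]].
  by exists 0 => // z _; rewrite horner0 normc0.
exists (B * r + normc c); first by rewrite addr_ge0 ?mulr_ge0 ?normc_ge0.
move=> z zr; rewrite hornerMXaddC (le_trans (normcD _ _))// lerD2r normcM.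
by rewrite ler_pM ?normc_ge0 ?pB.
Qed.

Lemma poly_lipschitz p r : 0 <= r ->
  exists2 L, 0 <= L & forall z w, normc z <= r -> normc w <= r ->
    normc (p.[z] - p.[w]) <= L * normc (z - w).
Proof.
move=> r0; elim/poly_ind: p => [|p c [L L0 pL]].
  by exists 0 => // z w _ _; rewrite !horner0 subrr normc0 mul0r.
have [B B0 pB] := poly_bounded p r0.
exists (L * r + B); first by rewrite addr_ge0 ?mulr_ge0.
move=> z w zr wr; rewrite !hornerMXaddC.
have -> : p.[z] * z + c - (p.[w] * w + c) =
  (p.[z] - p.[w]) * z + p.[w] * (z - w) by ring.
rewrite (le_trans (normcD _ _))// !normcM mulrDl lerD//.
  by rewrite mulrAC ler_pM ?normc_ge0 ?pL.
by rewrite ler_wpM2r ?normc_ge0 ?pB.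
Qed.

Lemma poly_approx_ext f g s r :
  (forall z, normc z <= r -> f (s + z) = g (s + z)) ->
  poly_approx f s r -> poly_approx g s r.
Proof.
by move=> fg af e e0; have [p pP] := af e e0; exists p => z zr; rewrite -fg ?pP.
Qed.

Lemma poly_approx_cst c s r : poly_approx (fun=> c) s r.
Proof. by move=> e /ltW e0; exists c%:P => z _; rewrite hornerC subrr normc0. Qed.

Lemma poly_approx_id s r : poly_approx id s r.
Proof.
move=> e /ltW e0; exists ('X + s%:P) => z _.
by rewrite hornerD hornerX hornerC (addrC s) subrr normc0.
Qed.

Lemma poly_approx_lim f s r :
  (forall e, 0 < e -> exists2 g, poly_approx g s r &
     forall z, normc z <= r -> normc (f (s + z) - g (s + z)) <= e) ->
  poly_approx f s r.
Proof.
move=> fP e e0; have e2 : 0 < e / 2 by rewrite divr_gt0.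
have [g ga gP] := fP _ e2; have [p pP] := ga _ e2.
exists p => z zr; rewrite (le_trans (normc_tri _ (g (s + z)) _))//.
by have := gP _ zr; have := pP _ zr; lra.
Qed.

Lemma poly_approx_bounded f s r : 0 <= r -> poly_approx f s r ->
  exists2 B, 0 <= B & forall z, normc z <= r -> normc (f (s + z)) <= B.
Proof.
move=> r0 af; have [p pP] := af 1 ltr01; have [B B0 pB] := poly_bounded p r0.
exists (1 + B); first by rewrite addr_ge0.
move=> z zr; rewrite -(subrK p.[z] (f _)) (le_trans (normcD _ _))// lerD//.
- exact: pP.
- exact: pB.
Qed.

Lemma poly_approx_unif_cont f s r e : 0 <= r -> poly_approx f s r -> 0 < e ->
  exists2 d, 0 < d & forall z w, normc z <= r -> normc w <= r ->
    normc (z - w) <= d -> normc (f (s + z) - f (s + w)) <= e.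
Proof.
move=> r0 af e0; have e3 : 0 < e / 3 by rewrite divr_gt0.
have [p pP] := af _ e3; have [L L0 pL] := poly_lipschitz p r0.
have L1 : 0 < L + 1 by lra.
exists (e / 3 / (L + 1)); first by rewrite divr_gt0.
move=> z w zr wr zw.
rewrite (le_trans (normc_tri _ p.[z] _))//.
have h1 := normc_tri p.[z] p.[w] (f (s + w)).
have h2 : normc (p.[z] - p.[w]) <= e / 3.
  rewrite (le_trans (pL z w zr wr))//.
  apply: (@le_trans _ _ ((L + 1) * (e / 3 / (L + 1)))).
    apply: (@le_trans _ _ ((L + 1) * normc (z - w))); first by rewrite ler_wpM2r ?normc_ge0//; lra.
    by rewrite ler_wpM2l// ltW.
  by rewrite mulrC divfK ?gt_eqF.
have := pP _ zr; have := pP _ wr; rewrite (normcC (f (s + w))); lra.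
Qed.

Lemma poly_approxD f g s r : poly_approx f s r -> poly_approx g s r ->
  poly_approx (fun z => f z + g z) s r.
Proof.
move=> af ag e e0; have e2 : 0 < e / 2 by rewrite divr_gt0.
have [p pP] := af _ e2; have [q qP] := ag _ e2.
exists (p + q) => z zr; rewrite hornerD opprD addrACA (le_trans (normcD _ _))//.
by have := pP z zr; have := qP z zr; lra.
Qed.

Lemma poly_approxM f g s r : 0 <= r -> poly_approx f s r -> poly_approx g s r ->
  poly_approx (fun z => f z * g z) s r.
Proof.
move=> r0 af ag e e0.
have [B B0 fB] := poly_approx_bounded r0 af.
have h1 : 0 < e / 2 / (B + 1) by rewrite !divr_gt0//; lra.
have [q qP] := ag _ h1.
have [D D0 qD] := poly_bounded q r0.
have h2 : 0 < e / 2 / (D + 1) by rewrite !divr_gt0//; lra.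
have [p pP] := af _ h2.
exists (p * q) => z zr; rewrite hornerM.
have -> : f (s + z) * g (s + z) - p.[z] * q.[z] =
  f (s + z) * (g (s + z) - q.[z]) + (f (s + z) - p.[z]) * q.[z] by ring.
rewrite (le_trans (normcD _ _))// !normcM.
have k1 : normc (f (s + z)) * normc (g (s + z) - q.[z]) <= e / 2.
  rewrite (le_trans (ler_pM (normc_ge0 _) (normc_ge0 _) (fB _ zr) (qP _ zr)))//.
  by rewrite mulrA ler_pdivrMr; nra.
have k2 : normc (f (s + z) - p.[z]) * normc q.[z] <= e / 2.
  rewrite (le_trans (ler_pM (normc_ge0 _) (normc_ge0 _) (pP _ zr) (qD _ zr)))//.
  by rewrite mulrAC ler_pdivrMr; nra.
lra.
Qed.

Lemma poly_approxZ f c s r : 0 <= r -> poly_approx f s r ->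
  poly_approx (fun z => c * f z) s r.
Proof. by move=> r0; apply: poly_approxM => //; exact: poly_approx_cst. Qed.

Lemma poly_approxN f s r : poly_approx f s r -> poly_approx (fun z => - f z) s r.
Proof.
move=> af e e0; have [p pP] := af _ e0; exists (- p) => z zr.
by rewrite hornerN -opprD normcNE pP.
Qed.

Lemma poly_approxB f g s r : poly_approx f s r -> poly_approx g s r ->
  poly_approx (fun z => f z - g z) s r.
Proof. by move=> af ag; apply: poly_approxD => //; exact: poly_approxN. Qed.

Lemma poly_approx_sum I (l : seq I) (P : pred I) (F : I -> C -> C) s r :
  (forall i, P i -> poly_approx (F i) s r) ->
  poly_approx (fun z => \sum_(i <- l | P i) F i z) s r.
Proof.
move=> aF; elim: l => [|i l IH].
  by apply: poly_approx_ext (@poly_approx_cst 0 s r) => z _; rewrite big_nil.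
have [Pi|Pi] := boolP (P i).
  apply: poly_approx_ext (poly_approxD (aF i Pi) IH) => z _.
  by rewrite big_cons Pi.
by apply: poly_approx_ext IH => z _; rewrite big_cons (negPf Pi).
Qed.

Lemma poly_approx_subdisc f s s' r r' : normc (s' - s) + r' <= r ->
  poly_approx f s r -> poly_approx f s' r'.
Proof.
move=> sr af e e0; have [p pP] := af _ e0.
exists (p \Po ('X + (s' - s)%:P)) => z zr.
rewrite horner_comp hornerD hornerX hornerC.
have -> : s' + z = s + (z + (s' - s)) by ring.
apply: pP; rewrite (le_trans (normcD _ _))//; lra.
Qed.

Lemma geometric_small (x B e : R) : 0 <= x < 1 -> 0 < e ->
  exists K : nat, B * (x ^+ K / (1 - x)) <= e.
Proof.
move=> /andP[x0 x1] e0.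
have : (fun n => B / (1 - x) * x ^+ n) @ \oo --> B / (1 - x) * 0.
  by apply: cvgMr; apply: cvg_expr; rewrite ger0_norm.
rewrite mulr0 => /cvgr_norm_le /(_ e); rewrite normr0 e0 => /(_ isT).
move=> [K _ /(_ K (leqnn K)) /= h]; exists K.
by rewrite mulrCA mulrC (le_trans (ler_norm _)).
Qed.

(** A polynomial close to [f] is tiny on the small disc, so Cauchy's estimate makes its first [K]
    coefficients tiny; the later ones are controlled by the bound of [f] on the large disc.
    Analyticity enters only through these two estimates. *)
Lemma poly_approx_identity f s r d : poly_approx f s r -> 0 < d <= r ->
  (forall z, normc z <= d -> f (s + z) = 0) ->
  forall z, normc z < r -> f (s + z) = 0.
Proof.
move=> af /andP[d0 dr] f0 z zr; have r0 := lt_le_trans d0 dr.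
apply/eqP; rewrite -normc_eq0 eq_le normc_ge0 andbT.
apply/ler_addgt0Pr => e e0; rewrite add0r.
have [B B0 fB] := poly_approx_bounded (ltW r0) af.
pose x := normc z / r.
have x01 : 0 <= x < 1.
  by rewrite divr_ge0 ?normc_ge0 ?(ltW r0)//= ltr_pdivrMr// mul1r.
have e3 : 0 < e / 3 by rewrite divr_gt0.
have [K KP] := geometric_small (B + 1) x01 e3.
(* The ratio |z| / d may exceed 1 and [D] may be large, but it depends on [K] only; the precision
   [e'] is chosen after both. *)
pose D := \sum_(n < K) (normc z / d) ^+ n.
have D0 : 0 <= D.
  by apply: sumr_ge0 => n _; rewrite exprn_ge0// divr_ge0 ?normc_ge0 ?ltW.
pose e' := Num.min 1 (Num.min (e / 3) (e / 3 / (D + 1))).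
have e'0 : 0 < e' by rewrite !lt_min ltr01 !divr_gt0//; lra.
have [e'1 e'2 e'3] : [/\ e' <= 1, e' <= e / 3 & e' <= e / 3 / (D + 1)].
  by split; rewrite /e' !ge_min lexx ?orbT.
have [p pP] := af _ e'0.
have pd n : normc p`_n * d ^+ n <= e'.
  apply: (cauchy_estimate _ (ltW d0)) => w wd.
  by have := pP w (le_trans wd dr); rewrite f0// sub0r normcNE.
have pr n : (K <= n)%N -> normc p`_n * r ^+ n <= B + 1.
  move=> _; apply: (cauchy_estimate _ (ltW r0)) => w wr.
  have h1 := pP w wr; have h2 := fB w wr.
  have := normc_tri p.[w] (f (s + w)) 0; rewrite !subr0 (normcC p.[w]); lra.
have B1 : 0 <= B + 1 by lra.
have tail := horner_tail (ltW r0) B1 pr zr.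
have main : normc (\sum_(n < K) p`_n * z ^+ n) <= e / 3.
  apply: (@le_trans _ _ (e' * D)); last first.
    rewrite (le_trans (ler_wpM2r D0 e'3))// mulrAC ler_pdivrMr; nra.
  rewrite (le_trans (normc_sum _ _ _))// mulr_sumr; apply: ler_sum => n _.
  rewrite normcM normcX expr_div_n mulrA ler_pdivlMr ?exprn_gt0// mulrAC.
  by rewrite ler_wpM2r ?exprn_ge0 ?normc_ge0.
have h1 := pP z (ltW zr).
have h2 := normc_tri (f (s + z)) p.[z] (\sum_(n < K) p`_n * z ^+ n).
have h3 := normc_sub (f (s + z)) (\sum_(n < K) p`_n * z ^+ n).
rewrite -/x in tail; lra.
Qed.

Lemma poly_approx_cauchy_riemann f s r B h : 0 < r -> poly_approx f s r ->
  (forall z, normc z <= r -> normc (f (s + z)) <= B) -> 0 <= h <= r / 2 ->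
  normc (f (s + h%:C) - f s + 'i * (f (s + 'i * h%:C) - f s)) <=
    4 * B * (h / r) ^+ 2.
Proof.
move=> r0 af fB h0r; have [h0 hr] := andP h0r.
have hr1 : 0 <= h / r <= 1 by rewrite divr_ge0 ?(ltW r0)//= ler_pdivrMr//; lra.
apply/ler_addgt0Pr => e e0.
have e8 : 0 < e / 8 by rewrite divr_gt0.
have [p pP] := af _ e8.
have pB z : normc z <= r -> normc p.[z] <= B + e / 8.
  move=> zr; have h1 := pP z zr; have h2 := fB z zr.
  have := normc_tri p.[z] (f (s + z)) 0; rewrite !subr0 (normcC p.[z]); lra.
have cr := cauchy_riemann_poly r0 pB h0r.
have nh : normc (h%:C : C) <= r by rewrite normc_ge0_real//; lra.
have nih : normc ('i * h%:C : C) <= r by rewrite normcM normci mul1r.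
have n0 : normc (0 : C) <= r by rewrite normc0 ltW.
have h1 := pP _ nh; have h2 := pP _ nih; have h3 := pP _ n0; rewrite addr0 in h3.
have -> : f (s + h%:C) - f s + 'i * (f (s + 'i * h%:C) - f s) =
  (p.[h%:C] - p.[0] + 'i * (p.['i * h%:C] - p.[0])) +
  ((f (s + h%:C) - p.[h%:C]) - (f s - p.[0]) +
   'i * ((f (s + 'i * h%:C) - p.['i * h%:C]) - (f s - p.[0]))) by ring.
rewrite (le_trans (normcD _ _))//.
set u := f _ - p.[_] in h1 *; set v := f _ - p.[_] in h3 *; set w := f _ - p.[_] in h2 *.
have k1 := normcD (u - v) ('i * (w - v)); rewrite normcM normci mul1r in k1.
have k2 := normcB u v; have k3 := normcB w v.
have : (h / r) ^+ 2 <= 1 by rewrite exprn_ile1//; case/andP: hr1.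
move=> hr2; have : 0 <= (h / r) ^+ 2 by rewrite sqr_ge0.
nra.
Qed.

Lemma geometric_sum_complex w K : w != 1 ->
  \sum_(n < K) w ^+ n = (1 - w ^+ K) / (1 - w).
Proof.
move=> w1; have w1' : 1 - w != 0 by rewrite subr_eq0 eq_sym.
apply: (mulIf w1'); rewrite divfK// mulrC.
by rewrite -[RHS]opprB (subrX1 w K) -mulNr opprB.
Qed.

(** Geometric series in z / b with b = a - s: the pole lies outside the closed disc, so the ratio is
    at most r / |b| < 1. *)
Lemma poly_approx_subV a s r : 0 <= r ->
  (forall z, normc z <= r -> s + z != a) ->
  poly_approx (fun z => (z - a)^-1) s r.
Proof.
move=> r0 za; set b := a - s.
have br : r < normc b.
  rewrite ltNge; apply/negP => /za; rewrite /b addrC subrK eqxx; exact/negP.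
have b0 : b != 0 by rewrite -normc_gt0 (le_lt_trans r0).
have nb := le_lt_trans r0 br.
move=> e e0.
have x01 : 0 <= r / normc b < 1.
  by rewrite divr_ge0 ?normc_ge0//= ltr_pdivrMr ?mul1r.
have [K KP] := geometric_small (normc b)^-1 x01 e0.
exists (- b^-1 *: \sum_(n < K) (b^-1 *: 'X) ^+ n) => z zr.
rewrite hornerZ horner_sum.
under eq_bigr do rewrite horner_exp hornerZ hornerX.
set w := b^-1 * z.
have nw : normc w <= r / normc b.
  by rewrite normcM normcV mulrC ler_wpM2r ?invr_ge0 ?normc_ge0.
have w1 : w != 1.
  apply/eqP => w1; move: nw; rewrite w1 normc1 leNgt.
  by case/andP: x01 => _ ->.
have w1' : 1 - w != 0 by rewrite subr_eq0 eq_sym.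
rewrite geometric_sum_complex//.
have -> : (s + z - a)^-1 = - b^-1 / (1 - w).
  have -> : s + z - a = - b * (1 - w).
    by rewrite mulrBr mulr1 mulNr mulrA mulfV// mul1r /b; ring.
  by rewrite invfM invrN.
have -> : - b^-1 / (1 - w) - - b^-1 * ((1 - w ^+ K) / (1 - w)) =
  - b^-1 * (w ^+ K / (1 - w)) by field; rewrite b0 w1'.
rewrite !normcM normcNE !normcV normcX (le_trans _ KP)//.
rewrite ler_wpM2l ?invr_ge0 ?normc_ge0//.
have nw1 : 1 - r / normc b <= normc (1 - w).
  by have := normc_sub 1 w; rewrite normc1; lra.
have x1 : 0 < 1 - r / normc b by case/andP: x01 => _ ?; lra.
rewrite ler_pM ?invr_ge0 ?exprn_ge0 ?normc_ge0//.
- by rewrite lerXn2r ?nnegrE ?normc_ge0//; case/andP: x01.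
- by rewrite lef_pV2 ?posrE// (lt_le_trans x1).
Qed.

(** Over an algebraically closed field the reciprocal is a product of reciprocals of linear factors,
    each with its pole off the disc. *)
Lemma poly_approx_polyV p s r : 0 <= r ->
  (forall z, normc z <= r -> p.[s + z] != 0) ->
  poly_approx (fun z => p.[z]^-1) s r.
Proof.
move=> r0 p0; have [l Dp] := closed_field_poly_normal p.
have lc0 : lead_coef p != 0.
  rewrite lead_coef_eq0; apply/eqP => pz.
  by have := p0 0; rewrite normc0 pz horner0 eqxx => /(_ r0).
have pE z : p.[z] = lead_coef p * \prod_(a <- l) (z - a).
  rewrite {1}Dp hornerZ horner_prod; congr (_ * _).
  by apply: eq_bigr => a _; rewrite hornerXsubC.
have la a : a \in l -> forall z, normc z <= r -> s + z != a.
  move=> al z zr; apply: contraNneq (p0 z zr) => ->.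
  by rewrite pE (big_rem a al) /= subrr mul0r mulr0.
have : poly_approx (fun z => \prod_(a <- l) (z - a)^-1) s r.
  move: la; clear -r0; elim: l => [|a l IH] la.
    by apply: poly_approx_ext (@poly_approx_cst 1 s r) => z _; rewrite big_nil.
  have h1 : poly_approx (fun z => (z - a)^-1) s r.
    by apply: poly_approx_subV => // z; apply: la; rewrite mem_head.
  have h2 : poly_approx (fun z => \prod_(a <- l) (z - a)^-1) s r.
    by apply: IH => b bl; apply: la; rewrite inE bl orbT.
  by apply: poly_approx_ext (poly_approxM r0 h1 h2) => z _; rewrite big_cons.
move=> /(poly_approxZ (lead_coef p)^-1 r0); apply: poly_approx_ext => z _.
by rewrite pE invfM prodfV.
Qed.

(** A polynomial within [m / 2] of [f] has no zero on the disc, so its reciprocal is approximable,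
    and it is uniformly close to the reciprocal of [f]. *)
Lemma poly_approxV f s r m : 0 <= r -> poly_approx f s r -> 0 < m ->
  (forall z, normc z <= r -> m <= normc (f (s + z))) ->
  poly_approx (fun z => (f z)^-1) s r.
Proof.
move=> r0 af m0 fm; apply: poly_approx_lim => e e0.
pose e' := Num.min (m / 2) (e * (m * (m / 2))).
have e'0 : 0 < e' by rewrite lt_min !(divr_gt0, mulr_gt0).
have [e'1 e'2] : e' <= m / 2 /\ e' <= e * (m * (m / 2)).
  by rewrite /e' !ge_min !lexx orbT.
have [p pP] := af _ e'0.
have pm z : normc z <= r -> m / 2 <= normc p.[z].
  move=> zr; have := normc_sub (f (s + z)) (f (s + z) - p.[z]).
  by rewrite subKr; have := fm z zr; have := pP z zr; lra.
(* [p] is a polynomial in the displacement from [s]; the composition makes it a function of the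
   point itself. *)
exists (fun z => (p \Po ('X - s%:P)).[z]^-1).
  apply: poly_approx_polyV => // z zr.
  rewrite horner_comp hornerXsubC addrC addKr -normc_gt0.
  by rewrite (lt_le_trans _ (pm z zr))// divr_gt0.
move=> z zr; rewrite horner_comp hornerXsubC (addrC s z) addrK (addrC z s).
have fz0 : f (s + z) != 0 by rewrite -normc_gt0 (lt_le_trans m0) ?fm.
have pz0 : p.[z] != 0 by rewrite -normc_gt0 (lt_le_trans _ (pm z zr))// divr_gt0.
have -> : (f (s + z))^-1 - p.[z]^-1 = (p.[z] - f (s + z)) / (f (s + z) * p.[z]).
  by field; rewrite fz0 pz0.
rewrite normcM normcV normcM ler_pdivrMr; last by rewrite mulr_gt0 ?normc_gt0.
rewrite normcC (le_trans (pP z zr))// (le_trans e'2)// ler_wpM2l ?(ltW e0)//.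
by rewrite ler_pM ?fm ?pm// ltW// divr_gt0.
Qed.

(** Compactness, applied to the square [-r, r]^2 of pairs of coordinates: near each point some 1 /
    (n + 1) is a lower bound for all large [n], and the covering property makes [n] uniform. *)
Lemma poly_approx_lower_bound f s r : 0 <= r -> poly_approx f s r ->
  (forall z, normc z <= r -> f (s + z) != 0) ->
  exists2 m, 0 < m & forall z, normc z <= r -> m <= normc (f (s + z)).
Proof.
move=> r0 af f0.
have cK : compact (`[- r, r] `*` `[- r, r] : set (R * R)).
  by apply: compact_setX; exact: segment_compact.
pose P (n : nat) (u : R * R) := normc (u.1 +i* u.2) <= r ->
  n.+1%:R^-1 <= normc (f (s + (u.1 +i* u.2))).
have := (iffLR (compact_near_coveringP _)) cK nat \oo P _.
have nuv (u v : R * R) : normc ((u.1 +i* u.2) - (v.1 +i* v.2)) <=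
    `|u.1 - v.1| + `|u.2 - v.2|.
  by rewrite (le_trans (normc_le_ReIm _)).
case=> [u _|N _ /(_ N (leqnn N)) NP].
  have near_u d : 0 < d -> \forall v \near u,
      normc ((v.1 +i* v.2) - (u.1 +i* u.2)) <= d.
    move=> d0; have d2 : 0 < d / 2 by rewrite divr_gt0.
    exists (ball u.1 (d / 2), ball u.2 (d / 2)) => /=.
      by split; exact: nbhsx_ballx.
    move=> v /= [v1 v2]; rewrite (le_trans (nuv _ _))//.
    move: v1 v2; rewrite /ball /= => v1 v2.
    by rewrite (distrC v.1) (distrC v.2); lra.
  (* At a point of the square outside the disc a whole neighbourhood stays outside, where [P] holds
     vacuously. *)
  have [ur|ur] := leP (normc (u.1 +i* u.2)) r; last first.
    have d0 : 0 < (normc (u.1 +i* u.2) - r) / 2 by rewrite divr_gt0// subr_gt0.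
    exists ([set v : R * R | normc ((v.1 +i* v.2) - (u.1 +i* u.2)) <=
      (normc (u.1 +i* u.2) - r) / 2], setT) => /=.
      by split; [exact: near_u|exact: filterT].
    move=> [v n] [h _] vr.
    have {}h : normc ((v.1 +i* v.2) - (u.1 +i* u.2)) <=
      (normc (u.1 +i* u.2) - r) / 2 := h.
    have {}vr : normc (v.1 +i* v.2) <= r := vr.
    have := normc_sub (u.1 +i* u.2) (v.1 +i* v.2).
    rewrite normcC; lra.
  have m0 : 0 < normc (f (s + (u.1 +i* u.2))) / 2 by rewrite divr_gt0// normc_gt0 f0.
  have [d d0 dP] := poly_approx_unif_cont r0 af m0.
  have [N NP] : exists N : nat, N.+1%:R^-1 <= normc (f (s + (u.1 +i* u.2))) / 2.
    exists (Num.trunc ((normc (f (s + (u.1 +i* u.2))) / 2)^-1)).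
    rewrite invf_ple ?posrE//.
    by rewrite ltW// truncnS_gt.
  exists ([set v : R * R | normc ((v.1 +i* v.2) - (u.1 +i* u.2)) <= d], [set n | (N <= n)%N]).
    by split; [exact: near_u|exists N].
  move=> [v n] [vu Nn] vr.
  have {}vu : normc ((v.1 +i* v.2) - (u.1 +i* u.2)) <= d := vu.
  have {}vr : normc (v.1 +i* v.2) <= r := vr.
  rewrite /=; have h := dP _ _ vr ur vu.
  have k := normc_sub (f (s + (u.1 +i* u.2))) (f (s + (v.1 +i* v.2))).
  rewrite normcC in k.
  have : n.+1%:R^-1 <= N.+1%:R^-1 :> R by rewrite lef_pV2 ?posrE ?ler_nat.
  by move=> /le_trans; apply; apply: (le_trans NP); lra.
exists N.+1%:R^-1; first by rewrite invr_gt0.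
move=> z zr; have := NP (complex.Re z, complex.Im z); rewrite /P /=.
have -> : complex.Re z +i* complex.Im z = z by case: (z).
apply; last by rewrite -normc_sqrt.
split => /=; rewrite in_itv /= -ler_norml.
- exact: le_trans (Re_le_normc _) zr.
- exact: le_trans (Im_le_normc _) zr.
Qed.

End PolyApprox.

(** * Exponential functions as uniform limits of polynomials *)

Section ExponentialApprox.
Variable R : realType.
Local Notation C := R[i].
Implicit Types (a b s z : C) (r e l x : R).

Lemma normc_subX a b M n : normc a <= M -> normc b <= M ->
  normc (a ^+ n.+1 - b ^+ n.+1) <= n.+1%:R * M ^+ n * normc (a - b).
Proof.
move=> aM bM; have M0 : 0 <= M by exact: le_trans (normc_ge0 _) aM.
elim: n => [|n IH]; first by rewrite !expr1 expr0 !mul1r.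
have -> : a ^+ n.+2 - b ^+ n.+2 =
  a * (a ^+ n.+1 - b ^+ n.+1) + (a - b) * b ^+ n.+1.
  by rewrite (exprS a) (exprS b n.+1); ring.
rewrite (le_trans (normcD _ _))// !normcM normcX.
have h1 : normc a * normc (a ^+ n.+1 - b ^+ n.+1) <=
    M * (n.+1%:R * M ^+ n * normc (a - b)).
  by rewrite ler_pM ?normc_ge0.
have h2 : normc (a - b) * normc b ^+ n.+1 <= normc (a - b) * M ^+ n.+1.
  by rewrite ler_wpM2l ?normc_ge0// lerXn2r ?nnegrE ?normc_ge0.
rewrite (le_trans (lerD h1 h2))// le_eqVlt; apply/orP; left; apply/eqP.
by rewrite (exprS M n) -(natr1 n.+1); ring.
Qed.

Lemma max1_expR_le x y : 0 <= y -> x <= y -> Num.max 1 (expR x) <= expR y.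
Proof. by move=> y0 xy; rewrite ge_max ler_expR xy andbT -expR0 ler_expR. Qed.

Lemma le_Re_normc z : complex.Re z <= normc z.
Proof. exact: le_trans (ler_norm _) (Re_le_normc _). Qed.

(** Euler's product for exp: both e^(z / (m + 1)) and 1 + z / (m + 1) have modulus at most e^(|z| /
    (m + 1)) and differ to second order; raising them to the power m + 1 loses only a factor of
    order m. The factor |z|^2 in the error matters for [poly_approx_cexp_quotient2]. *)
Lemma cexp_poly_bound z m :
  normc (cexp z - (1 + z / m.+1%:R) ^+ m.+1) <=
    4 * normc z ^+ 2 * expR (2 * normc z) / m.+1%:R.
Proof.
have m0 : 0 < m.+1%:R :> R by rewrite ltr0n.
have z0 := normc_ge0 z.
have mC : m.+1%:R != 0 :> C by rewrite pnatr_eq0.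
set w := z / m.+1%:R.
have nw : normc w = normc z / m.+1%:R by rewrite normcM normcV normc_nat.
have w0 := normc_ge0 w.
have -> : cexp z = cexp w ^+ m.+1 by rewrite -cexpMn mulrC divfK.
set M := expR (normc w).
have aM : normc (cexp w) <= M by rewrite normc_cexp ler_expR le_Re_normc.
have bM : normc (1 + w) <= M.
  by rewrite (le_trans (normcD _ _))// normc1 expR_ge1Dx.
have M1 : 1 <= M by rewrite -expR0 ler_expR.
have MM : M ^+ m <= expR (normc z).
  apply: (@le_trans _ _ (M ^+ m.+1)); first by rewrite exprS ler_peMl// exprn_ge0// (le_trans ler01).
  by rewrite -expRM_natl nw mulrC divfK ?gt_eqF.
have ab : normc (cexp w - (1 + w)) <= 4 * normc w ^+ 2 * expR (normc z).
  rewrite opprD addrA (le_trans (cexp_sub1x_bound w))// ler_wpM2l//.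
    by rewrite mulr_ge0// exprn_ge0.
  apply: max1_expR_le => //; rewrite (le_trans (le_Re_normc _))// nw.
  by rewrite ler_pdivrMr// ler_peMr// ler1n.
rewrite (le_trans (normc_subX _ aM bM))//.
apply: (@le_trans _ _ (m.+1%:R * expR (normc z) * (4 * normc w ^+ 2 * expR (normc z)))).
  rewrite ler_pM ?normc_ge0 ?mulr_ge0 ?exprn_ge0 ?(le_trans ler01 M1)//.
  by rewrite ler_wpM2l.
have -> : expR (2 * normc z) = expR (normc z) * expR (normc z).
  by rewrite -expRD; congr expR; ring.
by rewrite nw le_eqVlt; apply/orP; left; apply/eqP; field; rewrite gt_eqF.
Qed.

Lemma exists_inv_nat_le (B e : R) : 0 < e -> exists m : nat, B / m.+1%:R <= e.
Proof.
move=> e0; exists (Num.trunc (B / e)); rewrite ler_pdivrMr ?ltr0n//.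
by rewrite mulrC -ler_pdivrMr// ltW// truncnS_gt.
Qed.

Lemma poly_approx_center (f : C -> C) s r :
  poly_approx (fun z => f (s + z)) 0 r -> poly_approx f s r.
Proof.
move=> h e e0; have [p pP] := h e e0; exists p => z zr.
by have := pP z zr; rewrite add0r.
Qed.

Lemma poly_approx_cexp a s r : 0 <= r ->
  poly_approx (fun z => cexp (z * a)) s r.
Proof.
move=> r0; apply: poly_approx_center.
suff h : poly_approx (fun z => cexp (z * a)) 0 r.
  apply: poly_approx_ext (poly_approxZ (cexp (s * a)) r0 h) => z _.
  by rewrite add0r mulrDl cexpD.
move=> e e0; have A0 : 0 <= r * normc a by rewrite mulr_ge0 ?normc_ge0.
have [m mP] := exists_inv_nat_le
  (4 * (r * normc a) ^+ 2 * expR (2 * (r * normc a))) e0.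
exists ((1 + (a / m.+1%:R) *: 'X) ^+ m.+1) => z zr; rewrite add0r.
rewrite horner_exp hornerD hornerC hornerZ hornerX mulrAC (mulrC a z).
have zar : normc (z * a) <= r * normc a by rewrite normcM ler_wpM2r ?normc_ge0.
rewrite (le_trans (cexp_poly_bound _ _))// (le_trans _ mP)//.
rewrite ler_wpM2r ?invr_ge0 ?ler0n// ler_pM ?expR_ge0//.
- by rewrite mulr_ge0// exprn_ge0// normc_ge0.
- by rewrite ler_wpM2l// lerXn2r ?nnegrE ?normc_ge0.
- by rewrite ler_expR ler_wpM2l.
Qed.

(** Entire, the removable singularity at 0 being filled with its limit. It is e^(l z) / z^2 minus
    its principal part at 0. *)
Definition cexp_quotient2 (l : R) (z : C) : C :=
  if z == 0 then (l ^+ 2 / 2)%:C else (cexp (z * l%:C) - 1 - z * l%:C) / z ^+ 2.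

(** Gives the polynomial left when Euler's approximation of exp, less its first two terms, is
    divided by z^2; its value at 0 is to be compared with that of [cexp_quotient2]. *)
Lemma binomial_remainder (c : C) m : exists q : {poly C},
  (1 + c *: 'X) ^+ m = 1 + (m%:R * c) *: 'X + 'X^2 * q /\
  q.[0] = 'C(m, 2)%:R * c ^+ 2.
Proof.
elim: m => [|m [q [qE q0]]].
  by exists 0; rewrite expr0 mul0r scale0r mulr0 !addr0 horner0 bin0n mul0r.
exists (q + (m%:R * c ^+ 2)%:P + c *: ('X * q)); split; last first.
  rewrite !(hornerD, hornerC, hornerZ, hornerM, hornerX, q0) binS bin1 natrD.
  by ring.
rewrite exprS qE -(natr1 m) expr2 -!mul_polyC !(polyCM, polyCD).
by ring.
Qed.

(** The error of Euler's polynomials carries a factor |z|^2, so dividing by z^2 costs nothing, even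
    near 0. That division is polynomial only about 0, hence the passage to a disc centred at 0 that
    contains the given one. *)
Lemma poly_approx_cexp_quotient2 l s r : 0 <= r ->
  poly_approx (cexp_quotient2 l) s r.
Proof.
move=> r0; apply: (@poly_approx_subdisc R _ 0 s (normc s + r) r).
  by rewrite subr0.
set r' := normc s + r.
have r'0 : 0 <= r' by rewrite addr_ge0 ?normc_ge0.
move=> e e0.
have A0 : 0 <= r' * `|l| by rewrite mulr_ge0.
have [m mP] := exists_inv_nat_le (4 * l ^+ 2 * expR (2 * (r' * `|l|))) e0.
have mR : 0 < m.+1%:R :> R by rewrite ltr0n.
have mC : m.+1%:R != 0 :> C by rewrite pnatr_eq0.
have [q [qE q0]] := binomial_remainder (l%:C / m.+1%:R) m.+1.
have l0 : normc (l%:C : C) ^+ 2 = l ^+ 2.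
  by rewrite normc_real real_normK ?num_real.
exists q => z zr; rewrite add0r (le_trans _ mP)//.
have bnd : l ^+ 2 / m.+1%:R <= 4 * l ^+ 2 * expR (2 * (r' * `|l|)) / m.+1%:R.
  rewrite ler_wpM2r ?invr_ge0// mulrAC ler_peMl ?sqr_ge0//.
  have : 1 <= expR (2 * (r' * `|l|)) by rewrite -expR0 ler_expR mulr_ge0.
  lra.
rewrite /cexp_quotient2; have [->|z0] := eqVneq z 0.
  rewrite q0 (le_trans _ bnd)//.
  have -> : (l ^+ 2 / 2)%:C - 'C(m.+1, 2)%:R * (l%:C / m.+1%:R) ^+ 2 =
      (l%:C) ^+ 2 / (2 * m.+1%:R) :> C.
    have : 'C(m.+1, 2)%:R * 2 = m.+1%:R * m%:R :> C.
      by rewrite -!natrM mulnC -mul_bin_diag bin1.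
    move=> h; rewrite rmorphM fmorphV rmorphXn rmorph_nat /=.
    have -> : 'C(m.+1, 2)%:R = m.+1%:R * m%:R / 2 :> C.
      by rewrite -h mulfK// pnatr_eq0.
    by rewrite -(natr1 m) in mC *; field; rewrite ?mC ?pnatr_eq0 ?andbT.
  rewrite normcM normcX l0 normcV normcM !normc_nat.
  rewrite ler_wpM2l ?sqr_ge0// lef_pV2 ?posrE ?mulr_gt0//; lra.
have -> : (cexp (z * l%:C) - 1 - z * l%:C) / z ^+ 2 - q.[z] =
    (cexp (z * l%:C) - (1 + z * l%:C / m.+1%:R) ^+ m.+1) / z ^+ 2.
  rewrite (mulrC m.+1%:R) (divfK mC) in qE.
  have := congr1 (horner^~ z) qE.
  rewrite /= horner_exp !(hornerD, hornerC, hornerZ, hornerM, hornerX, hornerXn).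
  have -> : l%:C / m.+1%:R * z = z * l%:C / m.+1%:R by rewrite mulrC mulrA.
  by move=> ->; field.
rewrite normcM normcV normcX ler_pdivrMr ?exprn_gt0 ?normc_gt0//.
rewrite (le_trans (cexp_poly_bound _ _))// normcM exprMn l0.
rewrite [leRHS]mulrAC ler_wpM2r ?invr_ge0//.
rewrite [leRHS]mulrAC ler_pM ?expR_ge0//.
- by apply: mulr_ge0 => //; apply: mulr_ge0; rewrite sqr_ge0.
- by rewrite le_eqVlt; apply/orP; left; apply/eqP; ring.
- by rewrite ler_expR ler_wpM2l// normc_real ler_wpM2r.
Qed.

Lemma cexp_quotient2_bound l z :
  normc (cexp_quotient2 l z) <= 4 * l ^+ 2 * Num.max 1 (expR (l * complex.Re z)).
Proof.
rewrite /cexp_quotient2; have [->|z0] := eqVneq z 0.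
  rewrite normc_ge0_real ?divr_ge0 ?sqr_ge0// mulr0 expR0 maxxx.
  have := sqr_ge0 l; lra.
rewrite normcM normcV normcX ler_pdivrMr ?exprn_gt0 ?normc_gt0//.
rewrite (le_trans (cexp_sub1x_bound _))// normcM normc_real exprMn.
rewrite real_normK ?num_real// ReM /= mulr0 subr0 (mulrC _ l).
by rewrite le_eqVlt; apply/orP; left; apply/eqP; ring.
Qed.

End ExponentialApprox.

(** * Taylor expansion of log |1 - w| *)

Section LogModulus.
Variable R : realType.
Local Notation C := R[i].
Implicit Types (p q : {poly C}) (w z : C) (r e t x : R).

Lemma invc_ReIm (x y : R) :
  (x +i* y)^-1 = (x / (x ^+ 2 + y ^+ 2)) -i* (y / (x ^+ 2 + y ^+ 2)) :> C.
Proof. by []. Qed.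

(** The mean value theorem along t in [0, 1], applied to 2 log |1 - t w| plus twice the real part of
    the partial sum at t w: summing the geometric series reduces the derivative to -2 Re (w (t w)^K
    / (1 - t w)). Only the real logarithm occurs. *)
Lemma ln_normc_approx w x K : normc w <= x -> x < 1 ->
  `|ln (normc (1 - w)) +
    complex.Re (\sum_(k < K) w ^+ k.+1 / k.+1%:R)| <= x ^+ K / (1 - x).
Proof.
move=> wx x1; have x0 : 0 <= x by exact: le_trans (normc_ge0 _) wx.
set a := complex.Re w; set b := complex.Im w.
have wE : w = a +i* b by rewrite /a /b; case: (w).
(* |1 - t w|^2 and twice the real part of the partial sum, as real polynomials in t, so that both
   are differentiated algebraically. *)
pose D : {poly R} := (1 - a *: 'X) ^+ 2 + (b *: 'X) ^+ 2.
pose Q : {poly R} :=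
  \sum_(k < K) (2 * complex.Re (w ^+ k.+1) / k.+1%:R) *: 'X^(k.+1).
have uE t : 1 - t%:C * w = (1 - t * a) +i* (- (t * b)).
  by rewrite wE; apply/eqP; rewrite eq_complex /=; apply/andP; split; apply/eqP; ring.
have DE t : D.[t] = normc (1 - t%:C * w) ^+ 2.
  rewrite uE normc_sqrt sqr_sqrtr ?addr_ge0 ?sqr_ge0//=.
  rewrite /D !(hornerD, hornerN, hornerC, hornerZ, horner_exp, hornerX).
  by rewrite sqrrN !(mulrC t).
have u_low t : 0 <= t <= 1 -> 1 - x <= normc (1 - t%:C * w).
  move=> /andP[t0 t1]; have := normc_sub 1 (t%:C * w).
  rewrite normc1 normcM normc_ge0_real//.
  have : t * normc w <= normc w by rewrite ler_piMl ?normc_ge0.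
  lra.
have u0 t : 0 <= t <= 1 -> 0 < normc (1 - t%:C * w).
  by move=> h; rewrite (lt_le_trans _ (u_low t h))// subr_gt0.
have D0 t : 0 <= t <= 1 -> 0 < D.[t] by move=> h; rewrite DE exprn_gt0// u0.
pose f t := ln D.[t] + Q.[t].
pose df t := D.[t]^-1 * D^`().[t] + Q^`().[t].
have fD t : 0 <= t <= 1 -> is_derive t 1 f (df t).
  move=> h; apply: is_deriveD.
  by apply: (@is_derive1_comp R (@ln R) (horner D)); exact: is_derive1_ln (D0 _ h).
have [||c cI fE] := @MVT_segment R f df 0 1 ler01.
- by move=> t; rewrite in_itv /= => /andP[t0 t1]; apply: fD; rewrite !ltW.
- apply: derivable_within_continuous => t; rewrite in_itv /= => h.
  by have := fD t h; case.
have c01 : 0 <= c <= 1 by move: cI; rewrite in_itv.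
have dfE : df c = 2 * complex.Re (- w * ((c%:C * w) ^+ K / (1 - c%:C * w))).
  have un0 : 1 - c%:C * w != 0 by rewrite -normc_gt0 u0.
  have cw1 : c%:C * w != 1 by rewrite eq_sym -subr_eq0.
  have D'E : D^`().[c] = 2 * (c * (a ^+ 2 + b ^+ 2) - a).
    rewrite /D !expr2 !poly.derivE.
    rewrite !(hornerM, hornerD, hornerN, hornerC, hornerZ, hornerX).
    by ring.
  have Q'E : Q^`().[c] = 2 * complex.Re (w * \sum_(k < K) (c%:C * w) ^+ k).
    rewrite /Q raddf_sum /= horner_sum mulr_sumr Re_sum mulr_sumr.
    apply: eq_bigr => k _; rewrite derivZ derivXn hornerZ hornerMn hornerXn /=.
    rewrite exprMn mulrCA -exprS -rmorphXn ReM /= mul0r subr0.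
    by rewrite -(mulr_natr (c ^+ k)) (mulrC (c ^+ k)) mulrA divfK ?pnatr_eq0//; ring.
  rewrite /df D'E Q'E geometric_sum_complex//.
  have -> : - w * ((c%:C * w) ^+ K / (1 - c%:C * w)) =
     w * ((1 - (c%:C * w) ^+ K) / (1 - c%:C * w)) + (- w * (1 - c%:C * w)^-1) by ring.
  rewrite ReD [RHS]mulrDr [LHS]addrC; congr (_ + _).
  have -> : D.[c] = (1 - c * a) ^+ 2 + (- (c * b)) ^+ 2.
    by rewrite DE uE normc_sqrt sqr_sqrtr ?addr_ge0 ?sqr_ge0.
  rewrite uE invc_ReIm ReM ReN ImN /= -/a -/b.
  by rewrite mulrCA; congr (_ * _); ring.
have df_le : `|df c| <= 2 * (x ^+ K / (1 - x)).
  rewrite dfE normrM ger0_norm// ler_wpM2l// (le_trans (Re_le_normc _))//.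
  rewrite !normcM normcNE normcV normcX.
  have wc : normc (c%:C * w) <= x.
    case/andP: c01 => c0 c1.
    rewrite normcM normc_ge0_real// (le_trans _ wx)//.
    by rewrite ler_piMl ?normc_ge0.
  have x1' : 0 < 1 - x by rewrite subr_gt0.
  apply: (@le_trans _ _ (1 * (x ^+ K / (1 - x)))); last by rewrite mul1r.
  rewrite ler_pM ?normc_ge0 ?mulr_ge0 ?exprn_ge0 ?invr_ge0 ?normc_ge0//.
    by rewrite (le_trans wx)// ltW.
  rewrite ler_pM ?exprn_ge0 ?invr_ge0 ?normc_ge0//.
    by rewrite lerXn2r ?nnegrE ?normc_ge0.
  by rewrite lef_pV2 ?posrE ?u0// u_low.
have f0 : f 0 = 0.
  rewrite /f DE mul0r subr0 normc1 expr1n ln1 add0r /Q horner_sum big1// => k _.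
  by rewrite hornerZ hornerXn expr0n mulr0.
have f1 : f 1 = 2 * (ln (normc (1 - w)) +
    complex.Re (\sum_(k < K) w ^+ k.+1 / k.+1%:R)).
  have w1 : 0 < normc (1 - w) by have := u0 1; rewrite mul1r; apply; rewrite ler01 lexx.
  rewrite /f DE mul1r lnXn// mulrDr mulr_natl; congr (_ + _).
  rewrite /Q horner_sum Re_sum mulr_sumr; apply: eq_bigr => k _.
  rewrite hornerZ hornerXn expr1n mulr1 natrC -fmorphV ReM /= mulr0 subr0.
  by rewrite mulrA.
rewrite f0 f1 !subr0 mulr1 in fE.
rewrite -(@ler_pM2l _ 2)// -{1}[2 : R]ger0_norm// -normrM fE; exact: df_le.
Qed.

End LogModulus.

(** * Growth of zero-free functions through their log-modulus *)

Section LogGrowth.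
Variable R : realType.
Local Notation C := R[i].
Implicit Types (f : C -> C) (p q : {poly C}) (s w z : C) (r e b B : R).

Lemma poly_log_approx p r e : 0 <= r -> 0 < e ->
  (forall z, normc z <= r -> p.[z] != 0) ->
  exists2 q : {poly C}, q`_0 = 0 & forall z, normc z <= r ->
    `|ln (normc p.[z]) - ln (normc p.[0]) - complex.Re q.[z]| <= e.
Proof.
move=> r0 e0 p0; have [l Dp] := closed_field_poly_normal p.
have z0 : normc (0 : C) <= r by rewrite normc0.
have lc0 : lead_coef p != 0.
  rewrite lead_coef_eq0; apply/eqP => pz.
  by have := p0 0 z0; rewrite pz horner0 eqxx.
have pE z : p.[z] = lead_coef p * \prod_(a <- l) (z - a).
  rewrite {1}Dp hornerZ horner_prod; congr (_ * _).
  by apply: eq_bigr => a _; rewrite hornerXsubC.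
have la z : normc z <= r -> all (fun a => z - a != 0) l.
  move=> zr; have := p0 z zr; rewrite pE mulf_eq0 negb_or => /andP[_].
  by rewrite prodf_seq_neq0.
suff [q q0 qP] : exists2 q : {poly C}, q`_0 = 0 & forall z, normc z <= r ->
    `|ln (normc (\prod_(a <- l) (z - a))) - ln (normc (\prod_(a <- l) (0 - a)))
      - complex.Re q.[z]| <= e.
  exists q => // z zr; rewrite !pE !normcM !lnM ?posrE ?normc_gt0//.
  - rewrite (addrC (ln (normc (lead_coef p)))) addrKA; exact: qP.
  - by rewrite prodf_seq_neq0; apply: la.
  - by rewrite prodf_seq_neq0; apply: la.
elim: l la e e0 {Dp pE} => [|a l IH] la e e0.
  exists 0; first by rewrite coef0.
  by move=> z _; rewrite !big_nil horner0 subrr subr0 normr0 ltW.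
have e2 : 0 < e / 2 by rewrite divr_gt0.
have [|q q0 qP] := IH _ _ e2; first by move=> z /la /= /andP[].
have ar : r < normc a.
  rewrite ltNge; apply/negP => /la /=; by rewrite subrr eqxx.
have a0 : a != 0 by rewrite -normc_gt0 (le_lt_trans r0).
have na := le_lt_trans r0 ar.
have x01 : 0 <= r / normc a < 1.
  by rewrite divr_ge0 ?normc_ge0//= ltr_pdivrMr ?mul1r.
have [x0 x1] := andP x01.
have [K KP] := geometric_small 1 x01 e2; rewrite mul1r in KP.
(* The added polynomial is the truncated Taylor series of log (1 - z / a). *)
exists (q - \sum_(k < K) (k.+1%:R)^-1 *: (a^-1 *: 'X) ^+ k.+1).
  rewrite coefB q0 sub0r -horner_coef0 horner_sum big1 ?oppr0// => k _.
  by rewrite hornerZ horner_exp hornerZ hornerX mulr0 expr0n mulr0.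
move=> z zr; rewrite !big_cons !normcM.
have /= /andP[za zl] := la z zr.
have /= /andP[oa ol] := la 0 z0.
rewrite !lnM ?posrE ?normc_gt0 ?prodf_seq_neq0//.
rewrite hornerD hornerN ReD ReN.
have wr : normc (z / a) <= r / normc a.
  by rewrite normcM normcV ler_wpM2r// invr_ge0 ltW.
have := ln_normc_approx K wr x1.
have -> : ln (normc (1 - z / a)) = ln (normc (z - a)) - ln (normc (0 - a)).
  rewrite -ln_div ?posrE ?normc_gt0// -normcV -normcM; congr (ln (normc _)).
  by rewrite sub0r; field; rewrite ?oppr_eq0 a0.
have -> : (\sum_(k < K) (k.+1%:R)^-1 *: (a^-1 *: 'X) ^+ k.+1).[z] =
  \sum_(k < K) (z / a) ^+ k.+1 / k.+1%:R.
  rewrite horner_sum; apply: eq_bigr => k _.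
  by rewrite hornerZ horner_exp hornerZ hornerX mulrC (mulrC z).
have := qP z zr.
set A := ln _ - ln _ - complex.Re _; move=> h1 h2.
rewrite (_ : _ - _ - _ = A + (ln (normc (z - a)) - ln (normc (0 - a)) +
  complex.Re (\sum_(k < K) (z / a) ^+ k.+1 / k.+1%:R))); last by rewrite /A; ring.
rewrite (le_trans (ler_normD _ _))//; lra.
Qed.

Lemma ln_normc_sub_le (a c : C) m e : 0 < m -> m <= normc a -> m <= normc c ->
  normc (a - c) <= e * m -> `|ln (normc a) - ln (normc c)| <= e.
Proof.
move=> m0.
suff h (x y : C) : m <= normc x -> m <= normc y -> normc (x - y) <= e * m ->
    ln (normc x) - ln (normc y) <= e.
  move=> ma mc ac; rewrite ler_norml; apply/andP; split; last exact: h.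
  by rewrite lerNl opprB; apply: h => //; rewrite normcC.
move=> mx my xy; have x0 := lt_le_trans m0 mx; have y0 := lt_le_trans m0 my.
rewrite -ln_div ?posrE// -[normc x / _](subrK 1) addrC.
rewrite (le_trans (le_ln1Dx _))//.
  by rewrite ltrBrDr addrC subrr divr_gt0.
have -> : normc x / normc y - 1 = (normc x - normc y) / normc y.
  by field; rewrite gt_eqF.
rewrite ler_pdivrMr// (le_trans (normc_sub _ _))// (le_trans xy)//.
have e0 : 0 <= e by rewrite -(pmulr_lge0 _ m0) (le_trans _ xy)// normc_ge0.
by rewrite ler_wpM2l.
Qed.

(* Hadamard's three circles for log |f|: Borel-Caratheodory bounds the n-th
   Taylor coefficient of log f both by 2 b / r1 ^ n and by 2 B / r2 ^ n. *)
Lemma log_growth f s r1 r2 b B K z : poly_approx f s r2 -> 0 < r1 -> r1 <= r2 ->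
  (forall z, normc z <= r2 -> f (s + z) != 0) ->
  (forall z, normc z <= r1 -> normc (f (s + z)) <= normc (f s) * expR b) ->
  (forall z, normc z <= r2 -> normc (f (s + z)) <= normc (f s) * expR B) ->
  normc z < r2 ->
  normc (f s) <= normc (f (s + z)) *
    expR (2 * b * (\sum_(n < K) (normc z / r1) ^+ n) +
          2 * B * ((normc z / r2) ^+ K / (1 - normc z / r2))).
Proof.
move=> af r10 r12 f0 fb fB zr; have r20 := lt_le_trans r10 r12.
have [m m0 fm] := poly_approx_lower_bound (ltW r20) af f0.
have n0r : normc (0 : C) <= r2 by rewrite normc0 ltW.
have fs0 : 0 < normc (f s) by have := fm 0 n0r; rewrite addr0; exact: lt_le_trans.
have fz0 w : normc w <= r2 -> 0 < normc (f (s + w)).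
  by move=> /fm; exact: lt_le_trans.
set S := \sum_(n < K) _; set T := _ / (1 - _).
have S0 : 0 <= S.
  by apply: sumr_ge0 => n _; rewrite exprn_ge0// divr_ge0 ?normc_ge0 ?ltW.
have T0 : 0 <= T.
  rewrite divr_ge0 ?exprn_ge0 ?divr_ge0 ?normc_ge0 ?(ltW r20)//.
  by rewrite subr_ge0 ler_pdivrMr// mul1r ltW.
rewrite mulrC -ler_pdivrMr ?fz0 ?(ltW zr)//.
rewrite -[leLHS]lnK ?posrE ?divr_gt0 ?fz0 ?(ltW zr)// ler_expR.
rewrite ln_div ?posrE ?fz0 ?(ltW zr)//.
(* Three errors of size [e] are allowed: [f] against [p] at the centre, the same at the other point,
   and log |p / p(0)| against Re q. *)
suff H e : 0 < e -> ln (normc (f s)) - ln (normc (f (s + z))) <=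
    2 * (b + 3 * e) * S + 2 * (B + 3 * e) * T + 3 * e.
  apply/ler_addgt0Pr => e e0.
  have d0 : 0 < 3 * (2 * S + 2 * T + 1) by lra.
  have e'0 : 0 < e / (3 * (2 * S + 2 * T + 1)) by rewrite divr_gt0.
  have := H _ e'0; set e' := e / _ => h; rewrite (le_trans h)//.
  have ee : e = e' * (3 * (2 * S + 2 * T + 1)) by rewrite divfK// gt_eqF.
  rewrite ee le_eqVlt; apply/orP; left; apply/eqP; ring.
move=> e0.
pose d := Num.min (m / 2) (e * (m / 2)).
have d0 : 0 < d by rewrite lt_min !(divr_gt0, mulr_gt0).
have [d1 d2] : d <= m / 2 /\ d <= e * (m / 2).
  by rewrite /d !ge_min !lexx orbT.
have [p pP] := af _ d0.
have pm w : normc w <= r2 -> m / 2 <= normc p.[w].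
  move=> wr; have := normc_sub (f (s + w)) (f (s + w) - p.[w]).
  by rewrite subKr; have := fm w wr; have := pP w wr; lra.
have m20 : 0 < m / 2 by rewrite divr_gt0.
have p0 w : normc w <= r2 -> p.[w] != 0.
  by move=> /pm h; rewrite -normc_gt0 (lt_le_trans m20).
have pf w : normc w <= r2 -> `|ln (normc (f (s + w))) - ln (normc p.[w])| <= e.
  move=> wr; apply: (ln_normc_sub_le m20); [|exact: pm|].
    by rewrite (le_trans _ (fm w wr))//; lra.
  exact: le_trans (pP w wr) d2.
have [q q0 qP] := poly_log_approx (ltW r20) e0 p0.
have key w : normc w <= r2 ->
    `|ln (normc (f (s + w))) - ln (normc (f s)) - complex.Re q.[w]| <= 3 * e.
  move=> wr; have h1 := pf w wr; have h2 := pf 0 n0r; have h3 := qP w wr.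
  rewrite addr0 in h2; move: h1 h2 h3; rewrite !ler_norml; lra.
have reQ D w : normc w <= r2 -> normc (f (s + w)) <= normc (f s) * expR D ->
    complex.Re q.[w] <= D + 3 * e.
  move=> wr h; have := key w wr; rewrite ler_norml.
  have : ln (normc (f (s + w))) <= ln (normc (f s)) + D.
    rewrite -{1}(expRK D) -lnM ?posrE ?expR_gt0// ler_ln ?posrE ?fz0//.
    by rewrite mulr_gt0 ?expR_gt0.
  lra.
have qb n : normc q`_n * r1 ^+ n <= 2 * (b + 3 * e).
  apply: borel_caratheodory (ltW r10) q0 _ => w wr.
  by apply: reQ (fb _ wr); exact: le_trans wr r12.
have qB n : (K <= n)%N -> normc q`_n * r2 ^+ n <= 2 * (B + 3 * e).
  move=> _; apply: borel_caratheodory (ltW r20) q0 _ => w wr.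
  exact: reQ (fB _ wr).
have B0 : 0 <= 2 * (B + 3 * e).
  by have := qB K (leqnn K); apply: le_trans; rewrite mulr_ge0 ?normc_ge0 ?exprn_ge0 ?(ltW r20).
have tail := horner_tail (ltW r20) B0 qB zr.
have main : normc (\sum_(n < K) q`_n * z ^+ n) <= 2 * (b + 3 * e) * S.
  rewrite (le_trans (normc_sum _ _ _))// mulr_sumr; apply: ler_sum => n _.
  rewrite normcM normcX expr_div_n mulrA ler_pdivlMr ?exprn_gt0// mulrAC.
  by rewrite ler_wpM2r ?exprn_ge0 ?normc_ge0.
have h1 := key z (ltW zr); have h2 := Re_le_normc q.[z].
have h3 := normc_sub q.[z] (\sum_(n < K) q`_n * z ^+ n).
move: h1 h2; rewrite !ler_norml -/T in tail *; lra.
Qed.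

End LogGrowth.

(** * Contour sums *)

Section VerticalSums.
Variable R : realType.
Local Notation C := R[i].
Implicit Types (f g : C -> C) (x t e B E rho : R) (j m n : nat).

(* Riemann sum, of mesh [1 / m.+1], of [f] over the segment of abscissa [x] and
   ordinates in [-j, j]. *)
Definition vsum f x j m : C :=
  \sum_(k < (2 * j) * m.+1)
    (m.+1%:R^-1)%:C * f (x +i* (k%:R / m.+1%:R - j%:R)).

Lemma vsumD f g x j m :
  vsum (fun s => f s + g s) x j m = vsum f x j m + vsum g x j m.
Proof. by rewrite /vsum -big_split /=; apply: eq_bigr => k _; rewrite mulrDr. Qed.

Lemma vsumZ c f x j m : vsum (fun s => c * f s) x j m = c * vsum f x j m.
Proof. by rewrite /vsum mulr_sumr; apply: eq_bigr => k _; rewrite mulrCA. Qed.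

Lemma vsumB f g x j m :
  vsum (fun s => f s - g s) x j m = vsum f x j m - vsum g x j m.
Proof. by rewrite /vsum -sumrB; apply: eq_bigr => k _; rewrite mulrBr. Qed.

Lemma vsum_sum I (l : seq I) (P : pred I) (F : I -> C -> C) x j m :
  vsum (fun s => \sum_(i <- l | P i) F i s) x j m =
  \sum_(i <- l | P i) vsum (F i) x j m.
Proof.
rewrite /vsum exchange_big /=; apply: eq_bigr => k _; by rewrite mulr_sumr.
Qed.

Lemma eq_vsum f g x j m : (forall t, f (x +i* t) = g (x +i* t)) ->
  vsum f x j m = vsum g x j m.
Proof. by move=> fg; apply: eq_bigr => k _; rewrite fg. Qed.

Lemma vsum_le f (u : R -> R) x j m : (forall t, normc (f (x +i* t)) <= u t) ->
  normc (vsum f x j m) <=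
  \sum_(k < (2 * j) * m.+1) m.+1%:R^-1 * u (k%:R / m.+1%:R - j%:R).
Proof.
move=> fu; rewrite (le_trans (normc_sum _ _ _))//; apply: ler_sum => k _.
by rewrite normcM normc_ge0_real ?invr_ge0// ler_wpM2l ?invr_ge0.
Qed.

Lemma vsum_le_cst f B x j m : (forall t, normc (f (x +i* t)) <= B) ->
  normc (vsum f x j m) <= 2 * j%:R * B.
Proof.
move=> fB; rewrite (le_trans (vsum_le _ _ fB))// sumr_const card_ord.
rewrite -(mulr_natl (_ * B)) !natrM mulrA mulfK ?pnatr_eq0//.
Qed.

(** The horizontal step equals the vertical mesh. By the discrete Cauchy-Riemann equation a
    horizontal increment is -i times the vertical one up to O(h^2); the vertical increments
    telescope to the two end values, and the 2 j / h errors weighted by h leave the last term. *)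
Lemma vsum_step f x j m rho B E : 0 < rho -> m.+1%:R^-1 <= rho / 2 ->
  (forall t, poly_approx f (x +i* t) rho) ->
  (forall z t, normc z <= rho -> normc (f ((x +i* t) + z)) <= B) ->
  normc (f (x +i* j%:R)) <= E -> normc (f (x +i* - j%:R)) <= E ->
  normc (vsum f (x + m.+1%:R^-1) j m - vsum f x j m) <=
    m.+1%:R^-1 * (2 * E) + 2 * j%:R * (4 * B * (m.+1%:R^-1 / rho) ^+ 2).
Proof.
move=> rho0 hrho af fB E1 E2; set h := m.+1%:R^-1.
have h0 : 0 <= h by rewrite invr_ge0.
pose pt (k : nat) := x +i* (k%:R / m.+1%:R - j%:R) : C.
pose err s := f (s + h%:C) - f s + 'i * (f (s + 'i * h%:C) - f s).
have ptS k : pt k.+1 = pt k + 'i * h%:C.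
  apply/eqP; rewrite eq_complex /=; apply/andP; split; apply/eqP.
    by ring.
  by rewrite -(natr1 k) /h; ring.
have -> : vsum f (x + h) j m - vsum f x j m =
    h%:C * \sum_(0 <= k < (2 * j) * m.+1) err (pt k) -
    h%:C * 'i * (f (x +i* j%:R) - f (x +i* - j%:R)).
  rewrite /vsum -sumrB !big_mkord.
  have -> : f (x +i* j%:R) - f (x +i* - j%:R) =
      \sum_(k < (2 * j) * m.+1) (f (pt k + 'i * h%:C) - f (pt k)).
    rewrite -(big_mkord predT (fun k => f (pt k + 'i * h%:C) - f (pt k))).
    rewrite (@telescope_sumr_eq _ _ _ (fun k => f (pt k)))//; last first.
      by move=> k _; rewrite -ptS.
    congr (f (_ +i* _) - f (_ +i* _)); last by rewrite mul0r sub0r.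
    by rewrite !natrM mulfK ?pnatr_eq0//; ring.
  rewrite !mulr_sumr -sumrB; apply: eq_bigr => k _.
  have -> : (x + h) +i* (k%:R / m.+1%:R - j%:R) = pt k + h%:C.
    by apply/eqP; rewrite eq_complex /= addr0 !eqxx.
  rewrite -/h /err -/(pt k); ring.
rewrite (le_trans (normcB _ _))// addrC lerD//.
  rewrite !normcM normci mulr1 normc_ge0_real// ler_wpM2l//.
  by rewrite (le_trans (normcB _ _))//; lra.
rewrite mulr_sumr (le_trans (normc_sum _ _ _))//.
have -> : 2 * j%:R * (4 * B * (h / rho) ^+ 2) =
   \sum_(0 <= k < 2 * j * m.+1) h * (4 * B * (h / rho) ^+ 2).
  rewrite sumr_const_nat subn0 -(mulr_natl (h * _)) !natrM !mulrA /h mulfK//.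
apply: ler_sum => k _; rewrite normcM normc_ge0_real// ler_wpM2l//.
apply: poly_approx_cauchy_riemann => //; last by rewrite h0.
- exact: af.
- by move=> z zr; exact: fB.
Qed.

(** [n * m.+1] steps of width h = 1 / (m + 1): the end values contribute 2 n E in all, and errors of
    order h^2 per step add up to O(h), absorbed in [e] for a fine mesh. The bound [B] is asked on a
    strip wider by [rho] because it is used on the discs of radius [rho]. *)
Lemma vsum_shift f a n j rho B E e : 0 < rho -> 0 < e ->
  (forall x t, a <= x <= a + n%:R -> poly_approx f (x +i* t) rho) ->
  (forall x t, a - rho <= x <= a + n%:R + rho -> normc (f (x +i* t)) <= B) ->
  (forall x, a <= x <= a + n%:R ->
    normc (f (x +i* j%:R)) <= E /\ normc (f (x +i* - j%:R)) <= E) ->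
  exists M, forall m, (M <= m)%N ->
    normc (vsum f (a + n%:R) j m - vsum f a j m) <= 2 * n%:R * E + e.
Proof.
move=> rho0 e0 af fB fE.
have [M1 hM1] := exists_inv_nat_le 1 (divr_gt0 rho0 (ltr0n _ 2)).
have [M2 hM2] := exists_inv_nat_le (8 * n%:R * j%:R * B / rho ^+ 2) e0.
exists (maxn M1 M2) => m; rewrite geq_max => /andP[M1m M2m].
have B0 : 0 <= B.
  apply: le_trans (fB a 0 _); first exact: normc_ge0.
  by have := ler0n R n; lra.
have hm : m.+1%:R^-1 <= rho / 2.
  rewrite (le_trans _ hM1)// div1r lef_pV2 ?posrE ?ltr0n// ler_nat ltnS //.
have h0 : 0 < m.+1%:R^-1 :> R by rewrite invr_gt0.
have step i : (i <= n * m.+1)%N ->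
    normc (vsum f (a + i%:R / m.+1%:R) j m - vsum f a j m) <=
    i%:R * (m.+1%:R^-1 * (2 * E) + 2 * j%:R * (4 * B * (m.+1%:R^-1 / rho) ^+ 2)).
  elim: i => [_|i IH iN]; first by rewrite !mul0r addr0 subrr normc0.
  have ix : i%:R / m.+1%:R <= n%:R :> R.
    by rewrite ler_pdivrMr ?ltr0n// -natrM ler_nat ltnW.
  have i0 : 0 <= i%:R / m.+1%:R :> R by rewrite divr_ge0.
  have ax : a <= a + i%:R / m.+1%:R <= a + n%:R by rewrite lerDl lerD2l i0 ix.
  rewrite (le_trans (normc_tri _ (vsum f (a + i%:R / m.+1%:R) j m) _))//.
  rewrite -(natr1 i) 2!mulrDl !mul1r addrA [leRHS]addrC lerD ?IH 1?ltnW//.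
  have [E1 E2] := fE _ ax.
  apply: vsum_step => //; first by move=> t; exact: af.
  move=> z t zr; case: z zr => u v zr.
  have ur : `|u| <= rho := le_trans (Re_le_normc (u +i* v)) zr.
  have -> : (a + i%:R / m.+1%:R) +i* t + u +i* v =
    (a + i%:R / m.+1%:R + u) +i* (t + v) by [].
  by apply: fB; move: ur ax; clear; set y := a + _ / _; rewrite ler_norml; clearbody y; lra.
have := step (n * m.+1)%N (leqnn _).
rewrite natrM mulfK ?pnatr_eq0// => /le_trans; apply.
have mne : m.+1%:R != 0 :> R by rewrite pnatr_eq0.
have -> : n%:R * m.+1%:R * (m.+1%:R^-1 * (2 * E) +
   2 * j%:R * (4 * B * (m.+1%:R^-1 / rho) ^+ 2)) =
   2 * n%:R * E + (8 * n%:R * j%:R * B / rho ^+ 2) / m.+1%:R.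
  by move: (m.+1%:R) mne => h' h'0; field; rewrite (gt_eqF rho0) h'0.
rewrite lerD2l (le_trans _ hM2)// ler_wpM2l//.
  by rewrite divr_ge0 ?exprn_ge0 ?(ltW rho0)// !mulr_ge0.
by rewrite lef_pV2 ?posrE ?ltr0n// ler_nat ltnS.
Qed.

End VerticalSums.

(** * Vertical weights, and the Mellin kernel for non-positive exponents *)

Section Inversion.
Variable R : realType.
Local Notation C := R[i].
Implicit Types (f g : C -> C) (s z : C) (x y t c l e h eta : R) (j m n : nat).

(** The right side is the integral of u^(-1 - eta) over [x, x + h], the left side its lower
    rectangle. The proof needs only the tangent inequalities for exp and ln. *)
Lemma powR_telescope x h eta : 0 < x -> 0 < h -> 0 < eta ->
  h * (x + h) `^ (- (1 + eta)) <= (x `^ (- eta) - (x + h) `^ (- eta)) / eta.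
Proof.
move=> x0 h0 eta0; have y0 : 0 < x + h by rewrite addr_gt0.
rewrite ler_pdivlMr//.
have -> : (x + h) `^ (- (1 + eta)) = (x + h)^-1 * (x + h) `^ (- eta).
  rewrite opprD powRD; last by rewrite (gt_eqF y0) implybT.
  by rewrite powR_inv1 ?ltW.
have -> : x `^ (- eta) = (x + h) `^ (- eta) * expR (- eta * ln (x / (x + h))).
  by rewrite /powR !gt_eqF// -expRD ln_div ?posrE//; congr expR; ring.
set P := (x + h) `^ (- eta); have P0 : 0 < P by exact: powR_gt0.
have h1 := expR_ge1Dx (- eta * ln (x / (x + h))).
have h2 : ln (x / (x + h)) <= x / (x + h) - 1.
  rewrite -[x / _ in leLHS](subrK 1) addrC le_ln1Dx//.
  by rewrite ltrBrDr addrC subrr divr_gt0.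
have h3 : 1 - x / (x + h) = h * (x + h)^-1 by field; rewrite gt_eqF.
set w := h * (x + h)^-1 in h3.
have -> : h * ((x + h)^-1 * P) * eta = P * (eta * w) by rewrite /w; ring.
rewrite (_ : P * expR _ - P = P * (expR (- eta * ln (x / (x + h))) - 1)); last by ring.
rewrite ler_pM2l//; nra.
Qed.

Lemma riemann_tail_le h eta n : 0 < h -> 0 < eta ->
  \sum_(0 <= i < n) h * (1 + i.+1%:R * h) `^ (- (1 + eta)) <= 1 / eta.
Proof.
move=> h0 eta0.
pose F (i : nat) := - (1 + i%:R * h) `^ (- eta) / eta.
apply: (@le_trans _ _ (\sum_(0 <= i < n) (F i.+1 - F i))).
  apply: ler_sum => i _.
  have x0 : 0 < 1 + i%:R * h by rewrite ltr_pwDl// mulr_ge0// ltW.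
  have := powR_telescope x0 h0 eta0.
  have -> : 1 + i%:R * h + h = 1 + i.+1%:R * h by rewrite -(natr1 i); ring.
  move=> /le_trans; apply; rewrite /F le_eqVlt; apply/orP; left; apply/eqP; ring.
rewrite telescope_sumr// /F mul0r addr0 powR1 !mulNr opprK.
by rewrite ler_wnDl// oppr_le0 divr_ge0 ?powR_ge0 ?ltW.
Qed.

(** The bound is uniform in height and mesh, so estimates made with this weight survive both
    limits. *)
Lemma vertical_weight_le eta j m : 0 < eta ->
  \sum_(k < (2 * j) * m.+1) m.+1%:R^-1 *
    (1 + `|k%:R / m.+1%:R - j%:R|) `^ (- (1 + eta)) <= 2 * (1 + 1 / eta) :> R.
Proof.
move=> eta0; set h : R := m.+1%:R^-1; have h0 : 0 < h by rewrite invr_gt0.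
have h1 : h <= 1 by rewrite invf_le1 ?ltr0n// ler1n.
pose w (i : nat) := h * (1 + i%:R * h) `^ (- (1 + eta)).
have w0 i : 0 <= w i by rewrite mulr_ge0 ?powR_ge0 ?ltW.
have W n : \sum_(0 <= i < n) w i <= 1 + 1 / eta.
  case: n => [|n]; first by rewrite big_geq// addr_ge0// divr_ge0// ltW.
  rewrite big_nat_recl// lerD//; last exact: riemann_tail_le.
  by rewrite /w mul0r addr0 powR1 mulr1.
rewrite -(big_mkord predT (fun k => h * (1 + `|k%:R / m.+1%:R - j%:R|) `^ (- (1 + eta)))).
(* Index [j * m.+1] is ordinate 0. The lower half, reflected, starts at ordinate [h]; the upper half
   has the extra term at 0, worth at most 1. *)
have jm : (j * m.+1 <= 2 * j * m.+1)%N by rewrite leq_mul2r leq_pmull// orbT.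
have jE : j%:R = (j * m.+1)%:R * h :> R by rewrite natrM mulfK ?pnatr_eq0.
rewrite (@big_cat_nat _ _ _ (j * m.+1)%N)//= (_ : 2 * _ = (1 + 1 / eta) + (1 + 1 / eta)); last by ring.
rewrite lerD//.
  apply: (@le_trans _ _ (1 / eta)); last by lra.
  apply: le_trans (@riemann_tail_le h eta (j * m.+1)%N h0 eta0).
  rewrite big_nat_rev /= add0n le_eqVlt; apply/orP; left; apply/eqP.
  rewrite !big_nat; apply: eq_bigr => i /andP[_ ij]; congr (_ * _ `^ _).
  rewrite natrB// jE -/h.
  rewrite (_ : (_ - _) * h - _ = - (i.+1%:R * h)); last by ring.
  by rewrite normrN ger0_norm ?mulr_ge0 ?(ltW h0).
rewrite -{1}[(j * m.+1)%N]add0n big_addn; apply: le_trans (W (2 * j * m.+1 - j * m.+1)%N).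
rewrite le_eqVlt; apply/orP; left; apply/eqP; apply: eq_bigr => i _.
rewrite /w natrD jE; congr (_ * (_ + _) `^ _).
by rewrite mulrDl addrK ger0_norm// mulr_ge0// ltW.
Qed.

Lemma normc_ge_weight x t c : 0 < c -> c <= x ->
  Num.min 1 c / 2 * (1 + `|t|) <= normc (x +i* t).
Proof.
move=> c0 cx; have := Re_le_normc (x +i* t); have := Im_le_normc (x +i* t) => /=.
set n := Num.sqrt _.
have := ler_norm x; have := normr_ge0 t.
have [h|h] := leP 1 c; nra.
Qed.

(* The limit of [u] is taken in [m] (the mesh) before [j] (the height). *)
Definition iter_small (u : nat -> nat -> C) :=
  forall e, 0 < e -> exists J, forall j, (J <= j)%N ->
    exists M, forall m, (M <= m)%N -> normc (u j m) <= e.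

Lemma eq_iter_small (u v : nat -> nat -> C) : (forall j m, u j m = v j m) ->
  iter_small u -> iter_small v.
Proof.
move=> uv us e e0; have [J JP] := us e e0; exists J => j Jj.
by have [M MP] := JP j Jj; exists M => m Mm; rewrite -uv MP.
Qed.

Lemma iter_smallD (u v : nat -> nat -> C) : iter_small u -> iter_small v ->
  iter_small (fun j m => u j m + v j m).
Proof.
move=> us vs e e0; have e2 : 0 < e / 2 by rewrite divr_gt0.
have [J1 J1P] := us _ e2; have [J2 J2P] := vs _ e2.
exists (maxn J1 J2) => j; rewrite geq_max => /andP[/J1P[M1 M1P] /J2P[M2 M2P]].
exists (maxn M1 M2) => m; rewrite geq_max => /andP[/M1P h1 /M2P h2].
rewrite (le_trans (normcD _ _))//; lra.
Qed.

Lemma iter_smallZ a (u : nat -> nat -> C) : iter_small u ->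
  iter_small (fun j m => a * u j m).
Proof.
move=> us e e0; have a1 : 0 < normc a + 1 by have := normc_ge0 a; lra.
have [J JP] := us _ (divr_gt0 e0 a1); exists J => j /JP[M MP].
exists M => m /MP h; rewrite normcM; have := normc_ge0 a.
rewrite ler_pdivlMr// in h; have := normc_ge0 (u j m); nra.
Qed.

Lemma iter_small_sum I (r : seq I) (P : pred I) (u : I -> nat -> nat -> C) :
  (forall i, P i -> iter_small (u i)) ->
  iter_small (fun j m => \sum_(i <- r | P i) u i j m).
Proof.
move=> us; elim: r => [|i r IH].
  by move=> e e0; exists 0%N => j _; exists 0%N => m _; rewrite big_nil normc0 ltW.
have [Pi|Pi] := boolP (P i); last first.
  by apply: eq_iter_small IH => j m; rewrite big_cons (negPf Pi).
by apply: eq_iter_small (iter_smallD (us i Pi) IH) => j m; rewrite big_cons Pi.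
Qed.

(** This is the form in which contour shifts deliver their bounds: the heights and the far line cost
    D / j, the mesh an arbitrarily small [e]. *)
Lemma iter_smallI (u : nat -> nat -> C) (D : R) J : 0 <= D ->
  (forall j, (J <= j)%N -> (0 < j)%N -> forall e, 0 < e -> exists M, forall m,
    (M <= m)%N -> normc (u j m) <= D / j%:R + e) -> iter_small u.
Proof.
move=> D0 us e e0; have e2 : 0 < e / 2 by rewrite divr_gt0.
have [K KP] := exists_inv_nat_le D e2.
exists (maxn J K.+1) => j; rewrite geq_max => /andP[Jj Kj].
have [M MP] := us j Jj (leq_ltn_trans (leq0n _) Kj) _ e2; exists M => m /MP.
have : D / j%:R <= D / K.+1%:R.
  by rewrite ler_wpM2l// lef_pV2 ?posrE ?ltr0n ?ler_nat// (leq_ltn_trans (leq0n _) Kj).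
move=> h1 h2; have h3 := le_trans h1 KP.
by rewrite (le_trans h2)// [leRHS](splitr e) lerD2r.
Qed.

(** Its integral over a vertical line to the right of 0, divided by 2 i pi, is max(l, 0). The square
    in the denominator makes that integral absolutely convergent. *)
Definition mellin_kernel (l : R) (s : C) : C := cexp (s * l%:C) / s ^+ 2.

(* A kernel with residue 1 at [0] and a second pole at [2 c], whose positive
   values on [Re s = c] keep its integral away from 0; it normalizes residues
   and spares the evaluation of the contour integral. *)
Definition residue_kernel (c : R) (s : C) : C :=
  (2 * c)%:C / (s * ((2 * c)%:C - s)).

Lemma poly_approx_idV s r : 0 <= r ->
  (forall z, normc z <= r -> s + z != 0) -> poly_approx (fun z => z^-1) s r.
Proof.
move=> r0 h; apply: poly_approx_ext (poly_approx_subV r0 h) => z _.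
by rewrite subr0.
Qed.

Lemma right_half_disc_neq0 x t r z : r < x -> normc z <= r ->
  (x +i* t) + z != 0.
Proof.
move=> rx zr; apply/eqP => /(congr1 (@complex.Re R)); rewrite ReD /= => h.
have := le_trans (Re_le_normc z) zr; rewrite ler_norml => /andP[h1 _].
move: h h1 rx; move: (complex.Re z) => u; lra.
Qed.

Lemma normc_mellin_kernel l x t :
  normc (mellin_kernel l (x +i* t)) = expR (x * l) / normc (x +i* t) ^+ 2.
Proof.
rewrite /mellin_kernel normcM normcV normcX normc_cexp.
by congr (expR _ / _); rewrite ReM /= mulr0 subr0.
Qed.

Lemma poly_approx_mellin_kernel l x t r : 0 <= r -> r < x ->
  poly_approx (mellin_kernel l) (x +i* t) r.
Proof.
move=> r0 rx; apply: poly_approxM => //; first exact: poly_approx_cexp.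
have h : poly_approx (fun z : C => z^-1) (x +i* t) r.
  by apply: poly_approx_idV => // z zr; exact: right_half_disc_neq0 zr.
by apply: poly_approx_ext (poly_approxM r0 h h) => z _; rewrite -invfM expr2.
Qed.

Lemma normc_ge_Re x t : x <= normc (x +i* t).
Proof. exact: le_trans (ler_norm _) (Re_le_normc (x +i* t)). Qed.

Lemma normc_ge_Im x t : `|t| <= normc (x +i* t).
Proof. exact: Im_le_normc (x +i* t). Qed.

Lemma normc_sqr_ge (w : C) a : 0 < a -> a <= normc w ->
  1 / normc w ^+ 2 <= 1 / a ^+ 2.
Proof.
move=> a0 aw; have w0 := lt_le_trans a0 aw.
rewrite !div1r lef_pV2 ?posrE ?exprn_gt0// lerXn2r ?nnegrE//; exact: ltW.
Qed.

(** For l <= 0 the exponential is bounded on the right half-plane, and the line is pushed right by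
    [j], the height of the segment. The kernel is at most 1 / j^2 on the horizontal sides and on the
    far line, all of length O(j): each of the two contributes 2 / j. *)
Lemma vsum_mellin_small l c : l <= 0 -> 0 < c ->
  iter_small (vsum (mellin_kernel l) c).
Proof.
move=> l0 c0.
have kB x t a : 0 < a -> a <= normc (x +i* t) -> 0 <= x ->
    normc (mellin_kernel l (x +i* t)) <= 1 / a ^+ 2.
  move=> a0 aw x0; rewrite normc_mellin_kernel (le_trans _ (normc_sqr_ge a0 aw))//.
  by rewrite ler_wpM2r ?invr_ge0 ?exprn_ge0 ?normc_ge0// expR_le1 mulr_ge0_le0.
apply: (@iter_smallI _ 4 1) => // j _ j0 e e0.
have jR : 0 < j%:R :> R by rewrite ltr0n.
have c2 : 0 < c / 2 by rewrite divr_gt0.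
have [] := @vsum_shift R (mellin_kernel l) c j j (c / 2) (1 / (c / 2) ^+ 2)
  (1 / j%:R ^+ 2) e c2 e0.
- move=> x t /andP[cx _]; apply: poly_approx_mellin_kernel; first exact: ltW.
  by lra.
- move=> x t /andP[cx _]; apply: kB => //; last by lra.
  by apply: le_trans (normc_ge_Re x t); lra.
- move=> x /andP[cx _]; split; apply: kB => //; try lra.
  + by rewrite (le_trans _ (normc_ge_Im _ _))// ger0_norm.
  + by rewrite (le_trans _ (normc_ge_Im _ _))// normrN ger0_norm.
move=> M MP; exists M => m /MP h.
have h2 : normc (vsum (mellin_kernel l) (c + j%:R) j m) <= 2 * j%:R * (1 / j%:R ^+ 2).
  apply: vsum_le_cst => t; apply: kB => //; last by lra.
  by apply: le_trans (normc_ge_Re _ t); lra.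
have h3 : 2 * j%:R * (1 / j%:R ^+ 2) = 2 / j%:R :> R by field; rewrite gt_eqF.
have h4 := normc_sub (vsum (mellin_kernel l) c j m) (vsum (mellin_kernel l) (c + j%:R) j m).
rewrite normcC in h4; rewrite h3 in h h2.
have -> : 4 / j%:R = 2 / j%:R + 2 / j%:R :> R by rewrite -mulrDl; congr (_ / _); ring.
lra.
Qed.

End Inversion.

(** * Residue of the Mellin kernel for non-negative exponents *)

Section Residue.
Variable R : realType.
Local Notation C := R[i].
Implicit Types (f g : C -> C) (s z : C) (x y t c l e h eta : R) (j m n : nat).

(* The kernel [exp(l s) / s ^ 2] minus its principal part at [0], the simple
   pole being carried by [residue_kernel]; see [mellin_kernel_regularE]. *)
Definition mellin_kernel_regular (l c : R) (s : C) : C :=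
  cexp_quotient2 l s - l%:C / ((2 * c)%:C - s).

Lemma mellin_kernel_regularE l c s : s != 0 -> (2 * c)%:C - s != 0 ->
  mellin_kernel_regular l c s =
    mellin_kernel l s - mellin_kernel 0 s - l%:C * residue_kernel c s.
Proof.
move=> s0 cs0; rewrite /mellin_kernel_regular /cexp_quotient2 (negPf s0).
rewrite /mellin_kernel /residue_kernel mulr0 cexp0.
by move: ((2 * c)%:C) cs0 => d cs0; field; rewrite s0 cs0.
Qed.

Lemma left_half_neq (c x t : R) z r : r < 2 * c - x -> normc z <= r ->
  (2 * c)%:C - ((x +i* t) + z) != 0.
Proof.
move=> rx zr; apply/eqP => /(congr1 (@complex.Re R)).
rewrite ReD ReN ReD /= => h.
have := le_trans (Re_le_normc z) zr; rewrite ler_norml => /andP[_ h1].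
move: h h1 rx; move: (complex.Re z) => u; lra.
Qed.

Lemma poly_approx_mellin_kernel_regular l c x t r : 0 <= r -> r < 2 * c - x ->
  poly_approx (mellin_kernel_regular l c) (x +i* t) r.
Proof.
move=> r0 rx; apply: poly_approxB; first exact: poly_approx_cexp_quotient2.
apply: poly_approxZ => //.
have h : poly_approx (fun z : C => (z - (2 * c)%:C)^-1) (x +i* t) r.
  apply: poly_approx_subV => // z zr; rewrite -subr_eq0 -oppr_eq0 opprB.
  exact: left_half_neq zr.
by apply: poly_approx_ext (poly_approxN h) => z _; rewrite -invrN opprB.
Qed.

(** For l >= 0 the line is pushed left instead, across the double pole at 0. Its order-two part is
    the kernel with exponent 0, already known to be negligible, and its simple part is carried by
    [residue_kernel]; the regular remainder is then moved left by [j]. *)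
Lemma vsum_mellin_residue l c : 0 <= l -> 0 < c ->
  iter_small (fun j m =>
    vsum (mellin_kernel l) c j m - l%:C * vsum (residue_kernel c) c j m).
Proof.
move=> l0 c0.
have reg0 x t : x <= c -> 0 < `|x| \/ 0 < `|t| ->
    x +i* t != 0 /\ (2 * c)%:C - (x +i* t) != 0.
  move=> xc xt; split.
    by apply/eqP => -[x0 t0]; move: xt; rewrite x0 t0 normr0; lra.
  by apply/eqP => /(congr1 (@complex.Re R)); rewrite ReD ReN /=; lra.
suff G : iter_small (vsum (mellin_kernel_regular l c) c).
  have := iter_smallD G (vsum_mellin_small (lexx 0) c0).
  apply: eq_iter_small => j m; rewrite -vsumZ -vsumB -vsumD; apply: eq_vsum => t.
  have [|n0 n1] := reg0 c t (lexx c); first by left; rewrite gtr0_norm.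
  by rewrite mellin_kernel_regularE//; ring.
(* One summand for each piece of the regularized kernel: e^(l s) / s^2, 1 / s^2 and the multiple of
   [residue_kernel]. *)
set D := expR (l * c) + 1 + 2 * l * c.
have lc0 : 0 <= l * c by rewrite mulr_ge0// ltW.
have D0 : 0 <= D by rewrite /D; have := expR_ge0 (l * c); lra.
have gB x t a : 0 < a -> a <= normc (x +i* t) -> x <= c ->
    a <= normc ((2 * c)%:C - (x +i* t)) ->
    normc (mellin_kernel_regular l c (x +i* t)) <= D / a ^+ 2.
  move=> a0 aw xc aw'.
  have w0 := lt_le_trans a0 aw; have w'0 := lt_le_trans a0 aw'.
  rewrite mellin_kernel_regularE -?normc_gt0// /residue_kernel.
  rewrite (le_trans (normcB _ _))// (le_trans (lerD (normcB _ _) (lexx _)))//.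
  rewrite !normc_mellin_kernel mulr0 expR0 !normcM normcV normcM.
  rewrite !normc_ge0_real//; last by lra.
  have ia : 0 <= 1 / a ^+ 2 by rewrite divr_ge0 ?exprn_ge0 ?ltW.
  have k1 := normc_sqr_ge a0 aw.
  have k2 : (normc (x +i* t) * normc ((2 * c)%:C - (x +i* t)))^-1 <= 1 / a ^+ 2.
    rewrite div1r lef_pV2 ?posrE ?mulr_gt0 ?exprn_gt0// expr2.
    by rewrite ler_pM// ltW.
  have k3 : expR (x * l) <= expR (l * c) by rewrite ler_expR mulrC ler_wpM2l.
  have k4 : expR (x * l) / normc (x +i* t) ^+ 2 <= expR (l * c) * (1 / a ^+ 2).
    rewrite -(div1r (_ ^+ 2)) ler_pM ?expR_ge0//.
    by rewrite divr_ge0 ?exprn_ge0 ?normc_ge0.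
  have k5 : l * (2 * c * (normc (x +i* t) * normc ((2 * c)%:C - (x +i* t)))^-1) <=
      2 * l * c * (1 / a ^+ 2).
    move: k2; move: (_^-1) => W k2.
    rewrite (_ : l * (2 * c * W) = 2 * l * c * W); last by ring.
    by rewrite ler_wpM2l//; lra.
  have -> : D / a ^+ 2 = expR (l * c) * (1 / a ^+ 2) + 1 / a ^+ 2 +
      2 * l * c * (1 / a ^+ 2) by rewrite /D; field; rewrite gt_eqF.
  lra.
(* Once 2 c <= j, the far line Re s = c - j is at distance at least j / 2 from 0; it costs 8 D / j
   and the horizontal sides 2 D / j, whence the 10. *)
have [J JP] : exists J : nat, 2 * c <= J%:R.
  by exists (Num.trunc (2 * c)).+1; rewrite ltW// truncnS_gt.
apply: (@iter_smallI _ _ (10 * D) J); first by rewrite mulr_ge0.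
move=> j Jj j0 e e0.
have jR : 0 < j%:R :> R by rewrite ltr0n.
have cj : 2 * c <= j%:R by rewrite (le_trans JP)// ler_nat.
have c2 : 0 < c / 2 by rewrite divr_gt0.
have sym x t a : a <= `|t| -> a <= normc ((2 * c)%:C - (x +i* t)).
  move=> h; have -> : (2 * c)%:C - (x +i* t) = (2 * c - x) +i* (- t).
    by apply/eqP; rewrite eq_complex /= sub0r !eqxx.
  by rewrite (le_trans _ (normc_ge_Im _ _))// normrN.
have sym' x t : 2 * c - x <= normc ((2 * c)%:C - (x +i* t)).
  by apply: le_trans (le_Re_normc _); rewrite ReD ReN.
have [] := @vsum_shift R (mellin_kernel_regular l c) (c - j%:R) j j (c / 2)
  (4 * l ^+ 2 * expR (l * (c + c / 2)) + l / (c / 2)) (D / j%:R ^+ 2) e c2 e0.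
- move=> x t /andP[_ xc]; apply: poly_approx_mellin_kernel_regular; lra.
- move=> x t /andP[_ xc]; rewrite (le_trans (normcB _ _))// lerD//.
    rewrite (le_trans (cexp_quotient2_bound _ _))// ler_wpM2l//.
      by rewrite mulr_ge0// sqr_ge0.
    by apply: max1_expR_le; rewrite /= ?mulr_ge0 ?ler_wpM2l//; lra.
  rewrite normcM normcV normc_ge0_real// ler_wpM2l//.
  have h : c / 2 <= normc ((2 * c)%:C - (x +i* t)).
    by apply: le_trans (sym' x t); lra.
  by rewrite lef_pV2 ?posrE// (lt_le_trans c2).
- move=> x /andP[_ xc]; have xc' : x <= c by lra.
  by split; apply: gB => //; do ?[apply: sym]; rewrite ?normrN ?ger0_norm//;
    rewrite (le_trans _ (normc_ge_Im _ _))// ?normrN ger0_norm.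
move=> M MP; exists M => m /MP h; rewrite subrK in h.
have h2 : normc (vsum (mellin_kernel_regular l c) (c - j%:R) j m) <=
    2 * j%:R * (D / (j%:R / 2) ^+ 2).
  apply: vsum_le_cst => t; apply: gB; first by rewrite divr_gt0.
  - apply: le_trans (Re_le_normc _); rewrite /= distrC (le_trans _ (ler_norm _))//; lra.
  - by lra.
  - by apply: le_trans (sym' _ _); lra.
have h3 : 2 * j%:R * (D / (j%:R / 2) ^+ 2) = 8 * D / j%:R by field; rewrite gt_eqF.
have h4 : 2 * j%:R * (D / j%:R ^+ 2) = 2 * D / j%:R by field; rewrite gt_eqF.
have h5 := normc_sub (vsum (mellin_kernel_regular l c) c j m)
  (vsum (mellin_kernel_regular l c) (c - j%:R) j m).
rewrite h3 in h2; rewrite h4 in h.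
have -> : 10 * D / j%:R = 2 * D / j%:R + 8 * D / j%:R by ring.
lra.
Qed.

(** On Re s = c, 2 c - s is the conjugate of s, so the kernel equals 2 c / (c^2 + t^2). The lower
    bound keeps only the ordinates between 0 and 1, hence is independent of height and mesh. *)
Lemma vsum_residue_kernel_ge c j m : 0 < c -> (0 < j)%N ->
  2 * c / (c ^+ 2 + 1) <= normc (vsum (residue_kernel c) c j m).
Proof.
move=> c0 j0; rewrite (le_trans _ (le_Re_normc _))// /vsum Re_sum.
set h : R := m.+1%:R^-1; have h0 : 0 < h by rewrite invr_gt0.
pose w (t : R) := 2 * c / (c ^+ 2 + t ^+ 2).
have w0 t : 0 <= w t by rewrite divr_ge0 ?addr_ge0 ?sqr_ge0 ?mulr_ge0 ?ltW.
have E t : residue_kernel c (c +i* t) = (w t)%:C.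
  rewrite /residue_kernel.
  have -> : (c +i* t) * ((2 * c)%:C - (c +i* t)) = (c ^+ 2 + t ^+ 2)%:C.
    by apply/eqP; rewrite eq_complex /=; apply/andP; split; apply/eqP; ring.
  by rewrite -fmorphV -rmorphM.
under eq_bigr do rewrite E -rmorphM /=.
rewrite -(big_mkord predT (fun k => h * w (k%:R / m.+1%:R - j%:R))).
have jE : j%:R = (j * m.+1)%:R * h :> R by rewrite natrM mulfK ?pnatr_eq0.
have le1 : (j * m.+1 <= j.+1 * m.+1)%N by rewrite leq_mul2r leqnSn orbT.
have le2 : (j.+1 * m.+1 <= 2 * j * m.+1)%N.
  by rewrite leq_mul2r; apply/orP; right; lia.
have F0 k : 0 <= h * w (k%:R / m.+1%:R - j%:R) by rewrite mulr_ge0// ltW.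
rewrite (@big_cat_nat _ _ _ (j * m.+1)%N) ?(leq_trans le1)//=.
rewrite (@big_cat_nat _ _ _ (j.+1 * m.+1)%N (j * m.+1)%N)//=.
rewrite -[leLHS]add0r lerD ?sumr_ge0// -[leLHS]addr0 lerD ?sumr_ge0//.
rewrite -{1}[(j * m.+1)%N]add0n big_addn mulSn addnK.
have -> : 2 * c / (c ^+ 2 + 1) = \sum_(0 <= i < m.+1) h * (2 * c / (c ^+ 2 + 1)).
  by rewrite sumr_const_nat subn0 -[RHS]mulr_natl mulrA mulfV ?mul1r ?pnatr_eq0.
rewrite !big_nat; apply: ler_sum => i /andP[_ im]; rewrite ler_pM2l// /w natrD jE.
rewrite -/h (mulrDl i%:R) addrK /h ler_wpM2l ?mulr_ge0 ?(ltW c0)//.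
have i1 : 0 <= (i%:R / m.+1%:R : R) <= 1.
  by rewrite divr_ge0//= ler_pdivrMr ?ltr0n// mul1r ler_nat ltnW.
have i2 : (i%:R / m.+1%:R) ^+ 2 <= 1 :> R by rewrite exprn_ile1//; case/andP: i1.
rewrite lef_pV2 ?posrE ?lerD2l// ltr_pwDl ?exprn_gt0 ?sqr_ge0//.
Qed.

End Residue.

(** * A Perron formula for sums of Dirichlet coefficients *)

Section CoefficientSums.
Variable R : realType.
Local Notation C := R[i].
Implicit Types (f g : C -> C) (s z : C) (x y t c l e h eta : R) (j m n : nat).
Implicit Types (a : nat -> R) (N Y : nat).

Definition dirichlet_poly a Y (s : C) : C :=
  \sum_(1 <= n < Y.+1) (a n)%:C * cexp (- (s * (ln n%:R)%:C)).

Definition trapezoid_kernel N (s : C) : C :=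
  mellin_kernel (ln N.+1%:R) s - mellin_kernel (ln N%:R) s.

Lemma ler_ln_nat m n : (0 < m)%N -> (m <= n)%N -> ln m%:R <= ln n%:R :> R.
Proof.
by move=> m0 mn; rewrite ler_ln ?posrE ?ltr0n ?ler_nat// (leq_trans m0).
Qed.

Lemma mellin_kernel_shift l l' s :
  mellin_kernel l s * cexp (- (s * l'%:C)) = mellin_kernel (l - l') s.
Proof.
by rewrite /mellin_kernel mulrAC -cexpD -mulrBr -rmorphB.
Qed.

Lemma trapezoid_kernel_dirichlet a N Y s :
  trapezoid_kernel N s * dirichlet_poly a Y s = \sum_(1 <= n < Y.+1)
    (a n)%:C * (mellin_kernel (ln N.+1%:R - ln n%:R) s -
                mellin_kernel (ln N%:R - ln n%:R) s).
Proof.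
rewrite mulr_sumr; apply: eq_bigr => n _.
by rewrite -!mellin_kernel_shift /trapezoid_kernel; ring.
Qed.

(* [trapezoid_kernel] has Mellin transform weights [ln (N + 1) - ln N] on
   [n <= N] and [0] on [n > N], so that the sum over [n <= N] is recovered
   exactly for each integer [N]. *)
Lemma vsum_trapezoid_dirichlet a N Y c : (0 < N)%N -> (N <= Y)%N -> 0 < c ->
  iter_small (fun j m =>
    vsum (fun s => trapezoid_kernel N s * dirichlet_poly a Y s) c j m -
    ((ln N.+1%:R - ln N%:R) * \sum_(1 <= n < N.+1) a n)%:C *
      vsum (residue_kernel c) c j m).
Proof.
move=> N0 NY c0.
pose u n j m := vsum (fun s => (a n)%:C * (mellin_kernel (ln N.+1%:R - ln n%:R) s -
                mellin_kernel (ln N%:R - ln n%:R) s)) c j m.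
have uE n j m : u n j m = (a n)%:C * (vsum (mellin_kernel (ln N.+1%:R - ln n%:R)) c j m -
    vsum (mellin_kernel (ln N%:R - ln n%:R)) c j m).
  by rewrite /u vsumZ vsumB.
have big_small n : (N < n)%N -> iter_small (u n).
  move=> Nn.
  have h1 : ln N.+1%:R - ln n%:R <= 0 :> R.
    by rewrite subr_le0 ler_ln_nat.
  have h2 : ln N%:R - ln n%:R <= 0 :> R.
    by rewrite subr_le0 ler_ln_nat// ltnW.
  have := iter_smallD (vsum_mellin_small h1 c0)
    (iter_smallZ (-1) (vsum_mellin_small h2 c0)).
  move=> /(iter_smallZ (a n)%:C); apply: eq_iter_small => j m.
  by rewrite uE mulN1r.
(* For n <= N both kernels leave a residue, and the difference ln (N + 1) - ln N no longer depends
   on [n]. *)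
have small_small n : (0 < n <= N)%N -> iter_small (fun j m => u n j m -
    ((ln N.+1%:R - ln N%:R) * a n)%:C * vsum (residue_kernel c) c j m).
  move=> /andP[n0 nN].
  have h1 : 0 <= ln N.+1%:R - ln n%:R :> R.
    by rewrite subr_ge0 ler_ln_nat// (leq_trans nN).
  have h2 : 0 <= ln N%:R - ln n%:R :> R.
    by rewrite subr_ge0 ler_ln_nat.
  have := iter_smallD (vsum_mellin_residue h1 c0)
    (iter_smallZ (-1) (vsum_mellin_residue h2 c0)).
  move=> /(iter_smallZ (a n)%:C); apply: eq_iter_small => j m.
  rewrite uE !rmorphM !rmorphB /=; ring.
have H1 : iter_small (fun j m => \sum_(1 <= n < N.+1) (u n j m -
    ((ln N.+1%:R - ln N%:R) * a n)%:C * vsum (residue_kernel c) c j m)).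
  have : iter_small (fun j m => \sum_(n <- index_iota 1 N.+1 | (0 < n <= N)%N) (u n j m -
    ((ln N.+1%:R - ln N%:R) * a n)%:C * vsum (residue_kernel c) c j m)).
    by apply: iter_small_sum => n nN; exact: small_small.
  apply: eq_iter_small => j m; rewrite [RHS]big_nat_cond [LHS]big_nat_cond.
  by apply: eq_bigl => n; rewrite ltnS andbT andbb.
have H2 : iter_small (fun j m => \sum_(N.+1 <= n < Y.+1) u n j m).
  have : iter_small (fun j m => \sum_(n <- index_iota N.+1 Y.+1 | (N < n)%N) u n j m).
    by apply: iter_small_sum => n; exact: big_small.
  apply: eq_iter_small => j m; rewrite [RHS]big_nat_cond [LHS]big_nat_cond.
  apply: eq_bigl => n; rewrite andbT; case: (ltnP N n) => //=; rewrite ?andbT//.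
apply: eq_iter_small (iter_smallD H1 H2) => j m.
rewrite sumrB addrAC -(@big_cat_nat _ _ _ N.+1)//=.
congr (_ - _); last first.
  rewrite -mulr_suml; congr (_ * _).
  by rewrite mulr_sumr (raddf_sum (@real_complex_def R (Phant R))).
rewrite -vsum_sum; apply: eq_vsum => t.
by rewrite trapezoid_kernel_dirichlet.
Qed.

Lemma ln_succ_bounds N : (0 < N)%N ->
  N.+1%:R^-1 <= (ln N.+1%:R - ln N%:R : R) <= N%:R^-1.
Proof.
move=> N0; have NR : 0 < N%:R :> R by rewrite ltr0n.
have N1 : 1 <= N%:R :> R by rewrite ler1n.
have SR : 0 < N.+1%:R :> R by rewrite ltr0n.
rewrite -ln_div ?posrE//; apply/andP; split; last first.
  have -> : N.+1%:R / N%:R = 1 + N%:R^-1 :> R.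
    by rewrite -(natr1 N) mulrDl mulfV ?gt_eqF// mul1r.
  by rewrite le_ln1Dx// (@lt_trans _ _ 0)// invr_gt0.
have -> : N.+1%:R / N%:R = (1 + (- N.+1%:R^-1))^-1 :> R.
  rewrite -(natr1 N); field; rewrite natr1 !gt_eqF//=.
  by rewrite subr_gt0 ltr1n.
have p0 : 0 < 1 + - N.+1%:R^-1 :> R by rewrite subr_gt0 invf_lt1// ltr1n.
rewrite lnV ?posrE// lerNr (le_trans (le_ln1Dx _))//.
by rewrite ltrN2 invf_lt1// ltr1n.
Qed.

Lemma normc_trapezoid_kernel_le N x t : 0 < x -> (0 < N)%N ->
  normc (trapezoid_kernel N (x +i* t)) <=
    2 * expR (x * ln N.+1%:R) / normc (x +i* t) ^+ 2.
Proof.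
move=> x0 N0; rewrite (le_trans (normcB _ _))// !normc_mellin_kernel.
rewrite -mulrDl ler_wpM2r ?invr_ge0 ?exprn_ge0 ?normc_ge0//.
have : expR (x * ln N%:R) <= expR (x * ln N.+1%:R).
  by rewrite ler_expR ler_wpM2l ?(ltW x0)// ler_ln_nat.
lra.
Qed.

Lemma min1_le_powR u th : 0 < u -> 0 <= th <= 1 -> Num.min 1 u <= u `^ th :> R.
Proof.
move=> u0 /andP[th0 th1]; have [u1|u1] := leP 1 u.
  by rewrite -(powRr0 u) ler_powR.
by rewrite -{1}(powRr1 (ltW u0)) ger_powR// u0 ltW.
Qed.

(** The factor e^(lam s) - 1, with lam = ln (N + 1) - ln N <= 1 / N, is bounded both by a constant
    and by a multiple of u = |s| / N, hence by a multiple of u^(1 - 2 eps). This gains almost a full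
    factor 1 / N and still leaves the decay |s|^(-1 - 2 eps), enough to absorb a growth |t|^eps of
    the other factor. *)
Lemma normc_trapezoid_kernel_le_weight N x t eps : 0 < x -> (0 < N)%N ->
  0 < eps -> 2 * eps <= 1 ->
  normc (trapezoid_kernel N (x +i* t)) <=
    5 * expR x * (Num.min 1 x / 2) `^ (- (1 + 2 * eps)) *
    N%:R `^ (x - 1 + 2 * eps) * (1 + `|t|) `^ (- (1 + 2 * eps)).
Proof.
move=> x0 N0 e0 e1; have NR : 0 < N%:R :> R by rewrite ltr0n.
have N1 : 1 <= N%:R :> R by rewrite ler1n.
have sx : x <= normc (x +i* t) := normc_ge_Re x t.
set s := x +i* t in sx *; have s0 := lt_le_trans x0 sx.
pose lam : R := ln N.+1%:R - ln N%:R.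
have /andP[lam1 lam2] := ln_succ_bounds N0; rewrite -/lam in lam1 lam2.
have lam0 : 0 <= lam by apply: le_trans lam1; rewrite invr_ge0.
have lam3 : lam <= 1 by rewrite (le_trans lam2)// invf_le1.
have -> : trapezoid_kernel N s = cexp (s * (ln N%:R)%:C) * (cexp (s * lam%:C) - 1) / s ^+ 2.
  rewrite /trapezoid_kernel /mellin_kernel mulrBr -cexpD -mulrDr -rmorphD /=.
  by rewrite mulr1 mulrBl /lam [ln N%:R + _]addrC subrK.
rewrite 2!normcM normcV normcX normc_cexp.
have -> : expR (complex.Re (s * (ln N%:R)%:C)) = N%:R `^ x.
  by rewrite ReM /= mulr0 subr0 /powR gt_eqF.
have ReE : complex.Re (s * lam%:C) = x * lam by rewrite ReM /= mulr0 subr0.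
have xl : x * lam <= x by rewrite ler_piMr// ltW.
have xl0 : 0 <= x * lam by rewrite mulr_ge0// ltW.
have mx : Num.max 1 (expR (x * lam)) <= expR x by apply: max1_expR_le => //; exact: ltW.
have ex1 : 1 <= expR x by rewrite -expR0 ler_expR ltW.
set u := normc s / N%:R; have u0 : 0 < u by rewrite divr_gt0.
have b1 : normc (cexp (s * lam%:C) - 1) <= 5 * expR x * u.
  rewrite (le_trans (cexp_sub1_bound _))// ReE normcM normc_ge0_real//.
  rewrite -!mulrA ler_wpM2l// mulrA mulrC ler_pM ?le_max ?ler01//.
    by rewrite mulr_ge0// ltW.
  by rewrite ler_wpM2l ?(ltW s0).
have b2 : normc (cexp (s * lam%:C) - 1) <= 5 * expR x * 1.
  rewrite (le_trans (normcB _ _))// normc1 normc_cexp ReE.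
  have : expR (x * lam) <= expR x by rewrite ler_expR.
  lra.
have th : 0 <= 1 - 2 * eps <= 1 by lra.
have b3 : normc (cexp (s * lam%:C) - 1) <= 5 * expR x * u `^ (1 - 2 * eps).
  apply: le_trans (ler_wpM2l _ (min1_le_powR u0 th)); last by rewrite mulr_ge0 ?expR_ge0.
  by case: (leP 1 u).
have wt := normc_ge_weight t x0 (lexx x); rewrite -/s in wt.
have k0 : 0 < Num.min 1 x / 2 by rewrite divr_gt0// lt_min ltr01.
have t1 : 0 < 1 + `|t| by rewrite ltr_pwDl.
have b4 : normc s `^ (- (1 + 2 * eps)) <=
   (Num.min 1 x / 2) `^ (- (1 + 2 * eps)) * (1 + `|t|) `^ (- (1 + 2 * eps)).
  rewrite -powRM ?(ltW k0) ?(ltW t1)// !powRN.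
  rewrite lef_pV2 ?posrE ?powR_gt0 ?(mulr_gt0 k0 t1)//.
  by rewrite ge0_ler_powR ?nnegrE ?(ltW (mulr_gt0 k0 t1)) ?(ltW s0)//; lra.
have b5 : N%:R `^ x * u `^ (1 - 2 * eps) / normc s ^+ 2 =
    N%:R `^ (x - 1 + 2 * eps) * normc s `^ (- (1 + 2 * eps)).
  have -> : normc s ^+ 2 = normc s `^ 2%:R by rewrite powR_mulrn// ltW.
  rewrite /powR /u !gt_eqF ?divr_gt0// -expRN -!expRD ln_div ?posrE//.
  by congr expR; ring.
apply: (@le_trans _ _ (5 * expR x * (N%:R `^ x * u `^ (1 - 2 * eps) / normc s ^+ 2))).
  rewrite (mulrCA (5 * expR x)) -!mulrA ler_wpM2l ?powR_ge0//.
  rewrite !mulrA ler_wpM2r ?invr_ge0 ?exprn_ge0 ?(ltW s0)//.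
  by rewrite -(mulrA _ 5) [leRHS]mulrC.
rewrite b5 -!mulrA !ler_wpM2l ?expR_ge0//.
by rewrite [leRHS]mulrCA ler_wpM2l ?powR_ge0.
Qed.

(** On abscissa sigma + 1 the function [g] is replaced by a Dirichlet polynomial, whose vertical sum
    is the coefficient sum times lam = ln (N + 1) - ln N times a reference sum bounded below by
    [kap]. The line is then moved to sigma, where the vertical sum is O(N^(sigma - 1 + 2 eps));
    dividing by lam restores the factor N. *)
Lemma coefficient_sum_bound a g (sigma eps rho A : R) :
  0 < rho -> rho < sigma -> 0 < eps -> 2 * eps <= 1 -> 0 <= A ->
  (forall x t, sigma <= x <= sigma + 1 -> poly_approx g (x +i* t) rho) ->
  (forall x t, sigma - rho <= x <= sigma + 1 + rho ->
    normc (g (x +i* t)) <= A * (1 + `|t|) `^ eps) ->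
  (forall e, 0 < e -> exists Y0, forall Y, (Y0 <= Y)%N -> forall t,
    normc (g ((sigma + 1) +i* t) - dirichlet_poly a Y ((sigma + 1) +i* t)) <= e) ->
  exists D, forall N, (0 < N)%N ->
    `|\sum_(1 <= n < N.+1) a n| <= D * N%:R `^ (sigma + 2 * eps).
Proof.
move=> rho0 rs e0 e1 A0 ag gA gS.
have s0 : 0 < sigma by exact: lt_trans rs.
have c0 : 0 < sigma + 1 by rewrite addr_gt0.
set kap := 2 * (sigma + 1) / ((sigma + 1) ^+ 2 + 1).
have kap0 : 0 < kap by rewrite divr_gt0 ?mulr_gt0// ltr_pwDr// sqr_ge0.
pose D1 := 5 * expR sigma * (Num.min 1 sigma / 2) `^ (- (1 + 2 * eps)) * A *
  (2 * (1 + 1 / eps)).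
exists (2 * D1 / kap) => N N0; set S := \sum_(1 <= n < N.+1) a n.
have NR : 0 < N%:R :> R by rewrite ltr0n.
have /andP[lam1 _] := ln_succ_bounds N0.
set lam : R := ln N.+1%:R - ln N%:R in lam1.
have lam0 : 0 <= lam by apply: le_trans lam1; rewrite invr_ge0.
pose H s := trapezoid_kernel N s * g s.
have t1 t : 0 < 1 + `|t| by rewrite ltr_pwDl.
have sumH j m : normc (vsum H sigma j m) <= D1 * N%:R `^ (sigma - 1 + 2 * eps).
  pose w := 5 * expR sigma * (Num.min 1 sigma / 2) `^ (- (1 + 2 * eps)) *
    N%:R `^ (sigma - 1 + 2 * eps) * A.
  have w0 : 0 <= w by rewrite /w !mulr_ge0 ?powR_ge0 ?expR_ge0.
  have Hw t : normc (H (sigma +i* t)) <= w * (1 + `|t|) `^ (- (1 + eps)).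
    rewrite normcM.
    have gt : normc (g (sigma +i* t)) <= A * (1 + `|t|) `^ eps by apply: gA; lra.
    have kt := normc_trapezoid_kernel_le_weight t s0 N0 e0 e1.
    rewrite (le_trans (ler_pM (normc_ge0 _) (normc_ge0 _) kt gt))//.
    rewrite le_eqVlt; apply/orP; left; apply/eqP.
    have -> : (1 + `|t|) `^ (- (1 + eps)) = (1 + `|t|) `^ (- (1 + 2 * eps)) * (1 + `|t|) `^ eps.
      rewrite -powRD; first by congr (_ `^ _); ring.
      by rewrite (gt_eqF (t1 t)) implybT.
    by rewrite /w; ring.
  rewrite (le_trans (vsum_le _ _ Hw))//.
  under eq_bigr do rewrite mulrCA.
  rewrite -mulr_sumr (le_trans (ler_wpM2l w0 (vertical_weight_le j m e0)))//.
  by rewrite /w /D1 le_eqVlt; apply/orP; left; apply/eqP; ring.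
(* The bounds from here to [small1] depend on [N]: they serve only to let mesh and height go to
   their limits with [N] fixed. *)
pose P := 2 * expR ((sigma + 1 + rho) * ln N.+1%:R).
have P0 : 0 <= P by rewrite mulr_ge0 ?expR_ge0.
have d0 : 0 < sigma - rho by rewrite subr_gt0.
set q := Num.min 1 (sigma - rho) / 2.
have q0 : 0 < q by rewrite divr_gt0// lt_min ltr01.
have Kb x t : sigma - rho <= x <= sigma + 1 + rho ->
    normc (trapezoid_kernel N (x +i* t)) <= P / q ^+ 2 * (1 + `|t|) `^ (- 2%:R).
  move=> /andP[x1 x2]; have x0 : 0 < x by lra.
  rewrite (le_trans (normc_trapezoid_kernel_le t x0 N0))//.
  have wt := normc_ge_weight t d0 x1; rewrite -/q in wt.
  have qt : 0 < q * (1 + `|t|) by rewrite mulr_gt0.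
  rewrite powRN powR_mulrn ?(ltW (t1 t))// -[leRHS]mulrA -invfM -exprMn.
  rewrite ler_pM ?mulr_ge0 ?expR_ge0 ?invr_ge0 ?exprn_ge0 ?normc_ge0//.
    by rewrite /P ler_wpM2l// ler_expR ler_wpM2r// ln_ge0// ler1n.
  rewrite lef_pV2 ?posrE ?exprn_gt0//; last exact: lt_le_trans qt wt.
  by rewrite lerXn2r ?nnegrE ?normc_ge0// ltW.
have W0 : 0 <= P / q ^+ 2 by rewrite divr_ge0 ?exprn_ge0 ?(ltW q0).
have Hb x t : sigma - rho <= x <= sigma + 1 + rho ->
    normc (H (x +i* t)) <= P / q ^+ 2 * A * (1 + `|t|) `^ (- 1).
  move=> xI; rewrite normcM.
  rewrite (le_trans (ler_pM (normc_ge0 _) (normc_ge0 _) (Kb x t xI) (gA x t xI)))//.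
  have uv : (1 + `|t|) `^ (- 2%:R) * (1 + `|t|) `^ eps = (1 + `|t|) `^ (- 2%:R + eps).
    by rewrite powRD// (gt_eqF (t1 t)) implybT.
  rewrite (_ : P / q ^+ 2 * _ * (A * _) = P / q ^+ 2 * A * (1 + `|t|) `^ (- 2%:R + eps)).
    2: by rewrite -uv; ring.
  apply: ler_wpM2l; first exact: mulr_ge0.
  by rewrite ler_powR ?lerDl//; lra.
have WA0 : 0 <= P / q ^+ 2 * A by exact: mulr_ge0.
(* At height j the kernel decays like j^(-2) and [g] grows at most like j^eps, so the horizontal
   sides cost O(1 / j). *)
have small1 : iter_small (fun j m => vsum H (sigma + 1) j m - vsum H sigma j m).
  apply: (@iter_smallI _ _ (2 * (P / q ^+ 2 * A)) 0); first by rewrite mulr_ge0.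
  move=> j _ j0 e e_gt0; have jR : 0 < j%:R :> R by rewrite ltr0n.
  have Hj x t : sigma - rho <= x <= sigma + 1 + rho -> `|t| = j%:R ->
      normc (H (x +i* t)) <= P / q ^+ 2 * A / j%:R.
    move=> xI tj; rewrite (le_trans (Hb x t xI))// ler_wpM2l//.
    rewrite powR_inv1 ?(ltW (t1 t))// lef_pV2 ?posrE// tj; lra.
  have [] := @vsum_shift R H sigma 1 j rho (P / q ^+ 2 * A) (P / q ^+ 2 * A / j%:R) e rho0 e_gt0.
  - move=> x t xI; apply: poly_approxM; first exact: ltW.
      by apply: poly_approxB; apply: poly_approx_mellin_kernel; rewrite ?(ltW rho0)//; lra.
    exact: ag.
  - move=> x t xI; rewrite (le_trans (Hb x t xI))// ler_piMr//.
    by rewrite -[leRHS](powRr0 (1 + `|t|)) ler_powR ?lerDl//; lra.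
  - by move=> x xI; split; apply: Hj; rewrite ?normrN ?ger0_norm//; lra.
  by move=> M MP; exists M => m /MP; rewrite mulr1 mulrA.
pose V := P / q ^+ 2 * (2 * (1 + 1 / 1)).
have V0 : 0 <= V by rewrite mulr_ge0//; lra.
(* Given [e], the length [Y] of the Dirichlet polynomial is fixed, then the height [j], then the
   mesh [m]. The term [e * V] is the price of replacing [g] by the polynomial, 2 e that of the shift
   and of the residue. *)
have bound e : 0 < e -> kap * (lam * `|S|) <=
    D1 * N%:R `^ (sigma - 1 + 2 * eps) + e * V + 2 * e.
  move=> e_gt0; have [Y0 Y0P] := gS e e_gt0.
  pose Y := maxn N Y0.
  have small2 := vsum_trapezoid_dirichlet a N0 (leq_maxl N Y0) c0.
  rewrite -/Y -/lam -/S in small2.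
  have [J1 J1P] := small1 e e_gt0; have [J2 J2P] := small2 e e_gt0.
  pose j := maxn 1 (maxn J1 J2).
  have [|M1 M1P] := J1P j; first by rewrite /j !leq_max leqnn !orbT.
  have [|M2 M2P] := J2P j; first by rewrite /j !leq_max leqnn !orbT.
  pose m := maxn M1 M2.
  have h1 := M1P m (leq_maxl _ _); have h2 := M2P m (leq_maxr _ _).
  have h3 : normc (vsum H (sigma + 1) j m -
      vsum (fun s => trapezoid_kernel N s * dirichlet_poly a Y s) (sigma + 1) j m) <= e * V.
    rewrite -vsumB.
    have Hw t : normc (H ((sigma + 1) +i* t) - trapezoid_kernel N ((sigma + 1) +i* t) *
        dirichlet_poly a Y ((sigma + 1) +i* t)) <= e * (P / q ^+ 2) * (1 + `|t|) `^ (- (1 + 1)).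
      rewrite -mulrBr normcM mulrC -mulrA ler_pM ?normc_ge0//.
        by apply: Y0P; exact: leq_maxr.
      by apply: Kb; lra.
    rewrite (le_trans (vsum_le _ _ Hw))//.
    under eq_bigr do rewrite mulrCA.
    have eW : 0 <= e * (P / q ^+ 2) by rewrite mulr_ge0// ltW.
    rewrite -mulr_sumr /V [leRHS]mulrA; apply: ler_wpM2l => //.
    exact: vertical_weight_le.
  have h4 := @vsum_residue_kernel_ge R (sigma + 1) j m c0 (leq_maxl _ _).
  rewrite -/kap in h4.
  have h5 := sumH j m.
  move: h1 h2 h3 h4 h5.
  set v1 := vsum H _ j m; set v2 := vsum H _ j m; set v3 := vsum _ _ j m.
  set v4 := vsum _ _ j m => h1 h2 h3 h4 h5.
  have k1 : kap * (lam * `|S|) <= normc ((lam * S)%:C * v4).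
    rewrite normcM normc_real normrM (ger0_norm lam0) mulrC ler_wpM2l//.
    by rewrite mulr_ge0.
  have k2 : (lam * S)%:C * v4 = v2 + (v1 - v2) - (v1 - v3) - (v3 - (lam * S)%:C * v4).
    by ring.
  have k3 := normcB (v2 + (v1 - v2) - (v1 - v3)) (v3 - (lam * S)%:C * v4).
  have k4 := normcB (v2 + (v1 - v2)) (v1 - v3).
  have k5 := normcD v2 (v1 - v2).
  rewrite -k2 in k3; lra.
have bound0 : kap * (lam * `|S|) <= D1 * N%:R `^ (sigma - 1 + 2 * eps).
  apply/ler_addgt0Pr => e e_gt0.
  have V2 : 0 < V + 2 by lra.
  have := bound (e / (V + 2)) (divr_gt0 e_gt0 V2).
  rewrite -[X in _ <= X -> _]addrA (_ : _ / _ * V + _ = e)//.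
  by field; rewrite gt_eqF.
have -> : N%:R `^ (sigma + 2 * eps) = N%:R * N%:R `^ (sigma - 1 + 2 * eps).
  rewrite -{2}(powRr1 (ltW NR)) -powRD; last by rewrite (gt_eqF NR) implybT.
  by congr (_ `^ _); ring.
(* lam >= 1 / (N + 1) >= 1 / (2 N): this is where the factor N is lost. *)
have l2 : `|S| / (2 * N%:R) <= lam * `|S|.
  rewrite mulrC ler_wpM2r// (le_trans _ lam1)// lef_pV2 ?posrE ?mulr_gt0//.
  by rewrite -natrM ler_nat mul2n -addnn -addn1 leq_add2l.
rewrite -(ler_pM2l kap0) in l2.
have l3 := le_trans l2 bound0.
rewrite mulrA ler_pdivrMr ?mulr_gt0// in l3.
rewrite -(ler_pM2l kap0) (le_trans l3)// le_eqVlt; apply/orP; left; apply/eqP.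
by field; rewrite gt_eqF.
Qed.

End CoefficientSums.

(** * Limits with explicit rates, and sums of powers *)

Section ComplexLimits.
Variable R : realType.
Local Notation C := R[i].
Implicit Types (x y : R) (u : nat -> C) (b : nat -> R) (N M n : nat).

Lemma real_cauchy_limit (v b : nat -> R) :
  (forall N M, (N <= M)%N -> `|v M - v N| <= b N) ->
  (forall e, 0 < e -> exists N, b N <= e) ->
  exists l : R, (v : nat -> R) @ \oo --> l.
Proof.
move=> vb b0; have : cvgn v.
  apply/cauchy_cvgP/cauchy_ballP => _/posnumP[e].
  have e2 : 0 < e%:num / 4 by rewrite divr_gt0.
  have [N bN] := b0 _ e2.
  exists (`[v N - e%:num / 4, v N + e%:num / 4]%classic, `[v N - e%:num / 4, v N + e%:num / 4]%classic) => /=.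
    split; exists N => // M NM /=; rewrite in_itv /=;
      by have := le_trans (vb N M NM) bN; rewrite ler_norml; lra.
  move=> [x y] /= [xI yI]; move: xI yI; rewrite !in_itv /= => xI yI.
  rewrite /ball /= ltr_norml; lra.
by move=> h; exists (limn v).
Qed.

Lemma complex_cauchy_limit u b :
  (forall N M, (N <= M)%N -> normc (u M - u N) <= b N) ->
  (forall e, 0 < e -> exists N, b N <= e) ->
  exists l, forall N, normc (l - u N) <= b N.
Proof.
move=> ub b0.
have [|x xP] := @real_cauchy_limit (fun n => complex.Re (u n)) b _ b0.
  move=> N M NM; rewrite (le_trans _ (ub N M NM))// -ReN -ReD.
  exact: Re_le_normc.
have [|y yP] := @real_cauchy_limit (fun n => complex.Im (u n)) b _ b0.
  move=> N M NM; rewrite (le_trans _ (ub N M NM))// -ImN -ImD.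
  exact: Im_le_normc.
exists (x +i* y) => N; apply/ler_addgt0Pr => e e0.
have e2 : 0 < e / 2 by rewrite divr_gt0.
move/cvgrPdist_le : xP => /(_ _ e2)[M1 _ M1P].
move/cvgrPdist_le : yP => /(_ _ e2)[M2 _ M2P].
pose M := maxn N (maxn M1 M2).
have NM : (N <= M)%N by rewrite leq_maxl.
have h1 := M1P M _; have h2 := M2P M _.
have {}h1 := h1 (leq_trans (leq_maxl M1 M2) (leq_maxr _ _)).
have {}h2 := h2 (leq_trans (leq_maxr M1 M2) (leq_maxr _ _)).
have h3 := normc_le_ReIm ((x +i* y) - u M).
rewrite ReD ReN ImD ImN in h3.
have h4 := normc_tri (x +i* y) (u M) (u N).
have h5 := ub N M NM.
move: h1 h2 h3 h4 h5; rewrite /=; lra.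
Qed.

Lemma exists_powR_le (d e : R) : 0 < d -> 0 < e ->
  exists N, (0 < N)%N /\ forall M, (N <= M)%N -> M%:R `^ (- d) <= e.
Proof.
move=> d0 e0; pose N := (Num.trunc (e^-1 `^ d^-1)).+1.
have NP : e^-1 `^ d^-1 <= N%:R by rewrite ltW// truncnS_gt.
exists N; split => // M NM.
have M0 : 0 < M%:R :> R by rewrite ltr0n (leq_trans _ NM).
rewrite powRN invf_ple ?posrE ?powR_gt0//.
have -> : e^-1 = (e^-1 `^ d^-1) `^ d.
  by rewrite -powRrM mulVf ?gt_eqF// powRr1// invr_ge0 ltW.
rewrite ge0_ler_powR ?nnegrE ?powR_ge0 ?(ltW d0) ?(ltW M0)//.
by rewrite (le_trans NP)// ler_nat.
Qed.

Lemma powR_sum_le (d : R) N M : 0 < d -> (0 < N)%N -> (N <= M)%N ->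
  \sum_(N.+1 <= n < M.+1) n%:R `^ (- (1 + d)) <= N%:R `^ (- d) / d.
Proof.
move=> d0 N0 NM; pose F (n : nat) := - n%:R `^ (- d) / d : R.
apply: (@le_trans _ _ (\sum_(N <= n < M) (F n.+1 - F n))).
  rewrite big_add1 /= !big_nat; apply: ler_sum => n /andP[Nn _].
  have n0 : 0 < n%:R :> R by rewrite ltr0n (leq_trans N0).
  have := powR_telescope n0 ltr01 d0; rewrite mul1r natr1 => /le_trans; apply.
  by rewrite /F le_eqVlt; apply/orP; left; apply/eqP; ring.
rewrite telescope_sumr// /F !mulNr opprK.
by rewrite ler_wnDl// oppr_le0 divr_ge0 ?powR_ge0 ?ltW.
Qed.

Lemma powR_sum_le1 (d : R) M : 0 < d ->
  \sum_(1 <= n < M.+1) n%:R `^ (- (1 + d)) <= 1 + 1 / d.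
Proof.
move=> d0; case: M => [|M].
  by rewrite big_geq// addr_ge0// divr_ge0// ltW.
rewrite big_nat_recl//= powR1 lerD2l.
have := @powR_sum_le d 1 M.+1 d0 isT isT; rewrite powR1.
by rewrite [X in X <= _ -> _]big_add1.
Qed.

End ComplexLimits.

(** * The zeta function *)

Section EntirePart.
Variable R : realType.
Local Notation C := R[i].
Implicit Types (s z w : C) (x y t : R) (N M n : nat).

Definition npow n w : C := cexp (w * (ln n%:R)%:C).

Lemma npowD n w z : npow n (w + z) = npow n w * npow n z.
Proof. by rewrite /npow mulrDl cexpD. Qed.

Lemma npow1 w : npow 1 w = 1.
Proof. by rewrite /npow ln1 mulr0 cexp0. Qed.

Lemma npowM n m w : (0 < n)%N -> (0 < m)%N -> npow (n * m) w = npow n w * npow m w.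
Proof.
move=> n0 m0; rewrite /npow natrM lnM ?posrE ?ltr0n// rmorphD mulrDr.
exact: cexpD.
Qed.

Lemma normc_npow n w : (0 < n)%N -> normc (npow n w) = n%:R `^ complex.Re w.
Proof.
move=> n0; rewrite normc_cexp ReM /= mulr0 subr0 /powR.
by rewrite gt_eqF ?ltr0n.
Qed.

(* [s - 1] times the error in comparing [n ^ (- s)] with the integral of
   [x ^ (- s)] over [n, n + 1]; telescoping the first two terms gives
   [zeta_partialE]. *)
Definition zeta_defect n s : C :=
  npow n.+1 (1 - s) - npow n (1 - s) + (s - 1) * npow n (- s).

(** 4 e comes from the second-order remainder of the exponential, 1 from replacing ln (1 + 1 / n) by
    1 / n. *)
Definition zeta_defect_const : R := 4 * expR 1 + 1.

(** With lam = ln (n + 1) - ln n, the defect is n^(1 - s) times e^((1 - s) lam) - 1 - (1 - s) / n,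
    which is of second order in 1 / n. The resulting exponent -1 - Re s makes the series of defects
    converge on all of Re s > 0. *)
Lemma zeta_defect_bound n s : (0 < n)%N -> 0 < complex.Re s ->
  normc (zeta_defect n s) <=
    zeta_defect_const * (1 + normc s) ^+ 2 * n%:R `^ (- (1 + complex.Re s)).
Proof.
move=> n0 s0; have nR : 0 < n%:R :> R by rewrite ltr0n.
have n1 : 1 <= n%:R :> R by rewrite ler1n.
pose lam : R := ln n.+1%:R - ln n%:R.
have /andP[lam1 lam2] := @ln_succ_bounds R n n0; rewrite -/lam in lam1 lam2.
have lam0 : 0 <= lam by apply: le_trans lam1; rewrite invr_ge0.
have lam3 : lam <= 1 by rewrite (le_trans lam2)// invf_le1.
set w := 1 - s.
have -> : zeta_defect n s = npow n w * (cexp (w * lam%:C) - 1 - w * (n%:R^-1)%:C).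
  rewrite /zeta_defect -/w.
  have -> : npow n (- s) = npow n w * (n%:R^-1)%:C.
    have -> : - s = w - 1 by rewrite /w addrC addKr.
    rewrite npowD /npow mulN1r cexpN cexp_real lnK ?posrE//.
    by rewrite -fmorphV.
  have -> : npow n.+1 w = npow n w * cexp (w * lam%:C).
    rewrite /npow -cexpD -mulrDr -rmorphD /lam; congr (cexp (_ * _%:C)).
    by rewrite addrC subrK.
  by rewrite (_ : s - 1 = - w) /w; [ring|rewrite opprB].
have ReW : complex.Re w = 1 - complex.Re s by rewrite /w ReD ReN.
rewrite normcM normc_npow// ReW.
have nw : normc w <= 1 + normc s by rewrite /w (le_trans (normcB _ _))// normc1.
have s1 : 1 <= 1 + normc s by rewrite lerDl normc_ge0.
have e1 : 1 <= expR 1 :> R by rewrite -expR0 ler_expR.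
have lamn : `|lam - n%:R^-1| <= n%:R^-1 ^+ 2.
  rewrite distrC ger0_norm ?subr_ge0//.
  have h : n%:R^-1 - n.+1%:R^-1 <= n%:R^-1 ^+ 2 :> R.
    have -> : n%:R^-1 - n.+1%:R^-1 = n%:R^-1 * n.+1%:R^-1 :> R.
      rewrite -(natr1 n); field; rewrite natr1 !gt_eqF//.
    by rewrite expr2 ler_wpM2l ?invr_ge0// lef_pV2 ?posrE// ler_nat.
  by rewrite (le_trans _ h)// lerD2l lerN2.
have b1 : normc (cexp (w * lam%:C) - 1 - w * lam%:C) <=
    4 * expR 1 * (1 + normc s) ^+ 2 * n%:R^-1 ^+ 2.
  rewrite (le_trans (cexp_sub1x_bound _))// normcM (normc_ge0_real lam0).
  have mx : Num.max 1 (expR (complex.Re (w * lam%:C))) <= expR 1.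
    apply: max1_expR_le => //; rewrite ReM /= mulr0 subr0 ReW.
    have : (1 - complex.Re s) * lam <= 1 * lam by rewrite ler_wpM2r// lerBlDr lerDl ltW.
    lra.
  have -> : 4 * expR 1 * (1 + normc s) ^+ 2 * n%:R^-1 ^+ 2 =
    4 * ((1 + normc s) * n%:R^-1) ^+ 2 * expR 1 by rewrite exprMn; ring.
  rewrite ler_pM ?mulr_ge0 ?exprn_ge0 ?normc_ge0 ?le_max ?ler01//.
  rewrite ler_wpM2l// lerXn2r ?nnegrE ?mulr_ge0 ?normc_ge0 ?invr_ge0//; first lra.
  by rewrite ler_pM ?normc_ge0.
have b2 : normc (w * lam%:C - w * (n%:R^-1)%:C) <= (1 + normc s) ^+ 2 * n%:R^-1 ^+ 2.
  rewrite -mulrBr -rmorphB normcM normc_real ler_pM ?normc_ge0//.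
  by rewrite (le_trans nw)// expr2 ler_peMl//; lra.
have b3 : normc (cexp (w * lam%:C) - 1 - w * (n%:R^-1)%:C) <=
    zeta_defect_const * (1 + normc s) ^+ 2 * n%:R^-1 ^+ 2.
  rewrite (_ : _ - _ - _ = (cexp (w * lam%:C) - 1 - w * lam%:C) +
    (w * lam%:C - w * (n%:R^-1)%:C)); last by ring.
  rewrite (le_trans (normcD _ _))// (le_trans (lerD b1 b2))//.
  by rewrite /zeta_defect_const le_eqVlt; apply/orP; left; apply/eqP; ring.
have -> : n%:R `^ (- (1 + complex.Re s)) = n%:R `^ (1 - complex.Re s) * n%:R^-1 ^+ 2.
  have -> : n%:R^-1 ^+ 2 = n%:R `^ (- 2%:R) :> R.
    by rewrite powRN powR_mulrn ?ltW// exprVn.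
  rewrite -powRD; last by rewrite (gt_eqF nR) implybT.
  by congr (_ `^ _); ring.
rewrite mulrCA ler_wpM2l ?powR_ge0//.
Qed.

End EntirePart.

(** * From power series to discs, and the identity theorem along segments *)

Section AnalyticContinuation.
Variable R : realType.
Local Notation C := R[i].
Implicit Types (f : C -> C) (s z v : C) (r t e : R) (n N : nat).

Lemma cvg_normc (u : nat -> C) (l : C) : u @ \oo --> (l : C^o) ->
  forall e, 0 < e -> exists N, forall n, (N <= n)%N -> normc (l - u n) <= e.
Proof.
move=> ul e e0.
have := (iffLR (@cvgrPdist_le C (C^o) nat \oo _ u l)) ul (e%:C).
rewrite ltcR => /(_ _ e0) [N _ NP]; exists N => n /NP /=.
by rewrite normc_lec.
Qed.

(** Convergence at distance e / 2 bounds the terms there, so on the disc of radius e / 4 the partial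
    sums converge geometrically with ratio 1 / 2. *)
Lemma analytic_poly_approx f s : analytic_at f s ->
  exists2 r, 0 < r & poly_approx f s r.
Proof.
move=> [e e0 [a aP]].
have conv z : normc z < e -> forall d, 0 < d -> exists N, forall n, (N <= n)%N ->
    normc (f (s + z) - \sum_(k < n) a k * z ^+ k) <= d.
  move=> ze d d0; have := aP (s + z); rewrite addrC addKr normc_ltc => /(_ ze) h.
  have [N NP] := cvg_normc h d0; exists N => n /NP.
  by rewrite /series /= addrC big_mkord addrC.
have e2 : 0 < e / 2 by rewrite divr_gt0.
have ne2 : normc ((e / 2)%:C : C) = e / 2 by rewrite normc_ge0_real ?ltW.
have [|N NP] := conv (e / 2)%:C _ 1 ltr01; first by rewrite ne2; lra.
(* Two consecutive partial sums are each within 1 of the limit. *)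
have aB n : (N <= n)%N -> normc (a n) * (e / 2) ^+ n <= 2.
  move=> Nn; have h1 := NP n Nn; have h2 := NP n.+1 (leqW Nn).
  rewrite -ne2 -normcX -normcM.
  have h3 := normc_tri (\sum_(k < n.+1) a k * (e / 2)%:C ^+ k) (f (s + (e / 2)%:C))
     (\sum_(k < n) a k * (e / 2)%:C ^+ k).
  rewrite {1}big_ord_recr /= (addrC (\sum_(_ < _) _)) addrK in h3.
  rewrite normcC in h2; lra.
exists (e / 4); first by rewrite divr_gt0.
move=> d d0; have d2 : 0 < d / 2 by rewrite divr_gt0.
have hx : 0 <= (2^-1 : R) < 1 by rewrite invr_ge0 ler0n invf_lt1// ltr1n.
have [K KP] := geometric_small 2 hx d2.
exists (\poly_(k < maxn K N) a k) => z zr.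
have [|M MP] := conv z _ _ d2; first by lra.
pose L := maxn (maxn K N) M.
have h1 := MP L (leq_maxr _ _).
rewrite horner_poly -(subrK (\sum_(k < L) a k * z ^+ k) (f _)) -addrA.
rewrite (le_trans (normcD _ _))//.
suff : normc (\sum_(k < L) a k * z ^+ k - \sum_(k < maxn K N) a k * z ^+ k) <= d / 2.
  by lra.
rewrite -!(big_mkord predT (fun k => a k * z ^+ k)).
rewrite (@big_cat_nat _ _ _ (maxn K N)) ?leq_maxl//= addrAC subrr add0r.
rewrite (le_trans (normc_sum _ _ _))//.
apply: (@le_trans _ _ (\sum_(maxn K N <= k < L) 2 * 2^-1 ^+ k)).
  rewrite !big_nat; apply: ler_sum => k /andP[kK _].
  have kN : (N <= k)%N by rewrite (leq_trans _ kK)// leq_maxr.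
  rewrite normcM normcX.
  have zk : normc z ^+ k <= (e / 2) ^+ k * 2^-1 ^+ k.
    rewrite -exprMn lerXn2r ?nnegrE ?normc_ge0 ?mulr_ge0 ?(ltW e0)//; lra.
  rewrite (le_trans (ler_wpM2l (normc_ge0 _) zk))// mulrA ler_wpM2r ?exprn_ge0//.
  exact: aB.
rewrite -mulr_sumr (le_trans _ KP)// ler_wpM2l//.
rewrite (le_trans (geometric_tail_le _ _ hx))// ler_wpM2r//.
  by rewrite invr_ge0; lra.
by rewrite ler_wiXn2l ?leq_maxl//; lra.
Qed.

(** Compactness of the segment gives one radius [rho] valid at all its points; the vanishing is then
    carried along by steps short compared with [rho], through [poly_approx_identity]. *)
Lemma poly_approx_segment f s v :
  (forall t, 0 <= t <= 1 -> exists2 r, 0 < r & poly_approx f (s + t%:C * v) r) ->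
  (exists2 d, 0 < d & forall z, normc z <= d -> f (s + z) = 0) ->
  exists2 d, 0 < d & forall z, normc z <= d -> f (s + v + z) = 0.
Proof.
move=> fa f0.
pose P n t := t \in `[0, 1] -> poly_approx f (s + t%:C * v) n.+1%:R^-1.
have cK : compact (`[0, 1]%classic : set R) by exact: segment_compact.
have := (iffLR (compact_near_coveringP _)) cK nat \oo P _.
case=> [t t01|n0 _ /(_ n0 (leqnn _)) nP].
  have [|r r0 rP] := fa t; first by move: t01; rewrite /= in_itv.
  have v1 : 0 < normc v + 1 by have := normc_ge0 v; lra.
  have d0 : 0 < r / 2 / (normc v + 1) by rewrite !divr_gt0.
  have [N NP] := exists_inv_nat_le 1 (divr_gt0 r0 (ltr0n R 2)).
  exists (ball t (r / 2 / (normc v + 1)), [set n | (N <= n)%N]).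
    by split; [exact: nbhsx_ballx|exists N].
  move=> [t' n] [/= tt' Nn] t'01.
  apply: poly_approx_subdisc rP.
  have -> : s + t'%:C * v - (s + t%:C * v) = (t' - t)%:C * v.
    by rewrite rmorphB /=; ring.
  rewrite normcM normc_real.
  have h1 : n.+1%:R^-1 <= r / 2.
    by rewrite (le_trans _ NP)// div1r lef_pV2 ?posrE ?ltr0n// ler_nat.
  have h2 : `|t' - t| * normc v <= r / 2.
    move: tt'; rewrite /ball /= distrC => /ltW tt'.
    rewrite ler_pdivlMr// in tt'; have := normc_ge0 v; have := normr_ge0 (t' - t); nra.
  by rewrite [leRHS](splitr r) lerD.
set rho : R := n0.+1%:R^-1 in nP; have rho0 : 0 < rho by rewrite invr_gt0.
have [M MP] := exists_inv_nat_le (normc v) (divr_gt0 rho0 (ltr0n R 4)).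
pose pt (i : nat) : C := s + (i%:R / M.+1%:R)%:C * v.
suff H i : (i <= M.+1)%N -> exists2 d, 0 < d & forall z, normc z <= d -> f (pt i + z) = 0.
  by have := H M.+1 (leqnn _); rewrite /pt mulfV ?pnatr_eq0// mul1r.
elim: i => [_|i IH iM]; first by rewrite /pt mul0r mul0r addr0.
have [d d0 dP] := IH (ltnW iM).
have ai : poly_approx f (pt i) rho.
  by apply: nP; rewrite /= in_itv /= divr_ge0//= ler_pdivrMr ?ltr0n// mul1r ler_nat ltnW.
have d'0 : 0 < Num.min d rho <= rho by rewrite lt_min d0 rho0 ge_min lexx orbT.
have fz := poly_approx_identity ai d'0.
(* A step has length at most rho / 4, so the disc of radius rho / 2 about the next point lies within
   distance 3 rho / 4 of the current one. *)
exists (rho / 2); first by rewrite divr_gt0.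
move=> z zr; have -> : pt i.+1 + z = pt i + (M.+1%:R^-1%:C * v + z).
  by rewrite /pt -(natr1 i) mulrDl mul1r rmorphD /=; ring.
apply: fz; first by move=> w; rewrite le_min => /andP[/dP].
rewrite (le_lt_trans (normcD _ _))// normcM normc_ge0_real ?invr_ge0//.
by rewrite mulrC (le_lt_trans (lerD MP zr))//; lra.
Qed.

End AnalyticContinuation.

(** * Continuation of (s - 1) zeta s to Re s > 0 *)

Section RegularizedZeta.
Variable R : realType.
Local Notation C := R[i].
Implicit Types (f F zeta : C -> C) (s z v : C) (x y r t e d : R) (n N M : nat).

Definition zeta_partial N s : C := 1 + \sum_(1 <= n < N.+1) zeta_defect n s.

(* [F] continues [(s - 1) zeta s] to the right half-plane. *)
Definition regularized_zeta F := forall s N, 0 < complex.Re s -> (0 < N)%N ->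
  normc (F s - zeta_partial N s) <= zeta_defect_const R * (1 + normc s) ^+ 2 *
    (N%:R `^ (- complex.Re s) / complex.Re s).

Lemma zeta_defect_const_gt0 : 0 < zeta_defect_const R.
Proof. by rewrite /zeta_defect_const; have := expR_gt0 (1 : R); lra. Qed.

Lemma exists_regularized_zeta : exists F, regularized_zeta F.
Proof.
have : forall s, exists l, 0 < complex.Re s -> forall N, (0 < N)%N ->
    normc (l - zeta_partial N s) <= zeta_defect_const R * (1 + normc s) ^+ 2 *
    (N%:R `^ (- complex.Re s) / complex.Re s).
  move=> s; have [s0|s0] := ltP 0 (complex.Re s); last by exists 0.
  have K0 : 0 < zeta_defect_const R * (1 + normc s) ^+ 2.
    by rewrite mulr_gt0 ?zeta_defect_const_gt0// exprn_gt0// ltr_pwDl// normc_ge0.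
  have [||l lP] := @complex_cauchy_limit R (fun n => zeta_partial n.+1 s)
    (fun n => zeta_defect_const R * (1 + normc s) ^+ 2 *
    (n.+1%:R `^ (- complex.Re s) / complex.Re s)).
  - move=> N M NM; rewrite /zeta_partial opprD addrACA subrr add0r.
    rewrite (@big_cat_nat _ _ _ N.+2) ?ltnS//= addrAC subrr add0r.
    rewrite (le_trans (normc_sum _ _ _))//.
    rewrite (le_trans _ (ler_wpM2l (ltW K0) (@powR_sum_le R _ N.+1 M.+1 s0 isT NM)))//.
    rewrite mulr_sumr !big_nat; apply: ler_sum => n /andP[Nn _].
    by rewrite zeta_defect_bound// (leq_trans _ Nn).
  - move=> e e0.
    have [N [_ NP]] := exists_powR_le s0
      (divr_gt0 (mulr_gt0 e0 s0) K0).
    exists N; rewrite mulrA ler_pdivrMr// mulrC -ler_pdivlMr//.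
    exact: NP.
  by exists l => _ [|N]// _; exact: lP.
by move=> /choice[F FP]; exists F => s N s0 N0; exact: FP.
Qed.

Lemma poly_approx_zeta_partial N s r : 0 <= r ->
  poly_approx (zeta_partial N) s r.
Proof.
move=> r0; apply: poly_approxD; first exact: poly_approx_cst.
apply: poly_approx_sum => n _.
have pn k c : poly_approx (fun z : C => npow k (c - z)) s r.
  have := poly_approxZ (npow k c) r0 (poly_approx_cexp (- (ln k%:R)%:C) s r0).
  by apply: poly_approx_ext => z _; rewrite npowD /npow mulrN mulNr.
apply: poly_approxD; first exact: poly_approxB.
apply: poly_approxM => //.
  by apply: poly_approxB; [exact: poly_approx_id|exact: poly_approx_cst].
by apply: poly_approx_ext (pn n 0) => z _; rewrite sub0r.
Qed.

Lemma regularized_zeta_approx F s r : regularized_zeta F ->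
  0 <= r < complex.Re s -> poly_approx F s r.
Proof.
move=> FP /andP[r0 rs]; apply: poly_approx_lim => e e0.
set d := complex.Re s - r; have d0 : 0 < d by rewrite subr_gt0.
set K := zeta_defect_const R * (1 + (normc s + r)) ^+ 2 / d.
have K0 : 0 < K.
  rewrite divr_gt0// mulr_gt0 ?zeta_defect_const_gt0// exprn_gt0//.
  by have := normc_ge0 s; lra.
have [N [N0 /(_ N (leqnn N)) NP]] := exists_powR_le d0 (divr_gt0 e0 K0).
exists (zeta_partial N); first exact: poly_approx_zeta_partial.
move=> z zr; have dz : d <= complex.Re (s + z).
  have := le_trans (Re_le_normc z) zr; rewrite ler_norml ReD /d => /andP[h _].
  by rewrite lerD2l.
have sz0 := lt_le_trans d0 dz.
rewrite (le_trans (FP _ _ sz0 N0))//.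
rewrite ler_pdivlMr// in NP; apply: le_trans NP; rewrite /K [leRHS]mulrC.
rewrite -[leRHS]mulrA; apply: ler_pM.
- by rewrite mulr_ge0 ?(ltW zeta_defect_const_gt0)// exprn_ge0// addr_ge0// normc_ge0.
- by rewrite divr_ge0 ?powR_ge0// ltW.
- rewrite ler_wpM2l ?(ltW zeta_defect_const_gt0)//.
  rewrite lerXn2r ?nnegrE ?addr_ge0 ?normc_ge0// lerD2l.
  by rewrite (le_trans (normcD _ _))// lerD2l.
- rewrite mulrC ler_pM ?powR_ge0 ?invr_ge0 ?(ltW sz0)//.
    by rewrite ler_powR ?ler1n// lerN2.
  by rewrite lef_pV2 ?posrE.
Qed.

(** Comparison with a single defect already gives polynomial growth. The degree is immaterial, since
    only the logarithm of this bound enters [log_growth]. *)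
Lemma regularized_zeta_bound F s d : regularized_zeta F -> 0 < d ->
  d <= complex.Re s ->
  normc (F s) <= (1 + zeta_defect_const R * (1 + 1 / d)) * (1 + normc s) ^+ 2.
Proof.
move=> FP d0 ds; have s0 := lt_le_trans d0 ds.
have := FP s 1%N s0 isT; rewrite powR1 /zeta_partial big_nat1 => h1.
have h2 := zeta_defect_bound (ltn0Sn 0) s0; rewrite powR1 mulr1 in h2.
have s1 : 1 <= (1 + normc s) ^+ 2 by rewrite exprn_ege1// lerDl normc_ge0.
have K0 := zeta_defect_const_gt0.
set Q := (1 + normc s) ^+ 2 in s1 h1 h2 *.
have h3 : (complex.Re s)^-1 <= d^-1 by rewrite lef_pV2 ?posrE.
have h4 : zeta_defect_const R * Q * (1 / complex.Re s) <= zeta_defect_const R * Q * d^-1.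
  by rewrite div1r ler_wpM2l// mulr_ge0 ?(ltW K0)//; lra.
have h5 := normcD (F s - (1 + zeta_defect 1 s)) (1 + zeta_defect 1 s).
have h6 := normcD 1 (zeta_defect 1 s).
rewrite subrK in h5; rewrite normc1 in h6.
rewrite div1r (_ : _ * Q = Q + zeta_defect_const R * Q + zeta_defect_const R * Q * d^-1); last by ring.
lra.
Qed.

Lemma zeta_partialE N s : zeta_partial N s =
  npow N.+1 (1 - s) + (s - 1) * \sum_(1 <= n < N.+1) npow n (- s).
Proof.
rewrite /zeta_partial /zeta_defect big_split /= -mulr_sumr addrA; congr (_ + _).
by rewrite telescope_sumr// npow1 addrC subrK.
Qed.

Lemma zeta_dirichlet zeta s e : is_riemann_zeta zeta -> 1 < complex.Re s ->
  0 < e -> exists N0, forall N, (N0 <= N)%N ->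
    normc (zeta s - \sum_(1 <= n < N.+1) npow n (- s)) <= e.
Proof.
move=> [zP _] s1 e0; have [N0 NP] := cvg_normc (zP s s1) e0.
exists N0 => N /NP; rewrite /series /= big_add1 /=.
by under eq_bigr do rewrite /zeta_term -mulNr.
Qed.

(** In [zeta_partialE] the boundary term (N + 1)^(1 - s) tends to 0 when Re s > 1. *)
Lemma regularized_zetaE_gt1 zeta F s : is_riemann_zeta zeta ->
  regularized_zeta F -> 1 < complex.Re s -> F s = (s - 1) * zeta s.
Proof.
move=> zP FP s1; have s0 : 0 < complex.Re s by lra.
apply/eqP; rewrite -subr_eq0 -normc_eq0 eq_le normc_ge0 andbT.
apply/ler_addgt0Pr => e e0; rewrite add0r.
have e3 : 0 < e / 3 by rewrite divr_gt0.
have n1 : 0 < normc (s - 1) + 1 by have := normc_ge0 (s - 1); lra.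
have [N1 N1P] := zeta_dirichlet zP s1 (divr_gt0 e3 n1).
have d1 : 0 < complex.Re s - 1 by lra.
have [N2 [_ N2P]] := exists_powR_le d1 e3.
have K0 : 0 < zeta_defect_const R * (1 + normc s) ^+ 2 / complex.Re s.
  by rewrite divr_gt0// mulr_gt0 ?zeta_defect_const_gt0// exprn_gt0// ltr_pwDl// normc_ge0.
have [N3 [N30 N3P]] := exists_powR_le s0 (divr_gt0 e3 K0).
pose N := maxn N1 (maxn N2 N3).
have h1 := N1P N (leq_maxl _ _).
have h2 := N2P N.+1 (leqW (leq_trans (leq_maxl N2 N3) (leq_maxr _ _))).
have NN3 : (N3 <= N)%N := leq_trans (leq_maxr N2 N3) (leq_maxr _ _).
have h3 := N3P N NN3.
have h4 := FP s N s0 (leq_trans N30 NN3).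
have h5 : normc (F s - zeta_partial N s) <= e / 3.
  rewrite (le_trans h4)//; rewrite ler_pdivlMr// in h3.
  by apply: le_trans h3; rewrite le_eqVlt; apply/orP; left; apply/eqP; ring.
have h6 : normc (npow N.+1 (1 - s)) <= e / 3.
  rewrite normc_npow// (le_trans _ h2)// le_eqVlt; apply/orP; left; apply/eqP.
  by rewrite ReD ReN opprB.
have h7 : normc ((s - 1) * (\sum_(1 <= n < N.+1) npow n (- s) - zeta s)) <= e / 3.
  rewrite normcM (normcC _ (zeta s)); rewrite ler_pdivlMr// in h1.
  have := normc_ge0 (zeta s - \sum_(1 <= n < N.+1) npow n (- s)).
  have := normc_ge0 (s - 1); nra.
have -> : F s - (s - 1) * zeta s = (F s - zeta_partial N s) + npow N.+1 (1 - s) +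
    (s - 1) * (\sum_(1 <= n < N.+1) npow n (- s) - zeta s).
  by rewrite zeta_partialE; ring.
rewrite (le_trans (normcD _ _))// (le_trans (lerD (normcD _ _) (lexx _)))//; lra.
Qed.

(** The difference vanishes on Re s > 1 and is locally analytic off 1, so its vanishing is carried
    along segments that avoid 1: horizontal ones from abscissa 2 for non-real points, then a
    vertical one for real points. *)
Lemma regularized_zetaE zeta F s : is_riemann_zeta zeta ->
  regularized_zeta F -> 0 < complex.Re s -> s != 1 -> F s = (s - 1) * zeta s.
Proof.
move=> zP FP s0 s1.
pose f z := F z - (z - 1) * zeta z.
suff : f s = 0 by move/eqP; rewrite subr_eq0 => /eqP.
have f1 z : 1 < complex.Re z -> f z = 0.
  by move=> z1; rewrite /f (regularized_zetaE_gt1 zP FP z1) subrr.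
have fa z : 0 < complex.Re z -> z != 1 -> exists2 r, 0 < r & poly_approx f z r.
  move=> z0 z1; have [r r0 rP] := analytic_poly_approx (zP.2 z z1).
  pose r' := Num.min r (complex.Re z / 2).
  have r'0 : 0 < r' by rewrite lt_min r0 divr_gt0.
  have [r'1 r'2] : r' <= r /\ r' <= complex.Re z / 2.
    by rewrite /r' !ge_min !lexx orbT.
  exists r' => //; apply: poly_approxB.
    by apply: regularized_zeta_approx => //; rewrite (ltW r'0)/=; lra.
  apply: poly_approxM; first exact: ltW.
    by apply: poly_approxB; [exact: poly_approx_id|exact: poly_approx_cst].
  by apply: poly_approx_subdisc rP; rewrite subrr normc0 add0r.
have [s2|s2] := ltP 1 (complex.Re s); first exact: f1.
have start t : exists2 d, 0 < d & forall z, normc z <= d -> f ((2 +i* t) + z) = 0.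
  exists 2^-1; first by rewrite invr_gt0.
  move=> z zr; apply: f1; rewrite ReD /=.
  have := le_trans (Re_le_normc z) zr; rewrite ler_norml => /andP[h _].
  by apply: (@lt_le_trans _ _ (2 - 2^-1)); [lra|rewrite lerD2l].
have fend z : (exists2 d, 0 < d & forall w, normc w <= d -> f (z + w) = 0) -> f z = 0.
  by move=> [d d0 /(_ 0)]; rewrite normc0 addr0 => /(_ (ltW d0)).
have horizontal x t : 0 < x <= 1 -> t != 0 ->
    exists2 d, 0 < d & forall w, normc w <= d -> f ((x +i* t) + w) = 0.
  move=> /andP[x0 x1] t0.
  have -> : x +i* t = (2 +i* t) + (x - 2)%:C.
    by apply/eqP; rewrite eq_complex /= addr0 addrC subrK !eqxx.
  apply: poly_approx_segment (start t) => u /andP[u0 u1]; apply: fa.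
    by rewrite ReD -rmorphM /=; nra.
  by rewrite eq_complex ImD -rmorphM /= addr0 (negPf t0) andbF.
have sE : s = complex.Re s +i* complex.Im s by case: (s).
have [t0|t0] := eqVneq (complex.Im s) 0; last first.
  by rewrite sE; apply/fend/horizontal => //; rewrite s0.
(* A real point is reached from height 1; the vertical segment misses 1 because its abscissa is not
   1. *)
apply: fend; have -> : s = (complex.Re s +i* 1) + (0 -i* 1).
  by apply/eqP; rewrite eq_complex /= addr0 subrr t0 !eqxx.
apply: poly_approx_segment; last by apply: horizontal; rewrite ?s0 ?oner_eq0.
have x1 : complex.Re s != 1.
  by apply: contra s1 => /eqP x1; rewrite eq_complex x1 t0 /= !eqxx.
move=> u _; apply: fa; rewrite ?eq_complex ?ReD ReM /= mulr0 mul0r subr0 addr0//.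
by rewrite (negPf x1).
Qed.

End RegularizedZeta.

(** * Growth of 1 / zeta in a zero-free half-plane *)

Section ReciprocalGrowth.
Variable R : realType.
Local Notation C := R[i].
Implicit Types (F zeta : C -> C) (s z : C) (x y t d : R) (n N : nat).

Lemma zeta_sub1_bound zeta s : is_riemann_zeta zeta -> 1 < complex.Re s ->
  normc (zeta s - 1) <= 1 / (complex.Re s - 1).
Proof.
move=> zP s1; apply/ler_addgt0Pr => e e0.
have d0 : 0 < complex.Re s - 1 by rewrite subr_gt0.
have [N0 NP] := zeta_dirichlet zP s1 e0.
have h1 := NP N0.+1 (leqnSn _).
have h2 := normc_tri (zeta s) (\sum_(1 <= n < N0.+2) npow n (- s)) 1.
have h3 : normc (\sum_(1 <= n < N0.+2) npow n (- s) - 1) <= 1 / (complex.Re s - 1).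
  rewrite big_ltn// npow1 addrC addKr (le_trans (normc_sum _ _ _))//.
  have := @powR_sum_le R _ 1 N0.+1 d0 isT isT; rewrite powR1; apply: le_trans.
  rewrite !big_nat; apply: ler_sum => n /andP[n2 _].
  rewrite normc_npow ?(leq_trans _ n2)// ReN le_eqVlt; apply/orP; left; apply/eqP.
  by congr (_ `^ _); ring.
lra.
Qed.

Lemma regularized_zeta_le zeta F s : is_riemann_zeta zeta -> regularized_zeta F ->
  2 <= complex.Re s -> normc (F s) <= 2 * normc (s - 1).
Proof.
move=> zP FP s2; have s1 : 1 < complex.Re s by lra.
rewrite (regularized_zetaE_gt1 zP FP s1) normcM mulrC ler_wpM2r ?normc_ge0//.
have h1 := zeta_sub1_bound zP s1.
have h2 : 1 / (complex.Re s - 1) <= 1 by rewrite ler_pdivrMr ?mul1r; lra.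
have := normcD (zeta s - 1) 1; rewrite subrK normc1; lra.
Qed.

Lemma regularized_zeta_ge zeta F s : is_riemann_zeta zeta -> regularized_zeta F ->
  3 <= complex.Re s -> normc (s - 1) / 2 <= normc (F s).
Proof.
move=> zP FP s3; have s1 : 1 < complex.Re s by lra.
rewrite (regularized_zetaE_gt1 zP FP s1) normcM -div1r ler_wpM2l ?normc_ge0//.
have h1 := zeta_sub1_bound zP s1.
have h2 : 1 / (complex.Re s - 1) <= 1 / 2 by rewrite ler_pdivrMr; lra.
have := normc_tri 1 (zeta s) 0; rewrite !subr0 normc1 (normcC 1); lra.
Qed.

Lemma geometric_ratio_le (x y : R) K : 0 <= x -> x <= y -> y < 1 ->
  x ^+ K / (1 - x) <= y ^+ K / (1 - y).
Proof.
move=> x0 xy y1; have y0 := le_trans x0 xy.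
rewrite ler_pM ?exprn_ge0 ?invr_ge0 ?lerXn2r ?nnegrE//; first lra.
by rewrite lef_pV2 ?posrE; lra.
Qed.

(** [log_growth] is applied about 3 + i t with radii 1 and [r2]. The small disc lies in Re s >= 2,
    where |F| is at most 2 |s - 1|; the large one reaches Re s = alpha + delta, where only
    polynomial growth is known. The points of interest stay at distance at least [delta] inside the
    large circle, so the ratio is at most [x0] < 1 whatever t. *)
Lemma reciprocal_zeta_growth zeta F (alpha delta eps : R) :
  is_riemann_zeta zeta -> regularized_zeta F ->
  0 < alpha -> 0 < delta -> alpha + 2 * delta < 1 -> 0 < eps ->
  (forall s, alpha < complex.Re s -> F s != 0) ->
  exists2 A, 0 <= A & forall x t, alpha + 2 * delta <= x <= 3 ->
    normc (((x +i* t) - 1) / F (x +i* t)) <= A * (1 + `|t|) `^ eps.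
Proof.
move=> zP FP al0 de0 ad1 e0 F0.
set r2 := 3 - alpha - delta; have r2_gt : 1 <= r2 by rewrite /r2; lra.
have r20 : 0 < r2 by lra.
have r23 : r2 <= 3 by rewrite /r2; lra.
set x0 := (3 - alpha - 2 * delta) / r2.
have x01 : 0 <= x0 < 1.
  by rewrite divr_ge0 ?(ltW r20)//=; [rewrite ltr_pdivrMr// mul1r /r2; lra|lra].
have [x00 x0lt] := andP x01.
(* The factor 4 is the coefficient of ln (7 + |t|) in 2 B; [K] is chosen so that the final exponent
   of 7 + |t| is at most [eps]. *)
have [K KP] := geometric_small 4 x01 e0.
set T0 := x0 ^+ K / (1 - x0) in KP.
have T00 : 0 <= T0 by rewrite divr_ge0 ?exprn_ge0//; lra.
set C1 := 1 + zeta_defect_const R * (1 + 1 / (alpha + delta)).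
have ad0 : 0 < alpha + delta by lra.
have C11 : 1 <= C1.
  rewrite lerDl mulr_ge0 ?(ltW (zeta_defect_const_gt0 R))//.
  by rewrite addr_ge0// divr_ge0// ltW.
set S0 : R := \sum_(n < K) 3 ^+ n.
have b0 : 0 <= ln (6 : R) by rewrite ln_ge0//; lra.
set E0 := 2 * ln 6 * S0 + 2 * ln C1 * T0.
(* 5 is the product of 5 / 2, from |s - 1| <= 5 / 2 |c - 1|, and 2, from |c - 1| <= 2 |F c|; the
   power of 7 comes from 7 + |t| <= 7 (1 + |t|). *)
exists (5 * expR E0 * 7 `^ eps); first by rewrite !mulr_ge0 ?expR_ge0 ?powR_ge0.
move=> x t /andP[x1 x3].
have x30 : 0 <= 3 - x by rewrite subr_ge0.
have xr2 : 3 - x < r2 by rewrite /r2; clear -x1 de0; lra.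
have xx0 : (3 - x) / r2 <= x0.
  by rewrite ler_wpM2r ?invr_ge0 ?(ltW r20)//; clear -x1; lra.
set c := 3 +i* t : C.
have c1E : c - 1 = 2 +i* t.
  by apply/eqP; rewrite eq_complex /= subr0; apply/andP; split; apply/eqP; ring.
have n2 : 2 <= normc (c - 1) by rewrite c1E; exact: normc_ge_Re.
have Fc_ge : normc (c - 1) / 2 <= normc (F c).
  exact: regularized_zeta_ge zP FP _.
have Fc1 : 1 <= normc (F c) by clear -n2 Fc_ge; lra.
set z := (x - 3)%:C : C.
have nz : normc z = 3 - x by rewrite normc_real distrC ger0_norm.
have sE : x +i* t = c + z.
  by apply/eqP; rewrite eq_complex /= addr0 addrC subrK !eqxx.
have t7 : 0 < 7 + `|t| by rewrite ltr_pwDl.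
(* On the large disc 1 + |c + w| <= 1 + (3 + |t|) + 3, whence the 7. *)
set B := ln C1 + 2 * ln (7 + `|t|).
have reD w : normc w <= r2 -> alpha + delta <= complex.Re (c + w).
  move=> wr; have := le_trans (Re_le_normc w) wr.
  rewrite ler_norml ReD /= /r2 => /andP[h _]; move: h.
  by clear; move: (complex.Re w) => u h; lra.
have := @log_growth R F c 1 r2 (ln 6) B K z.
move=> /(_ _ ltr01 r2_gt); move=> lg; move: (lg) => {lg}.
have p1 : poly_approx F c r2.
  by apply: regularized_zeta_approx; rewrite ?(ltW r20)//= /r2; clear -al0 de0; lra.
have p2 w : normc w <= r2 -> F (c + w) != 0.
  by move=> /reD h; apply: F0; clear -h de0; lra.
(* |F (c + w)| <= 2 (|c - 1| + 1) <= 3 |c - 1| <= 6 |F c|, using |c - 1| >= 2. *)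
have p3 w : normc w <= 1 -> normc (F (c + w)) <= normc (F c) * expR (ln 6).
  move=> w1; rewrite lnK ?posrE//.
  have re2 : 2 <= complex.Re (c + w).
    have := le_trans (Re_le_normc w) w1; rewrite ler_norml ReD /= => /andP[h _].
    by move: h; clear; move: (complex.Re w) => u h; lra.
  rewrite (le_trans (regularized_zeta_le zP FP re2))// addrAC.
  by have := normcD (c - 1) w; clear -n2 w1 Fc_ge; lra.
have p4 w : normc w <= r2 -> normc (F (c + w)) <= normc (F c) * expR B.
  move=> wr; rewrite /B expRD mulrC -mulrA; have := reD w wr => h.
  rewrite lnK ?posrE; last by clear -C11; lra.
  rewrite (_ : 2 * ln (7 + `|t|) = ln (7 + `|t|) *+ 2); last by rewrite mulr_natl.
  rewrite -lnXn// lnK ?posrE ?exprn_gt0//.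
  rewrite (le_trans (regularized_zeta_bound FP ad0 h))//.
  rewrite ler_wpM2l//; first by rewrite -/C1; clear -C11; lra.
  rewrite (@le_trans _ _ ((7 + `|t|) ^+ 2))//.
    rewrite lerXn2r ?nnegrE ?addr_ge0 ?normc_ge0//.
    have := normcD c w; have := normc_le_ReIm c; rewrite /=.
    by have := ger0_norm (_ : 0 <= 3 :> R) => -> //; clear -wr r23; lra.
  by rewrite ler_peMr// exprn_ge0// ltW.
have p5 : normc z < r2 by rewrite nz.
move=> /(_ p1 p2 p3 p4 p5); rewrite nz -sE => {p1 p2 p3 p4 p5}.
set S := \sum_(n < K) _; set T := _ / (1 - _).
have SS : S <= S0.
  by apply: ler_sum => n _; rewrite divr1 lerXn2r ?nnegrE//; clear -xr2 r23; lra.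
have TT : T <= T0 by apply: geometric_ratio_le; rewrite // divr_ge0// ltW.
have lnt : 0 <= ln (7 + `|t|) by rewrite ln_ge0// (@le_trans _ _ 7)// ?lerDl//; clear; lra.
have lC : 0 <= ln C1 by rewrite ln_ge0.
have B0 : 0 <= B by rewrite addr_ge0// mulr_ge0.
have expo : 2 * ln 6 * S + 2 * B * T <= E0 + eps * ln (7 + `|t|).
  have h1 : 2 * ln 6 * S <= 2 * ln 6 * S0 by rewrite ler_wpM2l// mulr_ge0.
  have h2 : 2 * B * T <= 2 * B * T0 by rewrite ler_wpM2l// mulr_ge0.
  have h3 : 4 * T0 * ln (7 + `|t|) <= eps * ln (7 + `|t|) by rewrite ler_wpM2r.
  rewrite /E0 /B in h2 *; clear -h1 h2 h3; lra.
move=> /le_trans /(_ (ler_wpM2l (normc_ge0 _) (_ : _ <= expR (E0 + eps * ln (7 + `|t|))))).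
rewrite ler_expR => /(_ expo).
have -> : expR (E0 + eps * ln (7 + `|t|)) = expR E0 * (7 + `|t|) `^ eps.
  by rewrite expRD /powR gt_eqF.
set W := expR E0 * _; have W0 : 0 < W by rewrite mulr_gt0 ?expR_gt0 ?powR_gt0.
move=> main.
have Fs0 : 0 < normc (F (x +i* t)) by rewrite normc_gt0 F0//=; clear -x1 de0; lra.
have s1 : normc ((x +i* t) - 1) <= 5 / 2 * normc (c - 1).
  by rewrite sE addrAC (le_trans (normcD _ _))// nz; clear -n2 x1 al0 de0; lra.
have main2 : normc (((x +i* t) - 1) / F (x +i* t)) <= 5 * W.
  by rewrite normcM normcV ler_pdivrMr//; clear -s1 Fc_ge main; lra.
rewrite (le_trans main2)// /W -!mulrA ler_wpM2l// ler_wpM2l ?expR_ge0//.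
rewrite -powRM//.
rewrite ge0_ler_powR ?nnegrE ?(ltW e0) ?(ltW t7)//.
by have := normr_ge0 t; clear; lra.
Qed.

End ReciprocalGrowth.

(** * The Moebius function *)

Section Moebius.

Lemma perm_primesM p e : prime p -> (0 < e)%N -> ~~ (p %| e)%N ->
  perm_eq (primes (p * e)) (p :: primes e).
Proof.
move=> pp e0 pe; apply: uniq_perm; first exact: primes_uniq.
  by rewrite /= primes_uniq mem_primes pp e0 /= pe.
move=> q; rewrite primesM ?(prime_gt0 pp)// primes_prime// !inE.
by [].
Qed.

Lemma mobius_primeM p e : prime p -> (0 < e)%N -> ~~ (p %| e)%N ->
  mobius (p * e) = - mobius e.
Proof.
move=> pp e0 pe; have p0 := prime_gt0 pp; rewrite /mobius muln_gt0 p0 e0 /=.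
have P := perm_primesM pp e0 pe.
rewrite (perm_size P) /= exprS mulN1r.
have -> : all (fun q => logn q (p * e) == 1%N) (primes (p * e)) =
    all (fun q => logn q e == 1%N) (primes e).
  rewrite (perm_all _ P) /= lognM// logn_prime// eqxx.
  have -> : logn p e = 0%N by apply/eqP; rewrite -leqn0 leqNgt logn_gt0 mem_primes pp e0.
  rewrite addn0 eqxx /=; apply: eq_in_all => q; rewrite mem_primes => /and3P[qp _ qe].
  rewrite lognM// logn_prime//; case: (eqVneq q p) => [qp'|]; last by rewrite add0n.
  by rewrite -qp' qe in pe.
by case: ifP; rewrite ?oppr0.
Qed.

Lemma mobius_sqr p e : prime p -> (0 < e)%N -> (p %| e)%N ->
  mobius (p * e) = 0.
Proof.
move=> pp e0 pe; have p0 := prime_gt0 pp; rewrite /mobius.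
case: ifP => // /andP[_ /allP /(_ p)].
rewrite mem_primes pp muln_gt0 p0 e0 dvdn_mulr// => /(_ isT).
rewrite lognM// logn_prime// eqxx add1n eqSS => /eqP h.
by have := logn_gt0 p e; rewrite h mem_primes pp e0 pe.
Qed.

(** With p the least prime factor of k = p k', the divisors of k are the p e for e dividing k',
    together with the e dividing k' that are prime to p. Those p e with p dividing e contribute 0,
    and the others cancel against e. *)
Lemma mobius_divisors_sum k : (1 < k)%N -> \sum_(d <- divisors k) mobius d = 0.
Proof.
move=> k1; have k0 : (0 < k)%N by exact: ltnW.
set p := pdiv k; have pp : prime p by exact: pdiv_prime.
have p0 := prime_gt0 pp; have pk : (p %| k)%N := pdiv_dvd k.
set k' := (k %/ p)%N; have kE : k = (p * k')%N by rewrite mulnC divnK.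
have k'0 : (0 < k')%N by move: k0; rewrite kE muln_gt0 => /andP[].
have -> : \sum_(d <- divisors k) mobius d =
    \sum_(d <- [seq d <- divisors k | p %| d]%N) mobius d +
    \sum_(d <- [seq d <- divisors k | ~~ (p %| d)]%N) mobius d.
  by rewrite !big_filter [LHS](bigID (fun d => p %| d)%N).
have P1 : perm_eq [seq d <- divisors k | p %| d]%N [seq p * e | e <- divisors k']%N.
  apply: uniq_perm.
  - by rewrite filter_uniq ?divisors_uniq.
  - by rewrite map_inj_uniq ?divisors_uniq// => x y /eqP; rewrite eqn_pmul2l// => /eqP.
  - move=> d; rewrite mem_filter -dvdn_divisors//; apply/andP/mapP.
      move=> [pd dk]; exists (d %/ p)%N; last by rewrite mulnC divnK.
      by rewrite -dvdn_divisors// -(@dvdn_pmul2l p)// -kE mulnC divnK.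
    move=> [e]; rewrite -dvdn_divisors// => ek ->.
    by rewrite dvdn_mulr// kE dvdn_pmul2l.
have P2 : perm_eq [seq d <- divisors k | ~~ (p %| d)]%N
    [seq e <- divisors k' | ~~ (p %| e)]%N.
  apply: uniq_perm; rewrite ?filter_uniq ?divisors_uniq// => d.
  rewrite !mem_filter -!dvdn_divisors//; case: (boolP (p %| d)%N) => //= pd.
  by rewrite kE Gauss_dvdr// coprime_sym prime_coprime.
rewrite (perm_big _ P1) (perm_big _ P2) /= big_map big_filter.
rewrite (bigID (fun e => p %| e)%N) /= big1_seq ?add0r.
  rewrite -big_split /= big_seq_cond big1// => e /andP[ek pe].
  rewrite mobius_primeM ?addNr// (dvdn_gt0 k'0)// dvdn_divisors//.
move=> e /andP[pe ek]; rewrite mobius_sqr// (dvdn_gt0 k'0)// dvdn_divisors//.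
Qed.

Lemma mobius_dvd_sum k X : (0 < k)%N -> (k <= X)%N ->
  \sum_(1 <= d < X.+1 | (d %| k)%N) mobius d = (k == 1%N)%:R.
Proof.
move=> k0 kX.
have P : perm_eq [seq d <- index_iota 1 X.+1 | d %| k]%N (divisors k).
  apply: uniq_perm; rewrite ?filter_uniq ?iota_uniq ?divisors_uniq// => d.
  rewrite mem_filter mem_index_iota -dvdn_divisors// ltnS andb_idr// => dk.
  by rewrite (dvdn_gt0 k0 dk) (leq_trans (dvdn_leq k0 dk)).
rewrite -big_filter (perm_big _ P) /=.
case: (ltnP 1 k) => [k1|k1]; first by rewrite mobius_divisors_sum// gtn_eqF.
have -> : k = 1%N by apply/eqP; rewrite eqn_leq k1 k0.
by rewrite (_ : divisors 1 = [:: 1%N])// big_seq1.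
Qed.

Lemma mobius_abs_le1 n : (`|mobius n| <= 1 :> int)%R.
Proof. by rewrite /mobius; case: ifP => _; rewrite ?normr0// normrX normrN1 expr1n. Qed.

End Moebius.

(** * The convolution of the Moebius function with 1 *)

Section MoebiusSeries.
Variable R : realType.
Local Notation C := R[i].
Implicit Types (zeta : C -> C) (s z : C) (n m k N M X Y : nat).

Definition rmobius n : R := (mobius n)%:~R.

Lemma rmobius_abs_le1 n : `|rmobius n| <= 1.
Proof. by rewrite /rmobius -intr_norm (_ : 1 = 1%:~R)// ler_int mobius_abs_le1. Qed.

Lemma normc_rmobius_le n s : (0 < n)%N ->
  normc ((rmobius n)%:C * npow n (- s)) <= n%:R `^ (- complex.Re s).
Proof.
move=> n0; rewrite normcM normc_real normc_npow// ReN.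
by rewrite ler_piMl ?powR_ge0// rmobius_abs_le1.
Qed.

Lemma dirichlet_poly_npow a Y s :
  dirichlet_poly a Y s = \sum_(1 <= n < Y.+1) (a n)%:C * npow n (- s).
Proof. by apply: eq_bigr => n _; rewrite /npow mulNr. Qed.

(** Grouping by k = n m leaves the sum of the Moebius function over the divisors of k. Cut along the
    hyperbola n m <= X the identity is exact; the right side is 0 only when the sum is empty. *)
Lemma mobius_convolution X s :
  \sum_(1 <= n < X.+1) \sum_(1 <= m < X.+1 | (n * m <= X)%N)
    (rmobius n)%:C * npow (n * m) (- s) = (0 < X)%N%:R.
Proof.
transitivity (\sum_(1 <= k < X.+1) npow k (- s) *
    \sum_(1 <= n < X.+1 | (n %| k)%N) (rmobius n)%:C).
  have inner n m : (0 < n)%N -> (0 < m)%N ->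
      (if (n * m <= X)%N then (rmobius n)%:C * npow (n * m) (- s) else 0) =
      \sum_(1 <= k < X.+1 | k == (n * m)%N) (rmobius n)%:C * npow k (- s).
    by move=> n0 m0; rewrite big_nat1_eq ltnS muln_gt0 n0 m0.
  under eq_big_nat => n /andP[n0 _].
    rewrite big_mkcond; under eq_big_nat => m /andP[m0 _] do rewrite inner//.
    rewrite (exchange_big_dep predT)//=; over.
  rewrite exchange_big /=; apply: eq_big_nat => k /andP[k0 kX].
  rewrite mulr_sumr [RHS]big_mkcond; apply: eq_big_nat => n /andP[n0 nX].
  case: ifPn => nk; last first.
    rewrite big1// => m /eqP kE; by rewrite kE dvdn_mulr in nk.
  rewrite (eq_bigl (fun m => m == (k %/ n)%N)); last first.
    by move=> m; rewrite -[in LHS](divnK nk) mulnC eqn_pmul2l// eq_sym.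
  rewrite big_nat1_eq divn_gt0// dvdn_leq//= ltnS (leq_trans (leq_div _ _)) 1?mulrC//.
have inner k : (0 < k)%N -> (k < X.+1)%N ->
    \sum_(1 <= n < X.+1 | (n %| k)%N) (rmobius n)%:C = (k == 1%N)%:R :> C.
  move=> k0 kX; have := mobius_dvd_sum k0 kX.
  move/(congr1 (fun x : int => (x%:~R : R)%:C)).
  rewrite rmorph_sum (raddf_sum (@real_complex_def R (Phant R))) /= => ->.
  by case: (k == 1%N).
under eq_big_nat => k /andP[k0 kX] do rewrite inner//.
case: X {inner} => [|X]; first by rewrite big_geq.
rewrite big_ltn// npow1 eqxx mulr1 big_nat_cond big1 ?addr0// => k /andP[/andP[k2 _] _].
by rewrite gtn_eqF// mulr0.
Qed.

End MoebiusSeries.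

(** * The Dirichlet series of the Moebius function and its coefficient sums *)

Section MoebiusInverse.
Variable R : realType.
Local Notation C := R[i].
Implicit Types (zeta : C -> C) (s z : C) (n m k N M X Y : nat).

(* If [n m > Y ^ 2] then [n > Y] or [m > Y]. *)
Lemma mobius_product_bound s Y (d : R) : 1 < complex.Re s -> (0 < Y)%N ->
  d = complex.Re s - 1 ->
  normc (dirichlet_poly (rmobius R) (Y * Y) s *
    \sum_(1 <= m < (Y * Y).+1) npow m (- s) - 1) <=
    2 * ((1 + 1 / d) * (Y%:R `^ (- d) / d)).
Proof.
move=> s1 Y0 dE; have d0 : 0 < d by rewrite dE subr_gt0.
set X := (Y * Y)%N; have X0 : (0 < X)%N by rewrite muln_gt0 Y0.
pose a n : R := n%:R `^ (- complex.Re s).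
have a0 n : 0 <= a n by exact: powR_ge0.
have aE n : a n = n%:R `^ (- (1 + d)) by rewrite /a dE; congr (_ `^ _); ring.
have -> : dirichlet_poly (rmobius R) X s * \sum_(1 <= m < X.+1) npow m (- s) - 1 =
    \sum_(1 <= n < X.+1) \sum_(1 <= m < X.+1 | ~~ (n * m <= X)%N)
      (rmobius R n)%:C * npow (n * m) (- s).
  have C1 := mobius_convolution X s; rewrite X0 in C1; rewrite -[1 in LHS]C1.
  rewrite dirichlet_poly_npow mulr_suml -sumrB; apply: eq_big_nat => n /andP[n0 _].
  rewrite mulr_sumr (bigID (fun m => n * m <= X)%N) /= addrC.
  rewrite (_ : \sum_(1 <= i < X.+1 | (n * i <= X)%N) _ =
    \sum_(1 <= m < X.+1 | (n * m <= X)%N) (rmobius R n)%:C * npow (n * m) (- s)).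
    rewrite addrK [LHS]big_nat_cond [RHS]big_nat_cond.
    by apply: eq_bigr => m /andP[/andP[m0 _] _]; rewrite npowM// mulrA.
  rewrite [LHS]big_nat_cond [RHS]big_nat_cond.
  by apply: eq_bigr => m /andP[/andP[m0 _] _]; rewrite npowM// mulrA.
rewrite (le_trans (normc_sum _ _ _))//.
have S1 : \sum_(1 <= m < X.+1) a m <= 1 + 1 / d.
  by under eq_bigr do rewrite aE; exact: powR_sum_le1.
have T1 : \sum_(1 <= n < X.+1) a n * (Y < n)%N%:R <= Y%:R `^ (- d) / d.
  have YX : (Y <= X)%N by rewrite leq_pmull.
  rewrite (@big_cat_nat _ _ _ Y.+1)//= big_nat_cond big1 ?add0r.
    rewrite (le_trans _ (powR_sum_le d0 Y0 YX))// !big_nat.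
    by apply: ler_sum => n /andP[Yn _]; rewrite Yn mulr1 aE.
  by move=> n /andP[/andP[_ nY] _]; rewrite ltnNge -ltnS nY mulr0.
have S0 : 0 <= \sum_(1 <= m < X.+1) a m by rewrite sumr_ge0.
have T0 : 0 <= \sum_(1 <= n < X.+1) a n * (Y < n)%N%:R.
  by rewrite sumr_ge0// => n _; rewrite mulr_ge0.
have ST := ler_pM S0 T0 S1 T1.
apply: (@le_trans _ _ (\sum_(1 <= n < X.+1) \sum_(1 <= m < X.+1)
    (a n * (Y < n)%N%:R * a m + a n * (a m * (Y < m)%N%:R)))).
  rewrite !big_nat; apply: ler_sum => n /andP[n0 _].
  rewrite (le_trans (normc_sum _ _ _))// [leLHS]big_mkcond !big_nat.
  apply: ler_sum => m /andP[m0 _].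
  have p0 : 0 <= a n * (Y < n)%N%:R * a m + a n * (a m * (Y < m)%N%:R).
    by rewrite addr_ge0 ?mulr_ge0.
  case: ifPn => //; rewrite -ltnNge => Xnm.
  have nm := ler_pM (normc_ge0 _) (normc_ge0 (npow m (- s))) (normc_rmobius_le s n0) (lexx _).
  rewrite npowM// mulrA normcM (le_trans nm)// normc_npow// ReN.
  rewrite -/(a n) -/(a m).
  have : (Y < n)%N || (Y < m)%N.
    rewrite -[_ || _]negbK negb_or -!leqNgt; apply/negP => /andP[nY mY].
    by move: Xnm; rewrite ltnNge leq_mul.
  case: (Y < n)%N => /=; case: (Y < m)%N => //= _; rewrite !(mulr1, mulr0, mul0r, addr0, add0r)//.
  by rewrite lerDl mulr_ge0.
under eq_bigr do rewrite big_split /= -!mulr_sumr.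
rewrite big_split /= -!mulr_suml; lra.
Qed.

(** The series of mu(n) n^(-s) converges absolutely to some [l], and [mobius_product_bound] gives l
    zeta(s) = 1. Non-vanishing on Re s > 1 follows from this identity, without an Euler product. *)
Lemma mobius_dirichlet_tail zeta s Y : is_riemann_zeta zeta ->
  1 < complex.Re s -> (0 < Y)%N ->
  zeta s != 0 /\ normc ((zeta s)^-1 - dirichlet_poly (rmobius R) Y s) <=
    Y%:R `^ (- (complex.Re s - 1)) / (complex.Re s - 1).
Proof.
move=> zP s1; set d := complex.Re s - 1; have d0 : 0 < d by rewrite subr_gt0.
have sE : complex.Re s = 1 + d by rewrite /d; ring.
have [||l lP] := @complex_cauchy_limit R (fun n => dirichlet_poly (rmobius R) n.+1 s)
    (fun n => n.+1%:R `^ (- d) / d).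
- move=> N M NM; rewrite !dirichlet_poly_npow.
  rewrite (@big_cat_nat _ _ _ N.+2) ?ltnS//= addrAC subrr add0r.
  rewrite (le_trans (normc_sum _ _ _))//.
  rewrite (le_trans _ (@powR_sum_le R d N.+1 M.+1 d0 isT NM))//.
  rewrite !big_nat; apply: ler_sum => n /andP[Nn _].
  by rewrite (le_trans (normc_rmobius_le _ _)) ?sE// (leq_trans _ Nn).
- move=> e e0; have [N [_ NP]] := exists_powR_le d0 (mulr_gt0 e0 d0).
  by exists N; rewrite ler_pdivrMr// NP.
have {}lP N : (0 < N)%N -> normc (l - dirichlet_poly (rmobius R) N s) <= N%:R `^ (- d) / d.
  by case: N => // N _; exact: lP.
suff lz : l * zeta s = 1.
  move=> Y0; have z0 : zeta s != 0.
    by apply: contra_eq_neq lz => ->; rewrite mulr0 eq_sym oner_eq0.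
  split => //; have -> : (zeta s)^-1 = l by rewrite -[l](mulfK z0) lz mul1r.
  exact: lP.
apply/eqP; rewrite -subr_eq0 -normc_eq0 eq_le normc_ge0 andbT.
apply/ler_addgt0Pr => e e0; rewrite add0r.
have Dle N : normc (dirichlet_poly (rmobius R) N s) <= 1 + 1 / d.
  rewrite dirichlet_poly_npow (le_trans (normc_sum _ _ _))//.
  rewrite (le_trans _ (powR_sum_le1 N d0))// !big_nat; apply: ler_sum => n /andP[n0 _].
  by rewrite (le_trans (normc_rmobius_le _ _))// sE.
have e3 : 0 < e / 3 by rewrite divr_gt0.
have z1 : 0 < normc (zeta s) + 1 by have := normc_ge0 (zeta s); lra.
have D1 : 0 < 1 + 1 / d by rewrite addr_gt0// divr_gt0.
have [N1 [_ N1P]] := exists_powR_le d0 (mulr_gt0 (divr_gt0 e3 z1) d0).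
have [N2 N2P] := zeta_dirichlet zP s1 (divr_gt0 e3 D1).
have c3 : 0 < 2 * (1 + 1 / d) / d by rewrite divr_gt0// mulr_gt0.
have [N3 [_ N3P]] := exists_powR_le d0 (divr_gt0 e3 c3).
clear Y; pose Y := (maxn N1 (maxn N2 N3)).+1.
have N1Y : (N1 <= Y)%N by rewrite ltnW// ltnS leq_maxl.
have N2Y : (N2 <= Y)%N by rewrite ltnW// ltnS !leq_max leqnn orbT.
have N3Y : (N3 <= Y)%N by rewrite ltnW// ltnS !leq_max leqnn !orbT.
set X := (Y * Y)%N; have YX : (Y <= X)%N by rewrite leq_pmull.
have X0 : (0 < X)%N by rewrite (leq_trans _ YX).
have h1 : normc (l - dirichlet_poly (rmobius R) X s) <= e / 3 / (normc (zeta s) + 1).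
  by rewrite (le_trans (lP X X0))// ler_pdivrMr// N1P// (leq_trans N1Y YX).
have h2 := N2P X (leq_trans N2Y YX).
have h3 := @mobius_product_bound s Y d s1 isT erefl.
have {}h3 : normc (dirichlet_poly (rmobius R) X s * \sum_(1 <= m < X.+1) npow m (- s) - 1) <= e / 3.
  rewrite (le_trans h3)//; have := N3P Y N3Y; rewrite ler_pdivlMr// => h.
  by apply: le_trans h; rewrite le_eqVlt; apply/orP; left; apply/eqP; ring.
set D := dirichlet_poly _ _ _ in h1 h3; set Z := \sum_(1 <= m < _) _ in h2 h3.
have -> : l * zeta s - 1 = (l - D) * zeta s + D * (zeta s - Z) + (D * Z - 1) by ring.
rewrite (le_trans (normcD _ _))// (le_trans (lerD (normcD _ _) (lexx _)))// !normcM.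
have k1 : normc (l - D) * normc (zeta s) <= e / 3.
  rewrite ler_pdivlMr// in h1; have := normc_ge0 (l - D); nra.
have k2 : normc D * normc (zeta s - Z) <= e / 3.
  have := ler_pM (normc_ge0 _) (normc_ge0 _) (Dle X) h2.
  by rewrite (mulrC (1 + 1 / d)) divfK ?gt_eqF.
lra.
Qed.

(* Perron's formula for [1 / zeta] with the abscissa moved to the left. *)
Lemma mertens_bound zeta (F : C -> C) (alpha delta : R) :
  is_riemann_zeta zeta -> regularized_zeta F ->
  0 < alpha -> 0 < delta -> alpha + 5 * delta < 1 ->
  (forall s, alpha < complex.Re s -> F s != 0) ->
  exists D, forall N, (0 < N)%N ->
    `|\sum_(1 <= n < N.+1) rmobius R n| <= D * N%:R `^ (alpha + 5 * delta).
Proof.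
move=> zP FP al0 de0 ad1 F0.
have ad1' : alpha + 2 * delta < 1 by lra.
have [A A0 AP] := reciprocal_zeta_growth zP FP al0 de0 ad1' de0 F0.
have r0 : 0 < delta by [].
have d21 : 2 * delta <= 1 by lra.
have sd : delta < alpha + 3 * delta by lra.
(* With sigma = alpha + 3 delta and rho = eps = delta, the widened strip starts at alpha + 2 delta,
   where the growth bound begins, and sigma + 2 eps = alpha + 5 delta. *)
have [|||D DP] := @coefficient_sum_bound R (rmobius R) (fun s => (s - 1) / F s)
  (alpha + 3 * delta) delta delta A de0 sd de0 d21 A0.
- move=> x t /andP[x1 x2].
  have rF : poly_approx F (x +i* t) delta.
    by apply: regularized_zeta_approx => //=; rewrite (ltW de0)/=; lra.
  have F0' z : normc z <= delta -> F ((x +i* t) + z) != 0.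
    move=> zd; apply: F0; rewrite ReD /=.
    have := le_trans (Re_le_normc z) zd; rewrite ler_norml => /andP[h _].
    by move: h; move: (complex.Re z) => u h; lra.
  have [m m0 mP] := poly_approx_lower_bound (ltW de0) rF F0'.
  apply: poly_approxM; first exact: ltW.
    by apply: poly_approxB; [exact: poly_approx_id|exact: poly_approx_cst].
  exact: poly_approxV (ltW de0) rF m0 mP.
- by move=> x t /andP[x1 x2]; apply: AP; lra.
- move=> e e0; set sg := alpha + 3 * delta + 1.
  have d0 : 0 < sg - 1 by rewrite /sg; lra.
  have [N0 [N00 NP]] := exists_powR_le d0 (mulr_gt0 e0 d0).
  exists N0 => Y NY t; set s := sg +i* t.
  have s1 : 1 < complex.Re s by rewrite /=; lra.
  have [z0 h] := mobius_dirichlet_tail zP s1 (leq_trans N00 NY).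
  have sn1 : s - 1 != 0.
    by rewrite subr_eq0; apply: contraTneq s1 => ->; rewrite /= ltxx.
  rewrite (regularized_zetaE_gt1 zP FP s1) invfM mulrA mulfV// mul1r.
  by rewrite (le_trans h)// ler_pdivrMr//; exact: NP.
exists D => N N0; rewrite (le_trans (DP N N0))// le_eqVlt; apply/orP; left; apply/eqP.
by congr (_ * _ `^ _); ring.
Qed.

End MoebiusInverse.

(** * The norm of M_1 as a series *)

Lemma integral_nat_levels d (T : measurableType d) (R : realType)
    (mu : {measure set T -> \bar R}) (h : T -> nat) (c : nat -> R) :
  (forall n, measurable (h @^-1` [set n])) -> (forall n, 0 <= c n) ->
  (\int[mu]_x (c (h x))%:E = \sum_(0 <= n <oo) (c n)%:E * mu (h @^-1` [set n]))%E.
Proof.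
move=> mh c0; have cover : \bigcup_n (h @^-1` [set n]) = setT.
  by apply/seteqP; split => // x _; exists (h x).
have hE n : {in h @^-1` [set n], cst (c n)%:E =1 (fun x => (c (h x))%:E)}.
  by move=> x; rewrite inE /= => ->.
rewrite -cover ge0_integral_bigcup//; last 3 first.
- apply/measurable_fun_bigcup => // n.
  by apply: eq_measurable_fun (hE n) _; exact: measurable_cst.
- by move=> x _; rewrite lee_fin.
- exact: trivIset_preimage1.
apply: eq_eseriesr => n _; rewrite -integral_cst//.
by apply: eq_integral => x /hE.
Qed.

Section MertensNorm.
Variable R : realType.
Implicit Types (r theta B : R) (n N K : nat).

Definition rmertens n : R := \sum_(1 <= k < n.+1) rmobius R k.

Lemma rmertens0 : rmertens 0 = 0.
Proof. by rewrite /rmertens big_geq. Qed.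

Lemma M1_rmertens theta : M1 theta = rmertens (Num.truncn (1 / theta)).
Proof. by rewrite /M1 /mertens rmorph_sum. Qed.

(** Level 0 gathers theta > 1 and the non-positive theta, for which 1 / theta is non-positive and
    truncates to 0. *)
Lemma truncn_inv_level n : (fun theta : R => Num.truncn (1 / theta)) @^-1` [set n] =
  if n is n'.+1 then `]n.+1%:R^-1, n%:R^-1]%classic else ~` `]0, 1]%classic.
Proof.
have t0 theta : (Num.truncn (1 / theta) == 0%N) = (theta \notin `]0, 1]).
  rewrite -leqn0 leqNgt truncn_gt0 div1r in_itv /=; congr (~~ _).
  have [theta0|theta0] := ltP 0 theta; first by rewrite invf_ge1.
  by apply/negbTE; rewrite -ltNge (le_lt_trans _ ltr01)// invr_le0.
apply/seteqP; case: n => [|n]; split=> theta /=.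
- by move/eqP; rewrite t0 => /negP.
- by move=> h; apply/eqP; rewrite t0; apply/negP.
- move=> tn; have /= := t0 theta; rewrite tn /= => /esym/negbFE.
  rewrite !in_itv /= => /andP[theta0 _].
  have := @truncn_itv R (1 / theta); rewrite tn divr_ge0 ?(ltW theta0)// => /(_ isT).
  rewrite div1r => /andP[h1 h2].
  by rewrite invf_plt ?posrE//= h2 invf_pge ?posrE.
- rewrite in_itv /= => /andP[h1 h2].
  have theta0 : 0 < theta by rewrite (lt_trans _ h1)// invr_gt0.
  apply: truncn_def; rewrite div1r.
  by rewrite invf_plt ?posrE// in h1; rewrite invf_pge ?posrE// in h2; rewrite h1 h2.
Qed.

Lemma measurable_truncn_inv_level n :
  measurable ((fun theta : measurableTypeR R => Num.truncn (1 / theta : R)) @^-1` [set n]).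
Proof.
rewrite truncn_inv_level; case: n => [|n]; last exact: measurable_itv.
by apply: measurableC; exact: measurable_itv.
Qed.

Lemma lebesgue_pos_truncn_inv_level n : (0 < n)%N ->
  lebesgue_pos R ((fun theta : R => Num.truncn (1 / theta)) @^-1` [set n]) =
  ((n%:R * n.+1%:R)^-1)%:E.
Proof.
case: n => // n _; rewrite truncn_inv_level /lebesgue_pos /= /mrestr.
have -> : (`]n.+2%:R^-1, n.+1%:R^-1] `&` `]0, +oo[ = `]n.+2%:R^-1, n.+1%:R^-1] :> set R)%classic.
  apply/setIidl => theta /=; rewrite !in_itv /= andbT => /andP[h _].
  by rewrite (lt_trans _ h)// invr_gt0.
rewrite lebesgue_measure_itv /= lte_fin ltf_pV2 ?posrE// ltr_nat ltnSn.
rewrite -EFinB; congr EFin; rewrite -(natr1 n.+1); have : n.+1%:R != 0 :> R by rewrite pnatr_eq0.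
have : n.+1%:R + 1 != 0 :> R by rewrite natr1 pnatr_eq0.
by move: (n.+1%:R : R) => x x1 x0; field; rewrite x1 x0.
Qed.

(** Level 0 contains ]1, +oo[ and has infinite measure, but the integrand vanishes there since M(0)
    = 0 and 0^r = 0 for r != 0; the summand of index 0 is likewise 0. *)
Lemma integral_powR_M1 r : r != 0 ->
  (\int[lebesgue_pos R]_theta (`|M1 theta| `^ r)%:E =
   \sum_(0 <= n <oo) (`|rmertens n| `^ r / (n%:R * n.+1%:R))%:E)%E.
Proof.
move=> r0; under eq_integral do rewrite M1_rmertens.
have c0 n : 0 <= `|rmertens n| `^ r by exact: powR_ge0.
have -> := integral_nat_levels (lebesgue_pos R) measurable_truncn_inv_level c0.
apply: eq_eseriesr => -[|n] _; last by rewrite lebesgue_pos_truncn_inv_level.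
by rewrite rmertens0 normr0 powR0// mul0r mul0e.
Qed.

Lemma Lnorm_M1_lty r : r != 0 ->
  ('N[lebesgue_pos R]_(r%:E)[EFin \o @M1 R] < +oo)%E <->
  exists B, forall N, \sum_(0 <= n < N) `|rmertens n| `^ r / (n%:R * n.+1%:R) <= B.
Proof.
move=> r0; have := integral_powR_M1 r0.
have term0 n : (0 <= (`|rmertens n| `^ r / (n%:R * n.+1%:R))%:E)%E.
  by rewrite lee_fin divr_ge0 ?powR_ge0// mulr_ge0.
set S := (\sum_(0 <= n <oo) _)%E => IS.
have NS : ('N[lebesgue_pos R]_(r%:E)[EFin \o @M1 R] `^ r)%E = S.
  by rewrite powR_Lnorm// -IS.
have -> : ('N[lebesgue_pos R]_(r%:E)[EFin \o @M1 R] < +oo)%E <-> (S < +oo)%E.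
  by rewrite -NS; split; [exact: poweR_lty|exact: lty_poweRy].
split=> [Sy|[B BP]].
  exists (fine S) => N; rewrite -lee_fin fineK.
    rewrite -sumEFin; exact: nneseries_lim_ge.
  by rewrite ge0_fin_numE// nneseries_ge0.
apply: (@le_lt_trans _ _ B%:E); last exact: ltry.
apply: lime_le; first by apply: is_cvg_nneseries => n _ _.
by apply: nearW => N; rewrite sumEFin lee_fin.
Qed.

End MertensNorm.

(** * Continuation of 1 / zeta from the summability of M(N) *)

Section MertensSeries.
Variable R : realType.
Local Notation C := R[i].
Implicit Types (zeta F G : C -> C) (s z : C) (r sigma B e : R) (n N M : nat).

Lemma bounded_sum_tail (a : nat -> R) B : (forall n, 0 <= a n) ->
  (forall N, \sum_(0 <= n < N) a n <= B) -> exists T : nat -> R,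
    (forall N M, (N <= M)%N -> \sum_(N <= n < M) a n <= T N) /\
    (forall e, 0 < e -> exists N0, forall N, (N0 <= N)%N -> T N <= e).
Proof.
move=> a0 aB; pose v : nat -> R := fun N => \sum_(0 <= n < N) a n.
have vM N M : (N <= M)%N -> v M = v N + \sum_(N <= n < M) a n.
  by move=> NM; rewrite /v (@big_cat_nat _ _ _ N).
have vnd : nondecreasing_seq v.
  by move=> N M NM; rewrite (vM _ _ NM) lerDl sumr_ge0.
have vc : cvgn v.
  by apply: nondecreasing_is_cvgn => //; exists B => _ [N _ <-]; exact: aB.
exists (fun N => limn v - v N); split=> [N M NM|e e0].
  by rewrite lerBrDl -vM// nondecreasing_cvgn_le.
have [N0 _ NP] := (iffLR (cvgrPdist_le v (limn v))) vc e e0.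
by exists N0 => N /NP /=; apply: le_trans; rewrite ler_norm.
Qed.

Lemma npow_sub_bound n s : (0 < n)%N -> 0 <= complex.Re s ->
  normc (npow n (- s) - npow n.+1 (- s)) <=
    5 * normc s * n%:R `^ (- (1 + complex.Re s)).
Proof.
move=> n0 s0; have nR : 0 < n%:R :> R by rewrite ltr0n.
pose lam : R := ln n.+1%:R - ln n%:R.
have /andP[lam1 lam2] := @ln_succ_bounds R n n0; rewrite -/lam in lam1 lam2.
have lam0 : 0 <= lam by apply: le_trans lam1; rewrite invr_ge0.
have -> : npow n (- s) - npow n.+1 (- s) =
    - (npow n (- s) * (cexp (- s * lam%:C) - 1)).
  have -> : npow n.+1 (- s) = npow n (- s) * cexp (- s * lam%:C).
    rewrite /npow -cexpD -mulrDr -rmorphD /lam; congr (cexp (_ * _%:C)).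
    by rewrite addrC subrK.
  by rewrite mulrBr mulr1 opprB.
rewrite normcNE normcM normc_npow// ReN.
have h : normc (cexp (- s * lam%:C) - 1) <= 5 * normc s * n%:R^-1.
  rewrite (le_trans (cexp_sub1_bound _))//.
  have -> : Num.max 1 (expR (complex.Re (- s * lam%:C))) = 1.
    apply/max_idPl; rewrite -expR0 ler_expR ReM ReN /= mulr0 subr0 mulNr oppr_le0.
    by rewrite mulr_ge0.
  rewrite mulr1 normcM normcNE normc_ge0_real// mulrA ler_wpM2l//.
  by rewrite mulr_ge0 ?normc_ge0.
have -> : n%:R `^ (- (1 + complex.Re s)) = n%:R `^ (- complex.Re s) * n%:R^-1.
  rewrite opprD powRD; last by rewrite (gt_eqF nR) implybT.
  by rewrite powR_inv1 1?mulrC// ltW.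
by rewrite mulrCA ler_wpM2l ?powR_ge0.
Qed.

(** Write n^(-1 - sigma) as n^(1 - sigma) n^(-2) and apply Young's inequality to |M(n)| n^(1 -
    sigma) with exponents r and q: the first part is the given series up to a factor 2, the second
    is a convergent sum of powers. *)
Lemma mertens_series_bounded r sigma B : 1 < r -> r^-1 < sigma ->
  (forall N, \sum_(0 <= n < N) `|rmertens R n| `^ r / (n%:R * n.+1%:R) <= B) ->
  exists B', forall N,
    \sum_(0 <= n < N) `|rmertens R n| * n%:R `^ (- (1 + sigma)) <= B'.
Proof.
move=> r1 rs rB; have r0 : 0 < r by exact: lt_trans r1.
pose q := r / (r - 1); have r10 : 0 < r - 1 by rewrite subr_gt0.
have q0 : 0 < q by rewrite divr_gt0.
have rq : r^-1 + q^-1 = 1 by rewrite /q; field; rewrite !gt_eqF.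
have ri : 0 < r^-1 by rewrite invr_gt0.
have qi : 0 < q^-1 by rewrite invr_gt0.
(* d > 0 amounts to 1 - sigma < 1 / q = 1 - 1 / r, that is, sigma > 1 / r. *)
pose d := 1 - (1 - sigma) * q.
have d0 : 0 < d by rewrite subr_gt0 -ltr_pdivlMr// div1r; lra.
(* The 2 comes from 1 / n^2 <= 2 / (n (n + 1)). *)
exists (2 * B + (1 + 1 / d)) => -[|N].
  rewrite big_geq// addr_ge0//; last by rewrite addr_ge0// divr_ge0// ltW.
  by rewrite mulr_ge0//; have := rB 0%N; rewrite big_geq.
rewrite big_ltn// rmertens0 normr0 mul0r add0r.
have := rB N.+1; rewrite (@big_ltn _ _ _ 0)// mul0r invr0 mulr0 add0r => rBN.
apply: (@le_trans _ _ (\sum_(1 <= n < N.+1) (2 * (`|rmertens R n| `^ r / (n%:R * n.+1%:R)) +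
    n%:R `^ (- (1 + d))))).
  rewrite !big_nat; apply: ler_sum => n /andP[n0 _].
  have nR : 0 < n%:R :> R by rewrite ltr0n.
  pose m : R := `|rmertens R n|; rewrite -/m; have m0 : 0 <= m by exact: normr_ge0.
  have mn : m * n%:R `^ (1 - sigma) <= m `^ r + n%:R `^ ((1 - sigma) * q).
    rewrite powRrM (le_trans (conjugate_powR m0 (powR_ge0 _ _) r0 q0 rq))//.
    by rewrite lerD// ler_piMr ?powR_ge0//; lra.
  have n2 : n%:R `^ (- 2) = (n%:R * n%:R)^-1 :> R.
    by rewrite powRN powR_mulrn ?ltW.
  have -> : n%:R `^ (- (1 + sigma)) = n%:R `^ (1 - sigma) * (n%:R * n%:R)^-1.
    rewrite -n2 -powRD; first by congr (_ `^ _); ring.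
    by rewrite (gt_eqF nR) implybT.
  have nn : 0 <= (n%:R * n%:R)^-1 :> R by rewrite invr_ge0 mulr_ge0.
  rewrite [leLHS]mulrA (le_trans (ler_wpM2r nn mn))// mulrDl lerD//; last first.
    rewrite -n2 -powRD; last by rewrite (gt_eqF nR) implybT.
    by rewrite le_eqVlt; apply/orP; left; apply/eqP; congr (_ `^ _); rewrite /d; ring.
  rewrite mulrCA ler_wpM2l ?powR_ge0// -ler_pdivrMl// -invfM lef_pV2 ?posrE ?mulr_gt0//.
  by rewrite (mulrCA 2) ler_pM2l// mulr_natl mulr2n -natrD ler_nat -addn1 leq_add2l.
rewrite big_split /= -mulr_sumr lerD//; last exact: powR_sum_le1.
by rewrite ler_wpM2l.
Qed.

(** Partial summation of the Dirichlet series of the Moebius function, without its boundary term.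
    The term of index 0 vanishes because M(0) = 0. *)
Definition mertens_series N s : C :=
  \sum_(0 <= n < N) (rmertens R n)%:C * (npow n (- s) - npow n.+1 (- s)).

Lemma dirichlet_poly_mertens N s : dirichlet_poly (rmobius R) N s =
  mertens_series N.+1 s + (rmertens R N)%:C * npow N.+1 (- s).
Proof.
rewrite dirichlet_poly_npow; elim: N => [|N IH].
  by rewrite /mertens_series big_nat1 rmertens0 big_geq// !mul0r addr0.
rewrite big_nat_recr//= IH /mertens_series [in RHS]big_nat_recr//=.
have -> : rmertens R N.+1 = rmertens R N + rmobius R N.+1 by rewrite /rmertens big_nat_recr.
rewrite rmorphD /=; ring.
Qed.

Lemma poly_approx_mertens_series N s e : 0 <= e -> poly_approx (mertens_series N) s e.
Proof.
move=> e0; apply: poly_approx_sum => n _.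
have pn k : poly_approx (fun z : C => npow k (- z)) s e.
  apply: poly_approx_ext (poly_approx_cexp (- (ln k%:R)%:C) s e0).
  by move=> z _; rewrite /npow mulrN mulNr.
by apply: poly_approxZ => //; exact: poly_approxB.
Qed.

Lemma rmertens_le n : `|rmertens R n| <= n%:R.
Proof.
rewrite /rmertens (le_trans (ler_norm_sum _ _ _))//.
rewrite (le_trans (ler_sum _ (fun i _ => rmobius_abs_le1 R i)))//.
by rewrite sumr_const_nat subn1.
Qed.

(** The terms are at most 5 |s| |M(n)| n^(-1 - sigma), so convergence is uniform on discs in Re s >=
    sigma. On Re s > 1 the boundary term M(N) (N + 1)^(-s) tends to 0 because |M(N)| <= N, and the
    limit is 1 / zeta. *)
Lemma exists_mertens_series_limit sigma B : 0 < sigma ->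
  (forall N, \sum_(0 <= n < N) `|rmertens R n| * n%:R `^ (- (1 + sigma)) <= B) ->
  exists G, (forall zeta s, is_riemann_zeta zeta -> sigma <= complex.Re s ->
      1 < complex.Re s -> G s = (zeta s)^-1) /\
    forall s rho, 0 <= rho -> sigma + rho <= complex.Re s -> poly_approx G s rho.
Proof.
move=> sg0 aB; pose a n := `|rmertens R n| * n%:R `^ (- (1 + sigma)).
have a0 n : 0 <= a n by rewrite mulr_ge0 ?powR_ge0.
have [T [TP T0]] := bounded_sum_tail a0 aB.
have TN N : 0 <= T N by have := TP N N (leqnn N); rewrite big_geq.
have : forall s, exists l, sigma <= complex.Re s ->
    forall N, normc (l - mertens_series N s) <= 5 * normc s * T N.
  move=> s; have [ss|ss] := leP sigma (complex.Re s); last by exists 0.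
  have [||l lP] := @complex_cauchy_limit R (fun N => mertens_series N s)
      (fun N => 5 * normc s * T N); last by exists l => _.
  - move=> N M NM; rewrite /mertens_series (@big_cat_nat _ _ _ N)//= addrAC subrr add0r.
    rewrite (le_trans (normc_sum _ _ _))//.
    rewrite (le_trans _ (ler_wpM2l _ (TP N M NM))) ?mulr_ge0 ?normc_ge0// mulr_sumr.
    apply: ler_sum => -[|n] _; first by rewrite /a rmertens0 mul0r normc0 normr0 mul0r mulr0.
    rewrite normcM normc_real /a mulrCA ler_wpM2l//.
    rewrite (le_trans (npow_sub_bound _ _))//; first by rewrite (le_trans (ltW sg0)).
    rewrite ler_wpM2l ?mulr_ge0 ?normc_ge0// ler_powR ?ler1n//.
    by rewrite lerN2 lerD2l.
  - move=> e e0; have n1 : 0 < 5 * normc s + 1 by have := normc_ge0 s; lra.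
    have [N0 /(_ N0 (leqnn _)) NP] := T0 _ (divr_gt0 e0 n1).
    exists N0; rewrite ler_pdivlMr// in NP; apply: le_trans NP.
    by rewrite [leRHS]mulrC ler_wpM2r// lerDl.
move=> /choice[G GP]; exists G; split=> [zeta s zP ss s1|s rho rho0 ss].
  apply/eqP; rewrite -subr_eq0 -normc_eq0 eq_le normc_ge0 andbT.
  apply/ler_addgt0Pr => e e0; rewrite add0r.
  pose d := complex.Re s - 1; have d0 : 0 < d by rewrite subr_gt0.
  have e3 : 0 < e / 3 by rewrite divr_gt0.
  have n1 : 0 < 5 * normc s + 1 by have := normc_ge0 s; lra.
  have [N1 N1P] := T0 _ (divr_gt0 e3 n1).
  have [N2 [_ N2P]] := exists_powR_le d0 e3.
  have [N3 [_ N3P]] := exists_powR_le d0 (mulr_gt0 e3 d0).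
  pose N := (maxn N1 (maxn N2 N3)).+1.
  have N1N : (N1 <= N)%N by rewrite ltnW// ltnS leq_maxl.
  have N2N : (N2 <= N)%N by rewrite ltnW// ltnS !leq_max leqnn orbT.
  have N3N : (N3 <= N)%N by rewrite ltnW// ltnS !leq_max leqnn !orbT.
  have h1 : normc (G s - mertens_series N.+1 s) <= e / 3.
    rewrite (le_trans (GP s ss N.+1))//.
    have := N1P N.+1 (leqW N1N); rewrite ler_pdivlMr//; apply: le_trans.
    by rewrite [leRHS]mulrC ler_wpM2r// lerDl.
  have h2 : normc ((rmertens R N)%:C * npow N.+1 (- s)) <= e / 3.
    rewrite normcM normc_real normc_npow// ReN (le_trans _ (N2P N.+1 (leqW N2N)))//.
    have -> : - d = 1 + - complex.Re s by rewrite /d; ring.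
    rewrite powRD; last by rewrite pnatr_eq0 implybT.
    rewrite powRr1// ler_wpM2r ?powR_ge0// (le_trans (rmertens_le _))//.
    by rewrite ler_nat.
  have [_ h3] := mobius_dirichlet_tail zP s1 (ltn0Sn (maxn N1 (maxn N2 N3))).
  have {}h3 : normc ((zeta s)^-1 - dirichlet_poly (rmobius R) N s) <= e / 3.
    by rewrite (le_trans h3)// ler_pdivrMr// N3P.
  rewrite dirichlet_poly_mertens in h3.
  set S := mertens_series _ _ in h1 h3; set u := (_ * _) in h2 h3.
  have -> : G s - (zeta s)^-1 = (G s - S) - u - ((zeta s)^-1 - (S + u)) by ring.
  rewrite (le_trans (normcB _ _))// (le_trans (lerD (normcB _ _) (lexx _)))//; lra.
apply: poly_approx_lim => e e0.
have n1 : 0 < 5 * (normc s + rho) + 1 by have := normc_ge0 s; lra.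
have [N /(_ N (leqnn _)) NP] := T0 _ (divr_gt0 e0 n1).
exists (mertens_series N); first exact: poly_approx_mertens_series.
move=> z zr; have sz : sigma <= complex.Re (s + z).
  have := le_trans (Re_le_normc z) zr; rewrite ler_norml ReD => /andP[h _].
  by move: ss h; move: (complex.Re s) (complex.Re z) => u v; lra.
rewrite (le_trans (GP _ sz N))//; rewrite ler_pdivlMr// in NP; apply: le_trans NP.
rewrite [leRHS]mulrC ler_wpM2r//; have := normcD s z; lra.
Qed.

(* By partial summation [1 / zeta] has a convergent series on [Re s > sigma],
   hence no pole there. *)
Lemma zeta_neq0_of_mertens zeta sigma B s : is_riemann_zeta zeta -> 0 < sigma ->
  (forall N, \sum_(0 <= n < N) `|rmertens R n| * n%:R `^ (- (1 + sigma)) <= B) ->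
  sigma < complex.Re s -> s != 1 -> zeta s != 0.
Proof.
move=> zP sg0 aB ss sn1; have [s1|s1] := ltP 1 (complex.Re s).
  by have [] := mobius_dirichlet_tail zP s1 (ltn0Sn 0).
have [G [Gz Ga]] := exists_mertens_series_limit sg0 aB.
have [F FP] := exists_regularized_zeta R.
(* [h] vanishes near [c], where G = 1 / zeta and F = (w - 1) zeta. A single disc of radius 2 - sigma
   about [c] reaches [s], since [c] has the same ordinate. *)
pose h w := G w * F w - (w - 1); pose c : C := 2 +i* complex.Im s.
have rho0 : 0 <= 2 - sigma by lra.
have ha : poly_approx h c (2 - sigma).
  apply: poly_approxB; first apply: poly_approxM => //.
  - by apply: Ga => //=; lra.
  - by apply: regularized_zeta_approx => //=; rewrite rho0 /=; lra.
  - by apply: poly_approxB; [exact: poly_approx_id|exact: poly_approx_cst].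
have h0 z : normc z <= 2^-1 -> h (c + z) = 0.
  move=> zr; have cz : 1 < complex.Re (c + z).
    have := le_trans (Re_le_normc z) zr; rewrite ler_norml ReD /= => /andP[h1 _].
    by move: h1; move: (complex.Re z) => x; lra.
  have [z0 _] := mobius_dirichlet_tail zP cz (ltn0Sn 0).
  rewrite /h (Gz zeta)//; last by lra.
  by rewrite (regularized_zetaE_gt1 zP FP cz) mulrCA mulVf// mulr1 subrr.
have dr : 0 < (2^-1 : R) <= 2 - sigma by lra.
have := poly_approx_identity ha dr h0 (z := s - c).
have -> : c + (s - c) = s by ring.
have -> : normc (s - c) = 2 - complex.Re s.
  have -> : s - c = (complex.Re s - 2)%:C.
    by apply/eqP; rewrite eq_complex ReD ReN ImD ImN /= subrr !eqxx.
  by rewrite normc_real distrC ger0_norm//; lra.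
have s0 : 0 < complex.Re s by lra.
rewrite /h (regularized_zetaE zP FP s0 sn1) => h1.
(* At a zero of zeta the relation G F = s - 1 would force s = 1. *)
apply: contra_neq sn1 => z0; apply/eqP; rewrite -subr_eq0; apply/eqP.
have : G s * ((s - 1) * zeta s) - (s - 1) = 0 by apply: h1; lra.
by rewrite z0 !mulr0 sub0r => /eqP; rewrite oppr_eq0 => /eqP.
Qed.

End MertensSeries.

(** * The two implications *)

(** Every defect vanishes at s = 1. Since the value of zeta at 1 is unconstrained, the non-vanishing
    of F there has to come from the series itself. *)
Lemma regularized_zeta1 (R : realType) (F : R[i] -> R[i]) : regularized_zeta F -> F 1 = 1.
Proof.
move=> FP; apply/eqP; rewrite -subr_eq0 -normc_eq0 eq_le normc_ge0 andbT.
apply/ler_addgt0Pr => e e0; rewrite add0r.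
have K0 : 0 < zeta_defect_const R * (1 + normc (1 : R[i])) ^+ 2.
  by rewrite mulr_gt0 ?zeta_defect_const_gt0// exprn_gt0// ltr_pwDl// normc_ge0.
have [N [N0 /(_ N (leqnn N)) NP]] := exists_powR_le (@ltr01 R) (divr_gt0 e0 K0).
have Z1 : zeta_partial N (1 : R[i]) = 1.
  rewrite zeta_partialE subrr mul0r addr0 /npow mul0r.
  exact: cexp0.
have := FP 1 N ltr01 N0; rewrite Z1 => h; rewrite (le_trans h)//.
by rewrite divr1 mulrC -ler_pdivlMr.
Qed.

Lemma mertens_norm_bounded (R : realType) (zeta : R[i] -> R[i]) (alpha r : R) :
  is_riemann_zeta zeta -> 0 < alpha -> 1 < r -> r < alpha^-1 ->
  (forall s, s != 1 -> alpha < complex.Re s -> zeta s != 0) ->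
  exists B, forall N, \sum_(0 <= n < N) `|rmertens R n| `^ r / (n%:R * n.+1%:R) <= B.
Proof.
move=> zP al0 r1 ra z0; have r0 : 0 < r by exact: lt_trans r1.
have [F FP] := exists_regularized_zeta R.
have F0 s : alpha < complex.Re s -> F s != 0.
  move=> sa; have [->|s1] := eqVneq s 1; first by rewrite regularized_zeta1// oner_eq0.
  rewrite (regularized_zetaE zP FP (lt_trans al0 sa) s1) mulf_neq0 ?subr_eq0//.
  exact: z0.
have ai : alpha < r^-1 by rewrite -[alpha]invrK ltf_pV2 ?posrE ?invr_gt0.
have ri : r^-1 < 1 by rewrite invf_lt1.
(* Makes alpha + 5 delta the midpoint of alpha and 1 / r, so that M(n)^r / n^2 is O(n^(-1 - d)) with
   d > 0. *)
pose delta := (r^-1 - alpha) / 10.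
have de0 : 0 < delta by rewrite divr_gt0// subr_gt0.
have ad1 : alpha + 5 * delta < 1 by rewrite /delta; lra.
have [D DP] := mertens_bound zP FP al0 de0 ad1 F0.
set th := alpha + 5 * delta in ad1 DP.
have tr : th < r^-1 by rewrite /th /delta; lra.
pose d := 1 - th * r; have d0 : 0 < d by rewrite subr_gt0 -ltr_pdivlMr// div1r.
have D0 : 0 <= D by have := DP 1%N isT; rewrite powR1 mulr1; apply: le_trans.
exists (D `^ r * (1 + 1 / d)) => -[|N].
  by rewrite big_geq// mulr_ge0 ?powR_ge0// addr_ge0// divr_ge0// ltW.
rewrite big_ltn// mul0r invr0 mulr0 add0r.
rewrite (le_trans _ (ler_wpM2l (powR_ge0 _ _) (powR_sum_le1 N d0)))// mulr_sumr.
rewrite !big_nat; apply: ler_sum => n /andP[n0 _].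
have nR : 0 < n%:R :> R by rewrite ltr0n.
have -> : n%:R `^ (- (1 + d)) = n%:R `^ (th * r) * (n%:R * n%:R)^-1 :> R.
  rewrite -[_ * n%:R]expr2 -powR_mulrn ?ltW// -powRN -powRD; last by rewrite (gt_eqF nR) implybT.
  by congr (_ `^ _); rewrite /d; ring.
rewrite mulrA ler_pM ?powR_ge0 ?invr_ge0 ?mulr_ge0//.
  rewrite powRrM -powRM ?powR_ge0//.
  by rewrite ge0_ler_powR ?nnegrE ?mulr_ge0 ?powR_ge0 ?(ltW r0)// DP.
by rewrite lef_pV2 ?posrE ?mulr_gt0// ler_pM2l// ler_nat.
Qed.

Theorem proposition2p3 (R : realType) (zeta : R[i] -> R[i])
    (zetaP : is_riemann_zeta zeta) (p : R) (p_gt1 : 1 < p) :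
  (forall s : R[i], s != 1 -> 1 / p < complex.Re s -> zeta s != 0) <->
  (forall r : R, 1 < r -> r < p ->
    ('N[lebesgue_pos R]_(r%:E)[EFin \o @M1 R] < +oo)%E).
Proof.
have p0 : 0 < p by exact: lt_trans p_gt1.
rewrite div1r; split=> [z0 r r1 rp|Mr s s1 ps].
  apply/Lnorm_M1_lty; first by rewrite gt_eqF// (lt_trans _ r1).
  by apply: mertens_norm_bounded z0; rewrite ?invr_gt0 ?invrK.
have pi : p^-1 < 1 by rewrite invf_lt1.
have pi0 : 0 < p^-1 by rewrite invr_gt0.
(* Strictly between 1 / p and both Re s and 1; the exponent [r] below has 1 / r strictly between 1 /
   p and sigma. Then 1 / r < 1 gives r > 1, and 1 / r > 1 / p gives r < p. *)
pose sigma := (p^-1 + Num.min 1 (complex.Re s)) / 2.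
have [ps' s2 s3] : [/\ p^-1 < sigma, sigma < complex.Re s & sigma < 1].
  by rewrite /sigma; case: (leP 1 (complex.Re s)) => h; split; lra.
pose r := ((p^-1 + sigma) / 2)^-1.
have rs : r^-1 < sigma by rewrite invrK; lra.
have r1 : 1 < r by rewrite invf_gt1; lra.
have rp : r < p by rewrite -[p]invrK ltf_pV2 ?posrE//; lra.
have r0 : r != 0 by rewrite gt_eqF// (lt_trans _ r1).
have [B BP] := (iffLR (Lnorm_M1_lty r0)) (Mr r r1 rp).
have [B' BP'] := mertens_series_bounded r1 rs BP.
by apply: (zeta_neq0_of_mertens zetaP _ BP' s2 s1); rewrite (lt_trans pi0).
Qed.
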